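(* Let $b,c\in\mathbb{N}$ and let $\theta\in\mathbb{R}$ be fixed with $0<\theta\le 1/2$. (i) If $1<c<b$, then as $T\to\infty$ $$M_{1,1,b,c}^{\theta}(T)=T\,K_{b,c}(\log T)-C'_{1,c,b}T^{1-\theta(1/2-1/(2c))}-C'_{1,b,c}T^{1-\theta(1/2-1/(2b))}+O\big(T^{1-\theta/2}(\log T)^{13/4}+T^{1/2+\theta}\big).$$ (ii) If $b=c>1$, then $$M_{1,1,b,b}^{\theta}(T)=T\,K_{b,b}(\log T)-G_b(\log T)\,T^{1-\theta(1/2-1/(2b))}+O\big(T^{1-\theta/2}(\log T)^{13/4}+T^{1/2+\theta}\big).$$
   Context: For $\theta>0$ and real $\sigma$, $\tau>0$, let $D_\theta(\sigma+i\tau)=\sum_{1\le n\le (\tau/2\pi)^{\theta}} n^{-\sigma-i\tau}$, and $$M_{1,1,b,c}^{\theta}(T)=\int_0^T |D_\theta(1/2+it)|^2\,\zeta(1/2-ibt)\,\zeta(1/2-ict)\,dt.$$ Let $\gamma$ be Euler's constant, $\lambda_\theta=2/\theta-1$, and $K_{1,r,s}=\zeta((1+r)/2)\zeta((1+s)/2)$. Define $$B_{r,s}=r\zeta'\Big(\frac{1+r}{2}\Big)\zeta\Big(\frac{1+s}{2}\Big)+s\zeta'\Big(\frac{1+s}{2}\Big)\zeta\Big(\frac{1+r}{2}\Big)+K_{1,r,s}\gamma,$$ $$K_{r,s}(x)=\theta K_{1,r,s}x+B_{r,s}-\theta K_{1,r,s}-\theta K_{1,r,s}\log 2\pi.$$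 For $r>1$: $C_{1,r,s}=\frac{4r}{\theta(r-1)(\lambda_\theta r+1)}\zeta(\frac{s}{2r}+\frac12)(2\pi)^{\theta(1/2-1/(2r))}$ and $C'_{1,r,s}=\zeta(\frac12+\frac1{2r})C_{1,r,s}$. Also $E_{0,r}=\frac{4\gamma}{r-1}+\frac{4}{(r-1)^2}$, $E_{1,r}=\frac{2}{r(r-1)}$, $F_{0,r}=\frac{4\gamma}{\lambda_\theta r+1}-\frac{4}{(\lambda_\theta r+1)^2}$, $F_{1,r}=\frac{2}{r(\lambda_\theta r+1)}$, $E'_{0,r}=\zeta(\frac12+\frac1{2r})E_{0,r}+\frac{2\zeta'(\frac12+\frac1{2r})}{r(r-1)}$, $E'_{1,r}=\zeta(\frac12+\frac1{2r})E_{1,r}$, $F'_{0,r}=\zeta(\frac12+\frac1{2r})F_{0,r}+\frac{2\zeta'(\frac12+\frac1{2r})}{r(r\lambda_\theta+1)}$, $F'_{1,r}=\zeta(\frac12+\frac1{2r})F_{1,r}$, $H'_{0,r}=E'_{0,r}+F'_{0,r}$, $H'_{1,r}=E'_{1,r}+F'_{1,r}$, and $$G_r(x)=(2\pi)^{\theta(1/2-1/(2r))}\big(\theta H'_{1,r}x+H'_{0,r}-\theta H'_{1,r}\log 2\pi\big).$$ Implied constants depend on $b,c,\theta$. *)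

(* Defs.v *)
From Stdlib Require Import Reals.
From Coquelicot Require Import Coquelicot.
Open Scope R_scope.

(* n^{-(sigma + i tau)} for n >= 1, as a complex number:
   n^{-sigma} (cos(tau log n) - i sin(tau log n)). *)
Definition npow_neg (n : nat) (sigma tau : R) : C :=
  (Rpower (INR n) (- sigma) * cos (tau * ln (INR n)),
   - (Rpower (INR n) (- sigma) * sin (tau * ln (INR n))))%R.

Definition eta_partial (sigma tau : R) (N : nat) : C :=
  sum_n (fun k => Cmult (RtoC ((-1) ^ k)) (npow_neg (S k) sigma tau)) N.

(* Dirichlet eta function (convergent for Re s > 0), real and imaginary parts as limits. *)
Definition eta (sigma tau : R) : C :=
  (real (Lim_seq (fun N => fst (eta_partial sigma tau N))),
   real (Lim_seq (fun N => snd (eta_partial sigma tau N)))).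

Definition two_pow_1ms (sigma tau : R) : C :=
  (Rpower 2 (1 - sigma) * cos (tau * ln 2), - (Rpower 2 (1 - sigma) * sin (tau * ln 2)))%R.

(* Riemann zeta function zeta(sigma + i tau) on the half plane sigma > 0 (its analytic
   continuation there, via zeta(s) = eta(s) / (1 - 2^{1-s})).  Only used for sigma > 0, s <> 1. *)
Definition zeta (sigma tau : R) : C :=
  Cdiv (eta sigma tau) (Cminus (RtoC 1) (two_pow_1ms sigma tau)).

(* zeta restricted to real arguments x > 0, x <> 1 (it is real-valued there) and its derivative. *)
Definition zetaR (x : R) : R := fst (zeta x 0).
Definition zetaR' (x : R) : R := Derive zetaR x.

Definition euler_gamma : R :=
  real (Lim_seq (fun n => sum_n (fun k => / INR (S k)) n - ln (INR (S n)))).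

(* floor of x, as a natural number (0 for x < 0) *)
Definition nat_floor (x : R) : nat := Z.to_nat (Int_part x).

(* D_theta(sigma + i tau) = sum_{1 <= n <= (tau/2pi)^theta} n^{-sigma - i tau}, for tau > 0
   (set to the empty sum for tau <= 0, only the measure-zero point tau = 0 of the integral). *)
Definition Dtheta (theta sigma tau : R) : C :=
  if Rlt_dec 0 tau then
    sum_n (fun n => match n with O => RtoC 0 | _ => npow_neg n sigma tau end)
          (nat_floor (Rpower (tau / (2 * PI)) theta))
  else RtoC 0.

Definition Mintegrand (theta b c t : R) : C :=
  Cmult (RtoC (Cmod (Dtheta theta (1/2) t) ^ 2))
        (Cmult (zeta (1/2) (- (b * t))) (zeta (1/2) (- (c * t)))).

Definition M11 (theta b c T : R) : C :=
  (RInt (fun t => fst (Mintegrand theta b c t)) 0 T,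
   RInt (fun t => snd (Mintegrand theta b c t)) 0 T).

Definition lambda_theta (theta : R) : R := 2 / theta - 1.
Definition K1 (r s : R) : R := zetaR ((1 + r) / 2) * zetaR ((1 + s) / 2).
Definition Bcoef (r s : R) : R :=
  r * zetaR' ((1 + r) / 2) * zetaR ((1 + s) / 2)
  + s * zetaR' ((1 + s) / 2) * zetaR ((1 + r) / 2) + K1 r s * euler_gamma.
Definition Kpoly (theta r s x : R) : R :=
  theta * K1 r s * x + Bcoef r s - theta * K1 r s - theta * K1 r s * ln (2 * PI).

Definition C1 (theta r s : R) : R :=
  4 * r / (theta * (r - 1) * (lambda_theta theta * r + 1)) * zetaR (s / (2 * r) + 1 / 2)
  * Rpower (2 * PI) (theta * (1 / 2 - 1 / (2 * r))).
Definition C1' (theta r s : R) : R := zetaR (1 / 2 + 1 / (2 * r)) * C1 theta r s.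

Definition E0 (r : R) : R := 4 * euler_gamma / (r - 1) + 4 / (r - 1) ^ 2.
Definition E1 (r : R) : R := 2 / (r * (r - 1)).
Definition F0 (theta r : R) : R :=
  4 * euler_gamma / (lambda_theta theta * r + 1) - 4 / (lambda_theta theta * r + 1) ^ 2.
Definition F1 (theta r : R) : R := 2 / (r * (lambda_theta theta * r + 1)).
Definition E0' (r : R) : R :=
  zetaR (1 / 2 + 1 / (2 * r)) * E0 r + 2 * zetaR' (1 / 2 + 1 / (2 * r)) / (r * (r - 1)).
Definition E1' (r : R) : R := zetaR (1 / 2 + 1 / (2 * r)) * E1 r.
Definition F0' (theta r : R) : R :=
  zetaR (1 / 2 + 1 / (2 * r)) * F0 theta r
  + 2 * zetaR' (1 / 2 + 1 / (2 * r)) / (r * (r * lambda_theta theta + 1)).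
Definition F1' (theta r : R) : R := zetaR (1 / 2 + 1 / (2 * r)) * F1 theta r.
Definition H0' (theta r : R) : R := E0' r + F0' theta r.
Definition H1' (theta r : R) : R := E1' r + F1' theta r.
Definition Gpoly (theta r x : R) : R :=
  Rpower (2 * PI) (theta * (1 / 2 - 1 / (2 * r)))
  * (theta * H1' theta r * x + H0' theta r - theta * H1' theta r * ln (2 * PI)).

Definition err (theta T : R) : R :=
  Rpower T (1 - theta / 2) * Rpower (ln T) (13 / 4) + Rpower T (1 / 2 + theta).

(* Main.v *)
(* Expand [|D_theta|^2] and, for each [t], replace [zeta(1/2 - ibt)] and [zeta(1/2 - ict)] by averages of
   long partial sums; averaging over the cut-off makes the pole terms negligible.  With
   [X = (T/2pi)^theta], an integer [m] enters [D_theta] at the time [t_m = 2pi m^{1/theta}], so the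
   diagonal [m = n k^b l^c] contributes
     [sum_{n,k,l} n^{-1} k^{-(1+b)/2} l^{-(1+c)/2} max(0, T - t_{n k^b l^c})].
   The off-diagonal terms carry [1 / ln(n k^b l^c / m)]; splitting the ranges of [k] and [l] at about
   [sqrt X], double partial summation with the van der Corput bound for [sum_k k^{-1/2 + ibt}] bounds them
   dyadically by [X sqrt T = O(T^{1/2 + theta})].
   The diagonal equals [T * V(X)].  The hyperbola method evaluates [sum_{k^b l^c <= x} k^{-(1+b)/2}
   l^{-(1+c)/2}] as a constant plus secondary terms [x^{-1/2 + 1/2b}], [x^{-1/2 + 1/2c}] up to
   [O(x^{-1/2})].  Summing over [n], the constant produces [K_{b,c}(log T)], the secondary terms produce the
   powers [T^{1 - theta(1/2 - 1/2b)}], and the error costs only [T X^{-1/2} = O(T^{1 - theta/2})]. *)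

Require Import Defs.
From Stdlib Require Import Reals ZArith Lra Lia.
From Coquelicot Require Import Coquelicot.
Open Scope R_scope.

(** * Finite sums and real powers *)

(** No functional equation is available: [zeta] is given through the eta series, so everything rests
    on partial sums minus their pole term. With [N] terms the error is about
    [N^{-1/2} + tau^2 N^{-3/2}], which forces [N >= tau^2]; there the pole term [N^{1-s}/(1-s)] has
    size at least about 1, and averaging is what brings the total error down to [O(1/tau)]. The
    bound [tau^{1/4}] for partial sums makes a product of two of them [O(sqrt T)], exactly what the
    off-diagonal can afford. The integral is cut into windows [[T/2, T]]: as [b, c >= 2], both
    heights [b t] and [c t] are at least [T] there, one cut-off serves the whole window, and the
    errors of the windows sum geometrically. The hypothesis [theta <= 1/2] enters the off-diagonal
    estimate as [X <= sqrt T], so that [X^2] fits into [X sqrt T]. On the diagonal, comparing the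
    sum over [n] with an integral leaves the integral of [e(x)/x], where [e] is the error of the
    hyperbola method; its value is read off from a convergent double series with logarithms, and
    this is where the derivatives in [K_{b,c}] come from. *)

Fixpoint rsum (f : nat -> R) (n : nat) : R :=
  match n with O => 0 | S m => rsum f m + f (S m) end.

Fixpoint csum (f : nat -> C) (n : nat) : C :=
  match n with O => RtoC 0 | S m => Cplus (csum f m) (f (S m)) end.

Lemma rsum_ext f g n : (forall k, (1 <= k <= n)%nat -> f k = g k) -> rsum f n = rsum g n.
Proof.
  induction n as [|n IH]; intros H; simpl; auto.
  rewrite IH, H; auto; intros; try lia. apply H; lia.
Qed.

Lemma csum_ext f g n : (forall k, (1 <= k <= n)%nat -> f k = g k) -> csum f n = csum g n.
Proof.
  induction n as [|n IH]; intros H; simpl; auto.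
  rewrite IH, H; auto; intros; try lia. apply H; lia.
Qed.

Lemma rsum_plus f g n : rsum (fun k => f k + g k) n = rsum f n + rsum g n.
Proof. induction n as [|n IH]; simpl; [ring|rewrite IH; ring]. Qed.

Lemma rsum_minus f g n : rsum (fun k => f k - g k) n = rsum f n - rsum g n.
Proof. induction n as [|n IH]; simpl; [ring|rewrite IH; ring]. Qed.

Lemma rsum_scal a f n : rsum (fun k => a * f k) n = a * rsum f n.
Proof. induction n as [|n IH]; simpl; [ring|rewrite IH; ring]. Qed.

Lemma rsum_scal_r a f n : rsum (fun k => f k * a) n = rsum f n * a.
Proof. induction n as [|n IH]; simpl; [ring|rewrite IH; ring]. Qed.

Lemma csum_plus f g n : csum (fun k => Cplus (f k) (g k)) n = Cplus (csum f n) (csum g n).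
Proof. induction n as [|n IH]; simpl; [ring|rewrite IH; ring]. Qed.

Lemma csum_minus f g n : csum (fun k => Cminus (f k) (g k)) n = Cminus (csum f n) (csum g n).
Proof. induction n as [|n IH]; simpl; [ring|rewrite IH; ring]. Qed.

Lemma csum_scal a f n : csum (fun k => Cmult a (f k)) n = Cmult a (csum f n).
Proof. induction n as [|n IH]; simpl; [ring|rewrite IH; ring]. Qed.

Lemma csum_scal_r a f n : csum (fun k => Cmult (f k) a) n = Cmult (csum f n) a.
Proof. induction n as [|n IH]; simpl; [ring|rewrite IH; ring]. Qed.

Lemma csum_RtoC f n : csum (fun k => RtoC (f k)) n = RtoC (rsum f n).
Proof. induction n as [|n IH]; simpl; auto. rewrite IH, RtoC_plus; auto. Qed.

Lemma rsum_le f g n : (forall k, (1 <= k <= n)%nat -> f k <= g k) -> rsum f n <= rsum g n.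
Proof.
  induction n as [|n IH]; intros H; simpl; [lra|].
  apply Rplus_le_compat; [apply IH; intros|]; apply H; lia.
Qed.

Lemma rsum_nonneg f n : (forall k, (1 <= k <= n)%nat -> 0 <= f k) -> 0 <= rsum f n.
Proof.
  induction n as [|n IH]; intros H; simpl; [lra|].
  apply Rplus_le_le_0_compat; [apply IH; intros|]; apply H; lia.
Qed.

Lemma rsum_const a n : rsum (fun _ => a) n = INR n * a.
Proof. induction n as [|n IH]; [simpl; ring|]. rewrite S_INR; simpl; rewrite IH; ring. Qed.

Lemma csum_const a n : csum (fun _ => a) n = Cmult (RtoC (INR n)) a.
Proof.
  induction n as [|n IH]; [simpl; ring|]. rewrite S_INR, RtoC_plus; simpl; rewrite IH; ring.
Qed.

Lemma rsum_zero n : rsum (fun _ => 0) n = 0.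
Proof. rewrite rsum_const; ring. Qed.

Lemma csum_Cmod_le f n : Cmod (csum f n) <= rsum (fun k => Cmod (f k)) n.
Proof.
  induction n as [|n IH]; simpl; [rewrite Cmod_0; lra|].
  eapply Rle_trans; [apply Cmod_triangle|]; lra.
Qed.

Lemma rsum_Rabs_le f n : Rabs (rsum f n) <= rsum (fun k => Rabs (f k)) n.
Proof.
  induction n as [|n IH]; simpl; [rewrite Rabs_R0; lra|].
  eapply Rle_trans; [apply Rabs_triang|]; lra.
Qed.

Lemma csum_bound f g n :
  (forall k, (1 <= k <= n)%nat -> Cmod (f k) <= g k) -> Cmod (csum f n) <= rsum g n.
Proof. intros H; eapply Rle_trans; [apply csum_Cmod_le|]; apply rsum_le; auto. Qed.

Lemma rsum_bound f g n :
  (forall k, (1 <= k <= n)%nat -> Rabs (f k) <= g k) -> Rabs (rsum f n) <= rsum g n.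
Proof. intros H; eapply Rle_trans; [apply rsum_Rabs_le|]; apply rsum_le; auto. Qed.

Lemma rsum_app f m n : rsum f (m + n) = rsum f m + rsum (fun k => f (m + k)%nat) n.
Proof.
  induction n as [|n IH]; simpl; [rewrite Nat.add_0_r; ring|].
  rewrite Nat.add_succ_r; simpl; rewrite IH; ring.
Qed.

Lemma csum_app f m n : csum f (m + n) = Cplus (csum f m) (csum (fun k => f (m + k)%nat) n).
Proof.
  induction n as [|n IH]; simpl; [rewrite Nat.add_0_r; ring|].
  rewrite Nat.add_succ_r; simpl; rewrite IH; ring.
Qed.

Lemma rsum_mono f m n :
  (m <= n)%nat -> (forall k, (m < k <= n)%nat -> 0 <= f k) -> rsum f m <= rsum f n.
Proof.
  intros Hmn H. replace n with (m + (n - m))%nat by lia. rewrite rsum_app.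
  assert (0 <= rsum (fun k => f (m + k)%nat) (n - m)); [|lra].
  apply rsum_nonneg; intros; apply H; lia.
Qed.

Lemma rsum_trunc f m n :
  (m <= n)%nat -> (forall k, (m < k <= n)%nat -> f k = 0) -> rsum f n = rsum f m.
Proof.
  intros Hmn H. replace n with (m + (n - m))%nat by lia. rewrite rsum_app.
  rewrite (rsum_ext (fun k => f (m + k)%nat) (fun _ => 0)), rsum_zero; [ring|]. intros; apply H; lia.
Qed.

Lemma rsum_swap f m n :
  rsum (fun i => rsum (fun j => f i j) n) m = rsum (fun j => rsum (fun i => f i j) m) n.
Proof.
  induction m as [|m IH]; simpl; [rewrite rsum_zero; auto|].
  rewrite IH, <- rsum_plus; auto.
Qed.

Lemma rsum_single f n j :
  (1 <= j <= n)%nat -> (forall k, (1 <= k <= n)%nat -> k <> j -> f k = 0) -> rsum f n = f j.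
Proof.
  intros Hj H. induction n as [|n IH]; [lia|]. simpl.
  destruct (Nat.eq_dec j (S n)) as [->|Hn].
  - rewrite (rsum_ext _ (fun _ => 0)), rsum_zero; [ring|]. intros; apply H; lia.
  - rewrite IH, (H (S n)); try lia; [ring|]. intros; apply H; lia.
Qed.

Lemma rsum_tele (u : nat -> R) n : rsum (fun k => u k - u (S k)) n = u 1%nat - u (S n).
Proof. induction n as [|n IH]; simpl; [ring|]. rewrite IH; ring. Qed.

Lemma csum_tele (u : nat -> C) n :
  csum (fun k => Cminus (u k) (u (S k))) n = Cminus (u 1%nat) (u (S n)).
Proof. induction n as [|n IH]; simpl; [ring|]. rewrite IH; ring. Qed.

Lemma rsum_prod f g m n :
  rsum (fun i => rsum (fun j => f i * g j) n) m = rsum f m * rsum g n.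
Proof.
  rewrite <- rsum_scal_r. apply rsum_ext; intros. apply rsum_scal.
Qed.

Lemma csum_prod f g m n :
  csum (fun i => csum (fun j => Cmult (f i) (g j)) n) m = Cmult (csum f m) (csum g n).
Proof.
  rewrite <- csum_scal_r. apply csum_ext; intros. apply csum_scal.
Qed.

(** * Partial summation in one and two variables *)

Lemma csum_abel a c n :
  csum (fun k => Cmult (a k) (c k)) (S n) =
  Cplus (Cmult (csum a (S n)) (c (S n)))
        (csum (fun k => Cmult (csum a k) (Cminus (c k) (c (S k)))) n).
Proof.
  induction n as [|n IH]; [simpl; ring|].
  change (csum (fun k => Cmult (a k) (c k)) (S (S n))) with
    (Cplus (csum (fun k => Cmult (a k) (c k)) (S n)) (Cmult (a (S (S n))) (c (S (S n))))).
  rewrite IH. simpl. ring.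
Qed.

Lemma abel_bound a c n A :
  (forall j, (1 <= j <= S n)%nat -> Cmod (csum a j) <= A) ->
  Cmod (csum (fun k => Cmult (a k) (c k)) (S n)) <=
  A * (rsum (fun k => Cmod (Cminus (c k) (c (S k)))) n + Cmod (c (S n))).
Proof.
  intros H. rewrite csum_abel.
  eapply Rle_trans; [apply Cmod_triangle|]. rewrite Cmod_mult.
  assert (Cmod (csum a (S n)) * Cmod (c (S n)) <= A * Cmod (c (S n))).
  { apply Rmult_le_compat_r; [apply Cmod_ge_0|apply H; lia]. }
  assert (Cmod (csum (fun k => Cmult (csum a k) (Cminus (c k) (c (S k)))) n) <=
     rsum (fun k => A * Cmod (Cminus (c k) (c (S k)))) n).
  { apply csum_bound; intros. rewrite Cmod_mult.
    apply Rmult_le_compat_r; [apply Cmod_ge_0|apply H; lia]. }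
  rewrite rsum_scal in H1. lra.
Qed.

Lemma abel_mono a (d : nat -> R) n A :
  (forall j, (1 <= j <= n)%nat -> Cmod (csum a j) <= A) ->
  (forall k, (1 <= k <= n)%nat -> 0 <= d k) ->
  (forall k, (1 <= k < n)%nat -> d (S k) <= d k) -> 0 <= A -> 0 <= d 1%nat ->
  Cmod (csum (fun k => Cmult (a k) (RtoC (d k))) n) <= A * d 1%nat.
Proof.
  intros H Hd Hm HA Hd1. destruct n as [|n].
  - simpl. rewrite Cmod_0. apply Rmult_le_pos; auto.
  - eapply Rle_trans; [apply (abel_bound a (fun k => RtoC (d k)) n A H)|].
    apply Rmult_le_compat_l; auto.
    rewrite (rsum_ext _ (fun k => d k - d (S k))).
    + rewrite rsum_tele, Cmod_R, Rabs_pos_eq; [lra|apply Hd; lia].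
    + intros. rewrite <- RtoC_minus, Cmod_R, Rabs_pos_eq; auto.
      assert (d (S k) <= d k) by (apply Hm; lia); lra.
Qed.

(** Partial summation in [k] leaves the differences in [k] of the inner sums. Each is an inner sum
    with weights [h k l - h (S k) l], nonnegative by monotonicity in [k] and decreasing in [l] by
    the mixed difference condition, so [abel_mono] applies to it and the resulting bounds telescope
    in [k]. *)
Lemma abel_mono2 (a b : nat -> C) (h : nat -> nat -> R) m n A B :
  (forall j, (1 <= j <= m)%nat -> Cmod (csum a j) <= A) ->
  (forall j, (1 <= j <= n)%nat -> Cmod (csum b j) <= B) ->
  0 <= A -> 0 <= B ->
  (forall k l, (1 <= k)%nat -> (1 <= l)%nat -> 0 <= h k l) ->
  (forall k l, (1 <= k)%nat -> (1 <= l)%nat -> h (S k) l <= h k l) ->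
  (forall k l, (1 <= k)%nat -> (1 <= l)%nat -> h k (S l) <= h k l) ->
  (forall k l, (1 <= k)%nat -> (1 <= l)%nat ->
     h k (S l) - h (S k) (S l) <= h k l - h (S k) l) ->
  Cmod (csum (fun k => csum (fun l => Cmult (Cmult (a k) (b l)) (RtoC (h k l))) n) m)
  <= A * B * h 1%nat 1%nat.
Proof.
  intros Ha Hb HA HB Hp H1 H2 H12.
  destruct m as [|m].
  { simpl. rewrite Cmod_0. repeat apply Rmult_le_pos; auto. }
  set (c := fun k => csum (fun l => Cmult (b l) (RtoC (h k l))) n).
  rewrite (csum_ext _ (fun k => Cmult (a k) (c k))).
  2:{ intros k Hk. unfold c. rewrite <- csum_scal. apply csum_ext; intros; ring. }
  eapply Rle_trans; [apply (abel_bound a c m A Ha)|].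
  rewrite Rmult_assoc. apply Rmult_le_compat_l; auto.
  assert (E : rsum (fun k => Cmod (Cminus (c k) (c (S k)))) m <=
     rsum (fun k => B * h k 1%nat - B * h (S k) 1%nat) m).
  { apply rsum_le; intros k Hk. unfold c. rewrite <- csum_minus.
    rewrite (csum_ext _ (fun l => Cmult (b l) (RtoC (h k l - h (S k) l)))).
    2:{ intros; rewrite RtoC_minus; ring. }
    rewrite <- Rmult_minus_distr_l.
    apply (abel_mono b (fun l => h k l - h (S k) l) n B); auto.
    - intros l Hl. assert (h (S k) l <= h k l) by (apply H1; lia). lra.
    - intros l Hl. apply H12; lia.
    - assert (h (S k) 1%nat <= h k 1%nat) by (apply H1; lia). lra. }
  rewrite (rsum_tele (fun k => B * h k 1%nat)) in E.
  assert (Cmod (c (S m)) <= B * h (S m) 1%nat).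
  { unfold c. apply (abel_mono b (fun l => h (S m) l) n B); auto.
    - intros; apply Hp; lia.
    - intros; apply H2; lia.
    - apply Hp; lia. }
  lra.
Qed.

Definition cis (x : R) : C := (cos x, sin x).

Lemma cis_plus x y : cis (x + y) = Cmult (cis x) (cis y).
Proof. unfold cis, Cmult; simpl. rewrite cos_plus, sin_plus. f_equal; ring. Qed.

Lemma cis_0 : cis 0 = RtoC 1.
Proof. unfold cis, RtoC. rewrite cos_0, sin_0; auto. Qed.

Lemma cis_opp x : cis (- x) = Cconj (cis x).
Proof. unfold cis, Cconj; simpl. rewrite cos_neg, sin_neg; auto. Qed.

Lemma Cmod_cis x : Cmod (cis x) = 1.
Proof.
  unfold Cmod, cis, fst, snd. rewrite <- !Rsqr_pow2, Rplus_comm, sin2_cos2. apply sqrt_1.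
Qed.

Lemma Cmod_Rmult r z : 0 <= r -> Cmod (Cmult (RtoC r) z) = r * Cmod z.
Proof. intros. rewrite Cmod_mult, Cmod_R, Rabs_pos_eq; auto. Qed.

Lemma Cmod_le_sum (z : C) : Cmod z <= Rabs (fst z) + Rabs (snd z).
Proof.
  unfold Cmod. apply Rsqr_incr_0_var.
  - rewrite Rsqr_sqrt by (apply Rplus_le_le_0_compat; apply pow2_ge_0). unfold Rsqr.
    generalize (Rabs_pos (fst z)) (Rabs_pos (snd z)); intros.
    rewrite <- (pow2_abs (fst z)), <- (pow2_abs (snd z)). nra.
  - generalize (Rabs_pos (fst z)) (Rabs_pos (snd z)); lra.
Qed.

Lemma fst_le_Cmod (z : C) : Rabs (fst z) <= Cmod z.
Proof. eapply Rle_trans; [|apply Rmax_Cmod]. apply Rmax_l. Qed.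

Lemma snd_le_Cmod (z : C) : Rabs (snd z) <= Cmod z.
Proof. eapply Rle_trans; [|apply Rmax_Cmod]. apply Rmax_r. Qed.

Lemma Cmod_minus_sym (x y : C) : Cmod (Cminus x y) = Cmod (Cminus y x).
Proof. rewrite <- Cmod_opp. f_equal. ring. Qed.

Lemma Cmod_tri3 (x y z : C) : Cmod (Cminus x z) <= Cmod (Cminus x y) + Cmod (Cminus y z).
Proof. replace (Cminus x z) with (Cplus (Cminus x y) (Cminus y z)) by ring. apply Cmod_triangle. Qed.

Lemma INR_ge1 n : (1 <= n)%nat -> 1 <= INR n.
Proof. intros. apply (le_INR 1); auto. Qed.

Lemma nat_floor_spec x : 0 <= x -> INR (nat_floor x) <= x < INR (nat_floor x) + 1.
Proof.
  intros Hx. destruct (base_Int_part x) as [H1 H2]. unfold nat_floor.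
  assert (0 <= Int_part x)%Z.
  { apply Z.lt_succ_r. apply lt_IZR. rewrite succ_IZR. lra. }
  rewrite INR_IZR_INZ, Z2Nat.id by auto. lra.
Qed.

Lemma nat_floor_le n x : 0 <= x -> ((n <= nat_floor x)%nat <-> INR n <= x).
Proof.
  intros Hx. destruct (nat_floor_spec x Hx) as [H1 H2]. split; intros H.
  - apply le_INR in H; lra.
  - apply Nat.lt_succ_r. apply INR_lt. rewrite S_INR; lra.
Qed.

Lemma nat_floor_lt n x : 0 <= x -> ((nat_floor x < n)%nat <-> x < INR n).
Proof.
  intros Hx. generalize (nat_floor_le n x Hx); intros [H1 H2]. split; intros H.
  - apply Rnot_le_lt; intros H3. apply H2 in H3. lia.
  - apply Nat.lt_nge; intros H3. apply H1 in H3. lra.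
Qed.

Lemma Rpower_pos x y : 0 < Rpower x y.
Proof. apply exp_pos. Qed.

Lemma Rpower_1_l y : Rpower 1 y = 1.
Proof. unfold Rpower. rewrite ln_1, Rmult_0_r, exp_0; auto. Qed.

Lemma ln_nonneg x : 1 <= x -> 0 <= ln x.
Proof. intros. rewrite <- ln_1. apply ln_le; lra. Qed.

Lemma ln_ge_1m x : 0 < x -> 1 - / x <= ln x.
Proof.
  intros Hx. assert (Hi : 0 < / x) by (apply Rinv_0_lt_compat; auto).
  generalize (exp_ineq1_le (ln (/ x))). rewrite exp_ln by auto.
  rewrite ln_Rinv by auto. lra.
Qed.

Lemma ln_le_m1 x : 0 < x -> ln x <= x - 1.
Proof. intros Hx. generalize (exp_ineq1_le (ln x)). rewrite exp_ln by auto. lra. Qed.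

Lemma Rpower_le_base x y a : 0 < x <= y -> 0 <= a -> Rpower x a <= Rpower y a.
Proof. intros; apply Rle_Rpower_l; auto. Qed.

Lemma Rpower_le_base_neg x y a : 0 < x <= y -> a <= 0 -> Rpower y a <= Rpower x a.
Proof.
  intros H Ha. replace a with (- - a) by ring. rewrite !(Rpower_Ropp _ (- a)).
  apply Rinv_le_contravar; [apply Rpower_pos|]. apply Rle_Rpower_l; lra.
Qed.

Lemma Rpower_ge1 x a : 1 <= x -> 0 <= a -> 1 <= Rpower x a.
Proof. intros. rewrite <- (Rpower_O x) by lra. apply Rle_Rpower; auto. Qed.

Lemma Rpower_half x : 0 < x -> Rpower x (- (1 / 2)) = / sqrt x.
Proof. intros. rewrite Rpower_Ropp. f_equal. rewrite <- Rpower_sqrt by auto. f_equal; lra. Qed.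

(** From the alternating Taylor bound [cos d <= 1 - d^2/2 + d^4/24] and [d^4 <= d^2]. *)
Lemma cos_le_quad d : 0 <= d <= 1 -> cos d <= 1 - d ^ 2 / 4.
Proof.
  intros Hd. assert (H := pre_cos_bound d 0). destruct H as [_ H]; try lra.
  unfold cos_approx, cos_term in H. simpl in H.
  eapply Rle_trans; [apply H|]. clear H. field_simplify.
  assert (0 <= d ^ 2 <= 1) by nra. replace (d ^ 4) with (d ^ 2 * d ^ 2) by ring. nra.
Qed.

Lemma cos_away j d g : 0 < d <= 1 ->
  2 * PI * INR j + d <= g <= 2 * PI * INR (S j) - d -> d ^ 2 / 4 <= 1 - cos g.
Proof.
  intros Hd Hg. rewrite S_INR in Hg. set (u := g - 2 * INR j * PI).
  replace g with (u + 2 * INR j * PI) by (unfold u; ring). rewrite cos_period.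
  assert (Hu : d <= u <= 2 * PI - d) by (unfold u; lra). clearbody u.
  assert (cos d <= 1 - d ^ 2 / 4) by (apply cos_le_quad; lra).
  destruct (Rle_dec u PI).
  - assert (cos u <= cos d) by (apply cos_decr_1; lra). lra.
  - replace (cos u) with (cos (2 * PI - u)).
    + assert (cos (2 * PI - u) <= cos d) by (apply cos_decr_1; lra). lra.
    + rewrite <- (cos_neg u), <- (cos_period (- u) 1). f_equal. simpl; ring.
Qed.

(** * Exponential sums *)

(* [hcot g = cot (g / 2)] is the imaginary part of [2 / (1 - e^{ig})]. *)
Definition hcot (g : R) : R := sin g / (1 - cos g).

Lemma hcot_decr a b : a <= b -> (forall x, a <= x <= b -> 0 < 1 - cos x) -> hcot b <= hcot a.
Proof.
  intros Hab H.
  destruct (MVT_gen hcot a b (fun x => - / (1 - cos x))) as [x [Hx E]].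
  - rewrite Rmin_left, Rmax_right by lra. intros x Hx.
    assert (0 < 1 - cos x) by (apply H; lra).
    unfold hcot. auto_derive; [lra|].
    assert (E := sin2_cos2 x). unfold Rsqr in E. field_simplify_eq; [|lra]. nra.
  - rewrite Rmin_left, Rmax_right by lra. intros x Hx.
    assert (0 < 1 - cos x) by (apply H; lra).
    unfold hcot. apply derivable_continuous_pt. apply ex_derive_Reals_0.
    auto_derive; lra.
  - rewrite Rmin_left, Rmax_right in Hx by lra.
    assert (0 < / (1 - cos x)) by (apply Rinv_0_lt_compat; auto). nra.
Qed.

(** The half-angle identity [hcot^2 (1 - cos g) = 1 + cos g <= 2] gives [hcot^2 <= 8 / d^2], rounded
    up to [9 / d^2]. *)
Lemma hcot_bound d g : 0 < d -> d ^ 2 / 4 <= 1 - cos g -> Rabs (hcot g) <= 3 / d.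
Proof.
  intros Hd Hg. assert (0 < 1 - cos g) by nra.
  assert (E := sin2_cos2 g). unfold Rsqr in E.
  assert (Hh : hcot g * (1 - cos g) = sin g) by (unfold hcot; field; lra).
  assert (Hh2 : (hcot g) ^ 2 * (1 - cos g) = 1 + cos g).
  { apply Rmult_eq_reg_r with (1 - cos g); [|lra]. rewrite <- Hh in E. nra. }
  assert (0 < 3 / d) by (apply Rdiv_lt_0_compat; lra).
  rewrite <- (Rabs_pos_eq (3 / d)) by lra. apply Rsqr_le_abs_0.
  apply Rmult_le_reg_r with (d ^ 2); [nra|].
  replace (Rsqr (3 / d) * d ^ 2) with 9 by (unfold Rsqr; field; lra).
  unfold Rsqr. nra.
Qed.

(* [cis x = (cis x - cis (x + g)) * klw g]: the weight that makes an exponential sum telescope. *)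
Definition klw (g : R) : C := (1 / 2, hcot g / 2).

Lemma klw_spec x g : 1 - cos g <> 0 ->
  cis x = Cmult (Cminus (cis x) (cis (x + g))) (klw g).
Proof.
  intros Hg.
  assert (E := sin2_cos2 g). unfold Rsqr in E.
  assert (H1 : hcot g * (1 - cos g) = sin g) by (unfold hcot; field; auto).
  assert (H2 : hcot g * sin g = 1 + cos g).
  { apply Rmult_eq_reg_r with (1 - cos g); auto.
    replace (hcot g * sin g * (1 - cos g)) with (sin g * (hcot g * (1 - cos g))) by ring.
    rewrite H1. lra. }
  unfold cis, klw, Cmult, Cminus, Cplus, Copp; simpl.
  rewrite cos_plus, sin_plus. f_equal.
  - transitivity (/ 2 * (cos x * ((1 - cos g) + hcot g * sin g)
      + sin x * (sin g - hcot g * (1 - cos g)))); [rewrite H1, H2|]; field.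
  - transitivity (/ 2 * (sin x * ((1 - cos g) + hcot g * sin g)
      - cos x * (sin g - hcot g * (1 - cos g)))); [rewrite H1, H2|]; field.
Qed.

(** The Kusmin-Landau inequality. By [klw_spec] every term is a difference times a weight, and sums
    of the differences are at most 2 in modulus. The weights vary only in their imaginary part,
    which is monotone because the increments are, so their total variation is at most [3/d]. With
    the last weight this gives [2 (1/2 + 9/(2d)) <= 10/d], as [d <= 1]. *)
Lemma kusmin_landau (phi : nat -> R) j d n : 0 < d <= 1 ->
  (forall k, (1 <= k <= n)%nat ->
     2 * PI * INR j + d <= phi (S k) - phi k <= 2 * PI * INR (S j) - d) ->
  (forall k, (1 <= k < n)%nat -> phi (S (S k)) - phi (S k) <= phi (S k) - phi k) ->
  Cmod (csum (fun k => cis (phi k)) n) <= 10 / d.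
Proof.
  intros Hd Hg Hm. set (g := fun k => phi (S k) - phi k).
  assert (Hpos : 0 < / d) by (apply Rinv_0_lt_compat; lra).
  destruct n as [|n].
  { simpl. rewrite Cmod_0. unfold Rdiv; lra. }
  assert (HK : forall k, (1 <= k <= S n)%nat -> d ^ 2 / 4 <= 1 - cos (g k)).
  { intros. apply (cos_away j); auto. apply Hg; auto. }
  assert (Hd2 : 0 < d ^ 2) by nra.
  assert (HB : forall k, (1 <= k <= S n)%nat -> Rabs (hcot (g k)) <= 3 / d).
  { intros; apply hcot_bound; [lra|apply HK; auto]. }
  rewrite (csum_ext _ (fun k => Cmult (Cminus (cis (phi k)) (cis (phi (S k)))) (klw (g k)))).
  2:{ intros k Hk. rewrite (klw_spec (phi k) (g k)) at 1.
      - unfold g. do 2 f_equal. f_equal; ring.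
      - assert (H := HK k Hk). lra. }
  eapply Rle_trans; [apply (abel_bound _ (fun k => klw (g k)) n 2)|].
  - intros i Hi. rewrite (csum_tele (fun k => cis (phi k))).
    eapply Rle_trans; [apply Cmod_triangle|]. rewrite Cmod_opp, !Cmod_cis. lra.
  - rewrite (rsum_ext _ (fun k => / 2 * (- hcot (g k) - - hcot (g (S k))))).
    + rewrite rsum_scal, (rsum_tele (fun k => - hcot (g k))).
      assert (H1 := HB 1%nat ltac:(lia)). assert (H2 := HB (S n) ltac:(lia)).
      apply Rabs_le_between in H1.
      assert (H3 : Cmod (klw (g (S n))) <= 1 / 2 + (3 / d) / 2).
      { eapply Rle_trans; [apply Cmod_le_sum|]. unfold klw; simpl.
        assert (E : Rabs (hcot (g (S n)) / 2) = Rabs (hcot (g (S n))) / 2).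
        { unfold Rdiv; rewrite Rabs_mult, (Rabs_pos_eq (/ 2)); lra. }
        rewrite E, (Rabs_pos_eq (1 / 2)) by lra. lra. }
      apply Rabs_le_between in H2. unfold Rdiv in *.
      assert (1 <= / d). { rewrite <- Rinv_1. apply Rinv_le_contravar; lra. }
      lra.
    + intros k Hk. replace (Cminus (klw (g k)) (klw (g (S k)))) with
        (Cmult (RtoC (/ 2 * (hcot (g (S k)) - hcot (g k)))) (Copp Ci)).
      * rewrite Cmod_mult, Cmod_opp, Cmod_Ci, Cmod_R, Rabs_pos_eq; [ring|].
        apply Rmult_le_pos; [lra|]. apply Rge_le, Rge_minus, Rle_ge.
        assert (B1 := Hg k ltac:(lia)). assert (B2 := Hg (S k) ltac:(lia)).
        apply hcot_decr; [apply Hm; lia|]. intros x Hx.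
        assert (d ^ 2 / 4 <= 1 - cos x); [|lra].
        apply (cos_away j); auto. unfold g in Hx; lra.
      * unfold klw, Cmult, Cminus, Cplus, Copp, Ci, RtoC; simpl. f_equal; field.
Qed.

Lemma threshold_split (g : nat -> R) v n :
  (forall k, (1 <= k < n)%nat -> g (S k) <= g k) ->
  exists m, (m <= n)%nat /\ (forall k, (1 <= k <= m)%nat -> v < g k) /\
            (forall k, (m < k <= n)%nat -> g k <= v).
Proof.
  induction n as [|n IH]; intros Hm.
  - exists 0%nat. repeat split; intros; lia.
  - destruct IH as [m [H1 [H2 H3]]]; [intros; apply Hm; lia|].
    destruct (Rle_dec (g (S n)) v).
    + exists m. repeat split; auto; try lia.
      intros k Hk. destruct (Nat.eq_dec k (S n)); [subst; auto|]. apply H3; lia.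
    + exists (S n). assert (m = n).
      { destruct (Nat.eq_dec m n); auto. exfalso.
        assert (g n <= v) by (apply H3; lia).
        assert (g (S n) <= g n) by (apply Hm; lia). lra. }
      subst m. repeat split; auto; try lia.
      intros k Hk. destruct (Nat.eq_dec k (S n)); [subst; lra|]. apply H2; lia.
Qed.

Lemma count_spaced (g : nat -> R) lam n : 0 < lam ->
  (forall k, (1 <= k < n)%nat -> lam <= g k - g (S k)) ->
  forall d, 0 <= d -> (forall k, (1 <= k <= n)%nat -> g 1%nat - d <= g k) ->
  INR n <= d / lam + 1.
Proof.
  intros Hl Hs d Hd Hb. destruct n as [|n].
  - simpl. assert (0 <= d / lam) by (apply Rdiv_le_0_compat; lra). lra.
  - assert (E : forall m, (m <= n)%nat -> INR m * lam <= g 1%nat - g (S m)).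
    { induction m as [|m IH]; intros Hmn; [simpl; lra|].
      rewrite S_INR. assert (INR m * lam <= g 1%nat - g (S m)) by (apply IH; lia).
      assert (lam <= g (S m) - g (S (S m))) by (apply Hs; lia). lra. }
    assert (H1 := E n ltac:(lia)). assert (H2 := Hb (S n) ltac:(lia)).
    rewrite S_INR. apply Rplus_le_compat_r. apply Rle_div_r; lra.
Qed.

Lemma cis_sum_trivial (phi : nat -> R) n : Cmod (csum (fun k => cis (phi k)) n) <= INR n.
Proof.
  replace (INR n) with (rsum (fun _ => 1) n) by (rewrite rsum_const; ring).
  apply csum_bound; intros. rewrite Cmod_cis; lra.
Qed.

(** Increments within [d] of an end of the period are out of reach of Kusmin-Landau, but being
    spaced by [lam] there are at most [d/lam + 1] of them at either end. These are counted
    trivially, and the stretch between them costs [10/d]. *)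
Lemma vdc_one_period (phi : nat -> R) j d lam n : 0 < d <= 1 -> 0 < lam ->
  (forall k, (1 <= k <= n)%nat ->
     2 * PI * INR j <= phi (S k) - phi k <= 2 * PI * INR (S j)) ->
  (forall k, (1 <= k < n)%nat -> lam <= (phi (S k) - phi k) - (phi (S (S k)) - phi (S k))) ->
  Cmod (csum (fun k => cis (phi k)) n) <= 2 * (d / lam + 1) + 10 / d.
Proof.
  intros Hd Hl Hg Hs. set (g := fun k => phi (S k) - phi k).
  assert (Hm : forall k, (1 <= k < n)%nat -> g (S k) <= g k).
  { intros k Hk. assert (H := Hs k Hk). unfold g. lra. }
  destruct (threshold_split g (2 * PI * INR (S j) - d) n Hm) as [m1 [A1 [A2 A3]]].
  destruct (threshold_split g (2 * PI * INR j + d) n Hm) as [m2 [B1 [B2 B3]]].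
  (* End of the middle stretch; the maximum makes [m1 <= p] immediate, without comparing the two
     thresholds. *)
  set (p := Nat.max m1 m2).
  replace n with (m1 + ((p - m1) + (n - p)))%nat by lia.
  rewrite !csum_app.
  eapply Rle_trans; [apply Cmod_triangle|].
  eapply Rle_trans; [apply Rplus_le_compat_l, Cmod_triangle|].
  assert (C1 : Cmod (csum (fun k => cis (phi k)) m1) <= d / lam + 1).
  { eapply Rle_trans; [apply cis_sum_trivial|].
    apply (count_spaced g); auto; try lra.
    - intros; apply Hs; lia.
    - intros k Hk. assert (H1 := A2 k Hk).
      assert (H2 := Hg 1%nat ltac:(lia)). unfold g in *. lra. }
  assert (C2 : Cmod (csum (fun k => cis (phi (m1 + k)%nat)) (p - m1)) <= 10 / d).
  { apply (kusmin_landau (fun k => phi (m1 + k)%nat) j d); auto.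
    - intros k Hk. rewrite Nat.add_succ_r.
      assert (H1 := A3 (m1 + k)%nat ltac:(lia)). assert (H2 := B2 (m1 + k)%nat ltac:(lia)).
      unfold g in *. lra.
    - intros k Hk. rewrite !Nat.add_succ_r. apply Hm; lia. }
  assert (C3 : Cmod (csum (fun k => cis (phi (m1 + ((p - m1) + k))%nat)) (n - p)) <= d / lam + 1).
  { eapply Rle_trans; [apply (cis_sum_trivial (fun k => phi (m1 + ((p - m1) + k))%nat))|].
    apply (count_spaced (fun k => g (m1 + ((p - m1) + k))%nat)); auto; try lra.
    - intros k Hk. unfold g. rewrite !Nat.add_succ_r. apply Hs; lia.
    - intros k Hk. assert (H1 := Hg (m1 + ((p - m1) + k))%nat ltac:(lia)).
      assert (H2 := B3 (m1 + ((p - m1) + 1))%nat ltac:(lia)).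
      fold (g (m1 + ((p - m1) + k))%nat) in H1. lra. }
  lra.
Qed.

(** Van der Corput's second-derivative test in discrete form. The increments decrease, so those
    above [2 PI J] form an initial segment, which lies in a single period, and induction on [J]
    handles the rest. The parameter [d] stays free for optimisation. *)
Lemma vdc_abstract J : forall (phi : nat -> R) d lam n, 0 < d <= 1 -> 0 < lam ->
  (forall k, (1 <= k <= n)%nat -> 0 <= phi (S k) - phi k <= 2 * PI * INR J) ->
  (forall k, (1 <= k < n)%nat -> lam <= (phi (S k) - phi k) - (phi (S (S k)) - phi (S k))) ->
  Cmod (csum (fun k => cis (phi k)) n) <= INR (S J) * (2 * (d / lam + 1) + 10 / d).
Proof.
  induction J as [|J IH]; intros phi d lam n Hd Hl Hg Hs.
  - rewrite Rmult_1_l. apply (vdc_one_period phi 0); auto.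
    intros k Hk. assert (H := Hg k Hk). simpl in *. assert (P := PI_RGT_0). lra.
  - destruct (threshold_split (fun k => phi (S k) - phi k) (2 * PI * INR J) n)
      as [m [A1 [A2 A3]]].
    { intros k Hk. assert (H := Hs k Hk). lra. }
    replace n with (m + (n - m))%nat by lia. rewrite csum_app.
    eapply Rle_trans; [apply Cmod_triangle|]. rewrite S_INR, Rmult_plus_distr_r, Rmult_1_l.
    rewrite Rplus_comm. apply Rplus_le_compat.
    + apply (IH (fun k => phi (m + k)%nat)); auto.
      * intros k Hk. assert (H1 := Hg (m + k)%nat ltac:(lia)).
        assert (H2 := A3 (m + k)%nat ltac:(lia)). rewrite !Nat.add_succ_r. lra.
      * intros k Hk. rewrite !Nat.add_succ_r. apply Hs; lia.
    + apply (vdc_one_period phi J); auto.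
      * intros k Hk. assert (H1 := Hg k ltac:(lia)).
        assert (H2 := A2 k ltac:(lia)). simpl in H2. lra.
      * intros k Hk. apply Hs; lia.
Qed.

(** * The phase [tau ln n] on dyadic blocks, and partial sums on the critical line *)

Lemma ln_step_bounds x : 1 <= x -> / (x + 1) <= ln (x + 1) - ln x <= / x.
Proof.
  intros Hx. rewrite <- ln_div by lra. split.
  - replace (/ (x + 1)) with (1 - / ((x + 1) / x)) by (field; lra).
    apply ln_ge_1m. apply Rdiv_lt_0_compat; lra.
  - replace (/ x) with ((x + 1) / x - 1) by (field; lra).
    apply ln_le_m1. apply Rdiv_lt_0_compat; lra.
Qed.

(** The second difference is the logarithm of [(x+1)^2 / (x (x+2))], to which [ln z >= 1 - 1/z]
    applies. *)
Lemma ln_step2_lower x : 1 <= x ->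
  / ((x + 1) * (x + 1)) <= (ln (x + 1) - ln x) - (ln (x + 1 + 1) - ln (x + 1)).
Proof.
  intros Hx.
  replace ((ln (x + 1) - ln x) - (ln (x + 1 + 1) - ln (x + 1))) with
    (ln (((x + 1) * (x + 1)) / (x * (x + 1 + 1)))).
  - replace (/ ((x + 1) * (x + 1))) with (1 - / (((x + 1) * (x + 1)) / (x * (x + 1 + 1))))
      by (field; lra).
    apply ln_ge_1m. apply Rdiv_lt_0_compat; nra.
  - rewrite ln_div by nra. rewrite !ln_mult by lra. ring.
Qed.

(** On [[K, 2K]] the increments of the phase lie in [[tau/(4K), tau/K]] and are spaced by at least
    [tau/(4K^2)]. For [tau <= K] they stay inside one period, away from its ends, and Kusmin-Landau
    gives [40 K / tau]; otherwise the second-derivative test gives [78 sqrt tau]. *)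
Lemma block_bound tau (K A n : nat) : 0 < tau -> tau <= INR K ^ 2 -> (1 <= K)%nat ->
  (K <= A + 1)%nat -> (A + n <= 2 * K)%nat ->
  Cmod (csum (fun k => cis (tau * ln (INR (A + k)))) n) <= 78 * sqrt tau + 40 * INR K / tau.
Proof.
  intros Ht HtK HK HKA HAn.
  assert (K1 := INR_ge1 K HK).
  assert (Hx : forall k, (1 <= k <= n)%nat -> INR K <= INR (A + k) <= 2 * INR K).
  { intros k Hk. split; [apply le_INR; lia|]. change 2 with (INR 2). rewrite <- mult_INR.
    apply le_INR; lia. }
  set (phi := fun k => tau * ln (INR (A + k))).
  assert (Hphi : forall k, phi (S k) = tau * ln (INR (A + k) + 1)).
  { intros k. unfold phi. rewrite Nat.add_succ_r, S_INR. auto. }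
  assert (Hphi2 : forall k, phi (S (S k)) = tau * ln (INR (A + k) + 1 + 1)).
  { intros k. unfold phi. rewrite !Nat.add_succ_r, !S_INR. auto. }
  assert (P := PI2_3_2). unfold PI2 in P.
  assert (Hg : forall k, (1 <= k <= n)%nat ->
     tau / (4 * INR K) <= phi (S k) - phi k <= tau / INR K).
  { intros k Hk. specialize (Hx k Hk). rewrite Hphi. unfold phi.
    rewrite <- Rmult_minus_distr_l.
    assert (B := ln_step_bounds (INR (A + k)) ltac:(lra)).
    unfold Rdiv. split; apply Rmult_le_compat_l; try lra.
    - eapply Rle_trans; [|apply B]. apply Rinv_le_contravar; lra.
    - eapply Rle_trans; [apply B|]. apply Rinv_le_contravar; lra. }
  assert (Hs : forall k, (1 <= k < n)%nat ->
     tau / (4 * INR K ^ 2) <= phi (S k) - phi k - (phi (S (S k)) - phi (S k))).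
  { intros k Hk. assert (Hk1 := Hx k ltac:(lia)). assert (Hk2 := Hx (S k) ltac:(lia)).
    rewrite Nat.add_succ_r, S_INR in Hk2.
    rewrite Hphi2, Hphi. unfold phi. set (x := INR (A + k)) in *.
    replace (tau * ln (x + 1) - tau * ln x - (tau * ln (x + 1 + 1) - tau * ln (x + 1)))
      with (tau * (ln (x + 1) - ln x - (ln (x + 1 + 1) - ln (x + 1)))) by ring.
    unfold Rdiv. apply Rmult_le_compat_l; [lra|].
    eapply Rle_trans; [|apply ln_step2_lower; lra]. apply Rinv_le_contravar; nra. }
  assert (Hq : 0 < sqrt tau) by (apply sqrt_lt_R0; auto).
  assert (Hqq : sqrt tau * sqrt tau = tau) by (apply sqrt_sqrt; lra).
  assert (HqK : sqrt tau <= INR K).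
  { rewrite <- (sqrt_pow2 (INR K)) by lra. apply sqrt_le_1; nra. }
  destruct (Rle_dec tau (INR K)) as [Hc|Hc].
  - assert (Hd : 0 < tau / (4 * INR K) <= 1).
    { split; [apply Rdiv_lt_0_compat; lra|]. apply Rle_div_l; lra. }
    assert (Hd1 : tau / INR K <= 1) by (apply Rle_div_l; lra).
    eapply Rle_trans; [apply (kusmin_landau phi 0 (tau / (4 * INR K))); auto|].
    + intros k Hk. specialize (Hg k Hk). simpl. lra.
    + intros k Hk. specialize (Hs k Hk).
      assert (0 < tau / (4 * INR K ^ 2)) by (apply Rdiv_lt_0_compat; nra). lra.
    + replace (10 / (tau / (4 * INR K))) with (40 * INR K / tau) by (field; lra). lra.
  - set (J := S (nat_floor (tau / INR K))).
    assert (Hr : 1 <= tau / INR K) by (apply Rle_div_r; lra).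
    destruct (nat_floor_spec (tau / INR K)) as [F1 F2]; [lra|].
    assert (HJ : tau / INR K <= INR J <= tau / INR K + 1) by (unfold J; rewrite S_INR; lra).
    (* This [d] balances [d/lam] against [1/d], both then of order [K / sqrt tau]. The bracket of
       [vdc_abstract] is at most [26 K / sqrt tau], and its factor [J + 1] at most [3 tau / K]. *)
    assert (Hd : 0 < sqrt tau / (2 * INR K) <= 1).
    { split; [apply Rdiv_lt_0_compat; lra|]. apply Rle_div_l; lra. }
    assert (Hl : 0 < tau / (4 * INR K ^ 2)) by (apply Rdiv_lt_0_compat; nra).
    eapply Rle_trans; [apply (vdc_abstract J phi (sqrt tau / (2 * INR K)) (tau / (4 * INR K ^ 2)));
      auto|].
    + intros k Hk. specialize (Hg k Hk).
      assert (0 < tau / (4 * INR K)) by (apply Rdiv_lt_0_compat; lra). nra.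
    + rewrite S_INR.
      replace (sqrt tau / (2 * INR K) / (tau / (4 * INR K ^ 2))) with (2 * (INR K / sqrt tau)).
      2:{ clear -Hqq Hq K1. set (q := sqrt tau) in *. clearbody q. subst tau. field; lra. }
      replace (10 / (sqrt tau / (2 * INR K))) with (20 * (INR K / sqrt tau)) by (field; lra).
      assert (1 <= INR K / sqrt tau) by (apply Rle_div_r; lra).
      apply Rle_trans with (3 * (tau / INR K) * (26 * (INR K / sqrt tau))).
      * apply Rmult_le_compat; lra.
      * replace (3 * (tau / INR K) * (26 * (INR K / sqrt tau))) with (78 * sqrt tau).
        2:{ clear -Hqq Hq K1. set (q := sqrt tau) in *. clearbody q. subst tau. field; lra. }
        assert (0 <= 40 * INR K / tau) by (apply Rdiv_le_0_compat; lra). lra.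
Qed.

(* [n^{-1/2 + i tau}]: the exponent carries [+ i tau], as in [zeta (1/2 - i tau)]. *)
Definition zterm (tau : R) (n : nat) : C :=
  Cmult (RtoC (/ sqrt (INR n))) (cis (tau * ln (INR n))).

Lemma sqrt_INR_pos n : (1 <= n)%nat -> 0 < sqrt (INR n).
Proof. intros. apply sqrt_lt_R0. apply lt_0_INR; lia. Qed.

Lemma inv_sqrt_decr m n : (1 <= m <= n)%nat -> / sqrt (INR n) <= / sqrt (INR m).
Proof.
  intros. apply Rinv_le_contravar; [apply sqrt_INR_pos; lia|].
  apply sqrt_le_1; try apply pos_INR. apply le_INR; lia.
Qed.

Lemma zblock_bound tau (K A n : nat) : 0 < tau -> tau <= INR K ^ 2 -> (1 <= K)%nat ->
  (K <= A + 1)%nat -> (A + n <= 2 * K)%nat ->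
  Cmod (csum (fun k => zterm tau (A + k)) n) <=
  (78 * sqrt tau + 40 * INR K / tau) / sqrt (INR K).
Proof.
  intros Ht HtK HK HKA HAn.
  assert (K1 := INR_ge1 K HK).
  assert (HB : 0 <= 78 * sqrt tau + 40 * INR K / tau).
  { apply Rplus_le_le_0_compat; [generalize (sqrt_pos tau); lra|].
    apply Rdiv_le_0_compat; lra. }
  rewrite (csum_ext _ (fun k => Cmult (cis (tau * ln (INR (A + k)))) (RtoC (/ sqrt (INR (A + k))))))
    by (intros; unfold zterm; ring).
  eapply Rle_trans.
  - apply (abel_mono _ (fun k => / sqrt (INR (A + k))) n (78 * sqrt tau + 40 * INR K / tau)); auto.
    + intros j Hj. apply block_bound; auto; lia.
    + intros k Hk. apply Rlt_le, Rinv_0_lt_compat, sqrt_INR_pos; lia.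
    + intros k Hk. apply inv_sqrt_decr; lia.
    + apply Rlt_le, Rinv_0_lt_compat, sqrt_INR_pos; lia.
  - unfold Rdiv at 2. apply Rmult_le_compat_l; auto. apply inv_sqrt_decr; lia.
Qed.

(** [71/100] is just above [1 / sqrt 2]; being below 1 with room to spare, it makes the halving
    arguments converge. *)
Lemma sqrt_half_gap x y : 0 < x -> 0 < y -> x <= y / 2 -> sqrt x <= (71 / 100) * sqrt y.
Proof.
  intros Hx Hy H. apply Rsqr_incr_0_var.
  - rewrite Rsqr_sqrt by lra. unfold Rsqr.
    assert (sqrt y * sqrt y = y) by (apply sqrt_sqrt; lra). nra.
  - generalize (sqrt_pos y); lra.
Qed.

(** Dyadic summation as a strong induction that halves [N]. The term [- 300 sqrt tau / sqrt N] pays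
    for the top block: from [N] to its half it gains at least [(7/5 - 1) * 300 = 120], while the
    block costs [78 * 3/2 = 117]. Likewise [140 * 0.71 + 40 < 140] closes the induction for the last
    term. *)
Lemma zterm_tail tau (A : nat) : 0 < tau -> tau <= INR (A + 1) ^ 2 -> forall N, (A < N)%nat ->
  Cmod (Cminus (csum (zterm tau) N) (csum (zterm tau) A)) <=
  400 * (sqrt tau / sqrt (INR (A + 1))) - 300 * (sqrt tau / sqrt (INR N))
  + 140 * (sqrt (INR N) / tau).
Proof.
  intros Ht HA N. induction N as [N IH] using lt_wf_ind. intros HN.
  assert (Hq : 0 < sqrt tau) by (apply sqrt_lt_R0; auto).
   assert (HsA := sqrt_INR_pos (A + 1) ltac:(lia)).
  assert (SN : sqrt (INR N) * sqrt (INR N) = INR N) by (apply sqrt_sqrt, pos_INR).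
  assert (SA : sqrt (INR (A + 1)) * sqrt (INR (A + 1)) = INR (A + 1)) by (apply sqrt_sqrt, pos_INR).
  destruct (le_lt_dec N (2 * (A + 1))) as [Hc|Hc].
  - assert (E : Cminus (csum (zterm tau) N) (csum (zterm tau) A) =
                csum (fun k => zterm tau (A + k)) (N - A)).
    { replace N with (A + (N - A))%nat at 1 by lia. rewrite csum_app. ring. }
    rewrite E. eapply Rle_trans; [apply (zblock_bound tau (A + 1)); auto; lia|].
    assert (H1 : sqrt (INR (A + 1)) <= sqrt (INR N)) by (apply sqrt_le_1; try apply pos_INR; apply le_INR; lia).
    assert (H2 : sqrt tau / sqrt (INR N) <= sqrt tau / sqrt (INR (A + 1))).
    { apply Rmult_le_compat_l; [lra|]. apply Rinv_le_contravar; auto. }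
    assert (H3 : sqrt (INR (A + 1)) / tau <= sqrt (INR N) / tau).
    { apply Rmult_le_compat_r; auto. apply Rlt_le, Rinv_0_lt_compat; auto. }
    assert (H4 : 0 <= sqrt (INR (A + 1)) / tau) by (apply Rdiv_le_0_compat; lra).
    replace ((78 * sqrt tau + 40 * INR (A + 1) / tau) / sqrt (INR (A + 1))) with
      (78 * (sqrt tau / sqrt (INR (A + 1))) + 40 * (sqrt (INR (A + 1)) / tau)).
    2:{ rewrite <- SA at 3. field; lra. }
    assert (0 <= sqrt tau / sqrt (INR (A + 1))) by (apply Rdiv_le_0_compat; lra). lra.
  - set (N' := Nat.div2 N).
    assert (HN' : (2 * N' <= N <= 2 * N' + 1)%nat).
    { unfold N'. destruct (Nat.Even_or_Odd N) as [He|Ho].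
      - rewrite (Nat.Even_double N He) at 2 3. unfold Nat.double; lia.
      - rewrite (Nat.Odd_double N Ho) at 2 3. unfold Nat.double; lia. }
    assert (IHN := IH N' ltac:(lia) ltac:(lia)).
    set (K := (N' + 1)%nat).
    assert (E : Cminus (csum (zterm tau) N) (csum (zterm tau) A) =
                Cplus (Cminus (csum (zterm tau) N') (csum (zterm tau) A))
                  (csum (fun k => zterm tau (N' + k)) (N - N'))).
    { replace N with (N' + (N - N'))%nat at 1 by lia. rewrite csum_app. ring. }
    rewrite E. eapply Rle_trans; [apply Cmod_triangle|].
    assert (HK1 : INR (A + 1) <= INR K) by (apply le_INR; lia).
    assert (Hb : Cmod (csum (fun k => zterm tau (N' + k)) (N - N')) <=
      (78 * sqrt tau + 40 * INR K / tau) / sqrt (INR K)).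
    { apply zblock_bound; auto; try lia. eapply Rle_trans; [apply HA|]. nra. }
    assert (HsK := sqrt_INR_pos K ltac:(lia)). assert (HsN' := sqrt_INR_pos N' ltac:(lia)).
    assert (SK : sqrt (INR K) * sqrt (INR K) = INR K) by (apply sqrt_sqrt, pos_INR).
    replace ((78 * sqrt tau + 40 * INR K / tau) / sqrt (INR K)) with
      (78 * (sqrt tau / sqrt (INR K)) + 40 * (sqrt (INR K) / tau)) in Hb.
    2:{ rewrite <- SK at 3. field; lra. }
    assert (G1 : sqrt (INR N') <= (71 / 100) * sqrt (INR N)).
    { apply sqrt_half_gap; try (apply lt_0_INR; lia).
      assert (INR (2 * N') <= INR N) by (apply le_INR; lia). rewrite mult_INR in H. simpl in H. lra. }
    assert (G2 : sqrt (INR N) <= (3 / 2) * sqrt (INR K)).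
    { apply Rsqr_incr_0_var; [|lra]. unfold Rsqr.
      assert (INR N <= INR (2 * K)) by (apply le_INR; lia). rewrite mult_INR in H. simpl in H.
      replace ((3 / 2) * sqrt (INR K) * ((3 / 2) * sqrt (INR K))) with ((9 / 4) * (sqrt (INR K) * sqrt (INR K))) by field.
      rewrite SN, SK. generalize (pos_INR K); lra. }
    assert (G3 : sqrt (INR K) <= sqrt (INR N)).
    { apply sqrt_le_1; try apply pos_INR; apply le_INR; lia. }
    assert (T1 : sqrt tau / sqrt (INR K) <= (3 / 2) * (sqrt tau / sqrt (INR N))).
    { apply Rle_div_l; auto. replace ((3 / 2) * (sqrt tau / sqrt (INR N)) * sqrt (INR K)) with
        (sqrt tau * ((3 / 2) * sqrt (INR K) / sqrt (INR N))) by (field; lra).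
      assert (1 <= (3 / 2) * sqrt (INR K) / sqrt (INR N)) by (apply Rle_div_r; lra).
      rewrite <- (Rmult_1_r (sqrt tau)) at 1. apply Rmult_le_compat_l; lra. }
    assert (T2 : (7 / 5) * (sqrt tau / sqrt (INR N)) <= sqrt tau / sqrt (INR N')).
    { apply (Rle_div_r (7 / 5 * (sqrt tau / sqrt (INR N)))); auto. replace ((7 / 5) * (sqrt tau / sqrt (INR N)) * sqrt (INR N')) with
        (sqrt tau * ((7 / 5) * sqrt (INR N') / sqrt (INR N))) by (field; lra).
      assert ((7 / 5) * sqrt (INR N') / sqrt (INR N) <= 1) by (apply Rle_div_l; lra).
      rewrite <- (Rmult_1_r (sqrt tau)) at 2. apply Rmult_le_compat_l; lra. }
    assert (Hti : 0 < / tau) by (apply Rinv_0_lt_compat; auto).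
    assert (T3 : sqrt (INR K) / tau <= sqrt (INR N) / tau) by (unfold Rdiv; nra).
    assert (T4 : sqrt (INR N') / tau <= (71 / 100) * (sqrt (INR N) / tau)) by (unfold Rdiv; nra).
    assert (0 <= sqrt (INR N) / tau) by (apply Rdiv_le_0_compat; lra).
    assert (0 <= sqrt tau / sqrt (INR N)) by (apply Rdiv_le_0_compat; lra).
    lra.
Qed.

Lemma sum_inv_sqrt n : rsum (fun k => / sqrt (INR k)) n <= 2 * sqrt (INR n).
Proof.
  induction n as [|n IH]; [simpl; rewrite sqrt_0; lra|].
  change (rsum (fun k => / sqrt (INR k)) (S n)) with
    (rsum (fun k => / sqrt (INR k)) n + / sqrt (INR (S n))).
  assert (Hs := sqrt_INR_pos (S n) ltac:(lia)).
  assert (E1 : sqrt (INR (S n)) * sqrt (INR (S n)) = INR n + 1)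
    by (rewrite sqrt_sqrt, S_INR; auto; apply pos_INR).
  assert (E2 : sqrt (INR n) * sqrt (INR n) = INR n) by (apply sqrt_sqrt, pos_INR).
  assert (H : / sqrt (INR (S n)) <= 2 * sqrt (INR (S n)) - 2 * sqrt (INR n)).
  { apply Rmult_le_reg_r with (sqrt (INR (S n))); auto. rewrite Rinv_l by lra.
      nra. }
  lra.
Qed.

Lemma Cmod_zterm tau n : Cmod (zterm tau n) = / sqrt (INR n).
Proof.
  unfold zterm. rewrite Cmod_mult, Cmod_cis, Cmod_R, Rmult_1_r. apply Rabs_pos_eq.
  destruct (Rle_lt_or_eq_dec 0 (sqrt (INR n)) (sqrt_pos _)) as [H|H].
  - apply Rlt_le, Rinv_0_lt_compat; auto.
  - rewrite <- H, Rinv_0; lra.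
Qed.

Lemma zterm_trivial tau n : Cmod (csum (zterm tau) n) <= 2 * sqrt (INR n).
Proof.
  eapply Rle_trans; [|apply sum_inv_sqrt]. apply csum_bound; intros. rewrite Cmod_zterm; lra.
Qed.

(** The cut [A] is about [sqrt tau], where the trivial bound [2 sqrt A] and the van der Corput tail
    [400 sqrt tau / sqrt (A + 1)] are both of order [tau^{1/4}]. *)
Lemma zterm_partial tau N : 1 <= tau ->
  Cmod (csum (zterm tau) N) <= 402 * sqrt (sqrt tau) + 140 * (sqrt (INR N) / tau).
Proof.
  intros Ht. assert (Hq : 0 < sqrt tau) by (apply sqrt_lt_R0; lra).
  assert (Hqq : sqrt tau * sqrt tau = tau) by (apply sqrt_sqrt; lra).
  assert (Hr : 0 < sqrt (sqrt tau)) by (apply sqrt_lt_R0; lra).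
  assert (Hrr : sqrt (sqrt tau) * sqrt (sqrt tau) = sqrt tau) by (apply sqrt_sqrt; lra).
  assert (H0 : 0 <= sqrt (INR N) / tau) by (apply Rdiv_le_0_compat; [apply sqrt_pos|lra]).
  set (A := nat_floor (sqrt tau)).
  destruct (nat_floor_spec (sqrt tau)) as [F1 F2]; [lra|]. fold A in F1, F2.
  assert (TA : Cmod (csum (zterm tau) A) <= 2 * sqrt (sqrt tau)).
  { eapply Rle_trans; [apply zterm_trivial|].
    apply Rmult_le_compat_l; [lra|]. apply sqrt_le_1; auto; try lra. apply pos_INR. }
  destruct (le_lt_dec N A) as [Hc|Hc].
  - eapply Rle_trans; [apply zterm_trivial|].
    assert (sqrt (INR N) <= sqrt (sqrt tau)).
    { apply sqrt_le_1; try lra; [apply pos_INR|]. apply le_INR in Hc. lra. }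
    lra.
  - replace (csum (zterm tau) N) with
      (Cplus (csum (zterm tau) A) (Cminus (csum (zterm tau) N) (csum (zterm tau) A))) by ring.
    eapply Rle_trans; [apply Cmod_triangle|].
    assert (HA1 : sqrt tau <= INR (A + 1)) by (rewrite plus_INR; simpl; lra).
    assert (H1 : Cmod (Cminus (csum (zterm tau) N) (csum (zterm tau) A)) <=
       400 * (sqrt tau / sqrt (INR (A + 1))) - 300 * (sqrt tau / sqrt (INR N))
       + 140 * (sqrt (INR N) / tau)).
    { apply zterm_tail; auto; try lra. nra. }
    assert (HsA := sqrt_INR_pos (A + 1) ltac:(lia)). assert (HsN := sqrt_INR_pos N ltac:(lia)).
    assert (H2 : sqrt tau / sqrt (INR (A + 1)) <= sqrt (sqrt tau)).
    { apply Rle_div_l; auto. rewrite <- Hrr at 1. apply Rmult_le_compat_l; [lra|].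
      apply sqrt_le_1; lra. }
    assert (0 <= sqrt tau / sqrt (INR N)) by (apply Rdiv_le_0_compat; lra).
    lra.
Qed.

(** * Euler-Maclaurin steps and limits with a rate *)

Lemma mvt_le (f df : R -> R) x y : x < y ->
  (forall t, x <= t <= y -> is_derive f t (df t)) ->
  exists c, x <= c <= y /\ f y - f x = df c * (y - x).
Proof.
  intros Hxy H. destruct (MVT_gen f x y df) as [c [Hc E]].
  - rewrite Rmin_left, Rmax_right by lra. intros; apply H; lra.
  - rewrite Rmin_left, Rmax_right by lra. intros t Ht.
    apply derivable_continuous_pt, ex_derive_Reals_0. exists (df t). apply H; lra.
  - rewrite Rmin_left, Rmax_right in Hc by lra. exists c; auto.
Qed.

Lemma euler_maclaurin1 (F f f1 : R -> R) x B :
  (forall t, x <= t <= x + 1 -> is_derive F t (f t)) ->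
  (forall t, x <= t <= x + 1 -> is_derive f t (f1 t)) ->
  (forall t, x <= t <= x + 1 -> Rabs (f1 t) <= B) ->
  Rabs (f (x + 1) - (F (x + 1) - F x)) <= B.
Proof.
  intros HF Hf HB. destruct (mvt_le F f x (x + 1)) as [c [Hc E]]; [lra|auto|].
  rewrite E. replace (x + 1 - x) with 1 by ring. rewrite Rmult_1_r.
  destruct (Req_dec c (x + 1)) as [->|Hn].
  - rewrite Rminus_diag, Rabs_R0. eapply Rle_trans; [apply Rabs_pos|apply (HB x); lra].
  - destruct (mvt_le f f1 c (x + 1)) as [d [Hd E2]]; [lra|intros; apply Hf; lra|].
    rewrite E2, Rabs_mult, (Rabs_pos_eq (x + 1 - c)) by lra.
    assert (Rabs (f1 d) <= B) by (apply HB; lra). generalize (Rabs_pos (f1 d)); nra.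
Qed.

(** Trapezoidal rule. The error [E h] on [[x, x + h]] vanishes at 0 and its derivative at [c] equals
    [(c/2) (f1 (x + c) - f1 d)] for some [d] between [x] and [x + c], so one more mean value step
    brings in [f2]. *)
Lemma euler_maclaurin2 (F f f1 f2 : R -> R) x B :
  (forall t, x <= t <= x + 1 -> is_derive F t (f t)) ->
  (forall t, x <= t <= x + 1 -> is_derive f t (f1 t)) ->
  (forall t, x <= t <= x + 1 -> is_derive f1 t (f2 t)) ->
  (forall t, x <= t <= x + 1 -> Rabs (f2 t) <= B) ->
  Rabs ((f x + f (x + 1)) / 2 - (F (x + 1) - F x)) <= B.
Proof.
  intros HF Hf Hf1 HB.
  set (E := fun h => (f x + f (x + h)) * h / 2 - (F (x + h) - F x)).
  set (dE := fun h => f1 (x + h) * h / 2 + (f x + f (x + h)) / 2 - f (x + h)).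
  destruct (mvt_le E dE 0 1) as [c [Hc Ec]]; [lra| |].
  { intros h Hh. unfold E, dE.
    assert (D1 := HF (x + h) ltac:(lra)). assert (D2 := Hf (x + h) ltac:(lra)).
    auto_derive; [repeat split; [exists (f1 (x + h))|exists (f (x + h))]; auto|].
    replace (Derive (fun y => F y) (x + h)) with (f (x + h)) by (symmetry; apply is_derive_unique; auto).
    replace (Derive (fun y => f y) (x + h)) with (f1 (x + h)) by (symmetry; apply is_derive_unique; auto).
    field. }
  unfold E in Ec. rewrite Rplus_0_r in Ec.
  replace ((f x + f (x + 1)) / 2 - (F (x + 1) - F x)) with (dE c) by lra.
  destruct (Req_dec c 0) as [->|Hn].
  - unfold dE. rewrite Rplus_0_r.
    replace (f1 x * 0 / 2 + (f x + f x) / 2 - f x) with 0 by field. rewrite Rabs_R0.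
    eapply Rle_trans; [apply Rabs_pos|apply (HB x); lra].
  - destruct (mvt_le f f1 x (x + c)) as [d [Hd E2]]; [lra|intros; apply Hf; lra|].
    assert (Hdc : dE c = c / 2 * (f1 (x + c) - f1 d)).
    { unfold dE. replace (x + c - x) with c in E2 by ring. lra. }
    assert (H3 : Rabs (f1 (x + c) - f1 d) <= B).
    { destruct (Req_dec d (x + c)) as [->|Hn2].
      - rewrite Rminus_diag, Rabs_R0. eapply Rle_trans; [apply Rabs_pos|apply (HB x); lra].
      - destruct (mvt_le f1 f2 d (x + c)) as [e [He E3]]; [lra|intros; apply Hf1; lra|].
        rewrite E3, Rabs_mult, (Rabs_pos_eq (x + c - d)) by lra.
        assert (Rabs (f2 e) <= B) by (apply HB; lra). generalize (Rabs_pos (f2 e)); nra. }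
    rewrite Hdc, Rabs_mult, (Rabs_pos_eq (c / 2)) by lra.
    generalize (Rabs_pos (f1 (x + c) - f1 d)); nra.
Qed.

(** Increments dominated by those of [v] make [u] Cauchy, and letting the upper index tend to
    infinity gives the rate. The limits behind [zeta], [euler_gamma] and the derivative of [zetaR]
    all get their error terms this way. *)
Lemma tele_lim (u v : nat -> R) :
  (forall n, (1 <= n)%nat -> Rabs (u (S n) - u n) <= v n - v (S n)) ->
  is_lim_seq v 0 ->
  exists l : R, is_lim_seq u l /\ forall n, (1 <= n)%nat -> Rabs (l - u n) <= v n.
Proof.
  intros Hu Hv.
  assert (Hd : forall n m, (1 <= n)%nat -> (n <= m)%nat -> Rabs (u m - u n) <= v n - v m).
  { intros n m Hn Hm. induction Hm as [|m Hm IH].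
    - rewrite !Rminus_diag, Rabs_R0; lra.
    - replace (u (S m) - u n) with ((u (S m) - u m) + (u m - u n)) by ring.
      eapply Rle_trans; [apply Rabs_triang|]. assert (H := Hu m ltac:(lia)). lra. }
  assert (Hv0 : forall n, (1 <= n)%nat -> 0 <= v n).
  { intros n Hn. change (Rbar_le 0 (v n)).
    apply (is_lim_seq_le_loc v (fun _ => v n) 0 (v n)); auto; [|apply is_lim_seq_const].
    exists n. intros m Hm. assert (H := Hd n m Hn Hm). generalize (Rabs_pos (u m - u n)); lra. }
  assert (HC : ex_finite_lim_seq u).
  { apply ex_lim_seq_cauchy_corr. intros eps.
    apply is_lim_seq_spec in Hv. destruct (Hv (mkposreal (eps / 2) (is_pos_div_2 eps))) as [N HN].
    simpl in HN. exists (S N).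
    assert (W : forall n m, (S N <= n)%nat -> (n <= m)%nat -> Rabs (u n - u m) < eps).
    { intros n m Hn Hm. rewrite Rabs_minus_sym.
      eapply Rle_lt_trans; [apply Hd; lia|].
      assert (H1 := HN n ltac:(lia)). rewrite Rminus_0_r, Rabs_pos_eq in H1 by (apply Hv0; lia).
      assert (H2 := Hv0 m ltac:(lia)). generalize (cond_pos eps); lra. }
    intros n m Hn Hm. destruct (le_lt_dec n m); [apply W; auto|].
    rewrite Rabs_minus_sym; apply W; lia. }
  destruct HC as [l Hl]. exists l. split; auto. intros n Hn.
  assert (Hb : forall m, (n <= m)%nat -> Rabs (u m - u n) <= v n).
  { intros m Hm. assert (H := Hd n m Hn Hm). assert (H2 := Hv0 m ltac:(lia)). lra. }
  assert (HA : is_lim_seq (fun m => Rabs (u m - u n)) (Rabs (l - u n))).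
  { apply (is_lim_seq_abs (fun m => u m - u n) (l - u n)).
    apply is_lim_seq_minus'; auto. apply is_lim_seq_const. }
  change (Rbar_le (Rabs (l - u n)) (v n)).
  apply (is_lim_seq_le_loc _ (fun _ => v n) _ _) with (2 := HA); [|apply is_lim_seq_const].
  exists n; auto.
Qed.

Lemma lim_Rpower_neg s : 0 < s -> is_lim_seq (fun n => Rpower (INR n) (- s)) 0.
Proof.
  intros Hs. apply is_lim_seq_incr_1.
  apply (is_lim_comp_seq exp (fun n => - s * ln (INR (S n))) m_infty 0).
  - apply is_lim_exp_m.
  - exists 0%nat; intros; discriminate.
  - replace m_infty with (Rbar_mult (- s) p_infty).
    + apply is_lim_seq_scal_l.
      apply (is_lim_comp_seq ln (fun n => INR (S n)) p_infty p_infty).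
      * apply is_lim_ln_p.
      * exists 0%nat; intros; discriminate.
      * apply (is_lim_seq_incr_1 INR). apply is_lim_seq_INR.
    + simpl. case Rle_dec; intros H; [|auto]. exfalso; lra.
Qed.

Lemma Rpower_derive a x : 0 < x -> is_derive (fun y => Rpower y a) x (a * Rpower x (a - 1)).
Proof. intros. apply is_derive_Reals. apply derivable_pt_lim_power; auto. Qed.

(** Mean value theorem; the intermediate point is at most [x + 1 <= 2 x], which costs [2^{s+1}]. It
    puts Euler-Maclaurin errors into the telescoping form wanted by [tele_lim]. *)
Lemma Rpower_tele s x : 0 < s -> 1 <= x ->
  Rpower x (- s - 1) <= Rpower 2 (s + 1) / s * (Rpower x (- s) - Rpower (x + 1) (- s)).
Proof.
  intros Hs Hx.
  destruct (mvt_le (fun y => Rpower y (- s)) (fun y => - s * Rpower y (- s - 1)) x (x + 1))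
    as [c [Hc E]]; [lra|intros; apply Rpower_derive; lra|].
  replace (Rpower x (- s) - Rpower (x + 1) (- s)) with (s * Rpower c (- s - 1)) by lra.
  replace (Rpower 2 (s + 1) / s * (s * Rpower c (- s - 1))) with
    (Rpower 2 (s + 1) * Rpower c (- s - 1)) by (field; lra).
  assert (H : Rpower (2 * x) (- s - 1) <= Rpower c (- s - 1)) by (apply Rpower_le_base_neg; lra).
  rewrite <- Rpower_mult_distr in H by lra.
  apply Rle_trans with (Rpower 2 (s + 1) * (Rpower 2 (- s - 1) * Rpower x (- s - 1))).
  - rewrite <- Rmult_assoc, <- Rpower_plus. replace (s + 1 + (- s - 1)) with 0 by ring.
    rewrite Rpower_O by lra. lra.
  - apply Rmult_le_compat_l; auto. apply Rlt_le, Rpower_pos.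
Qed.

(** * Euler-Maclaurin approximation of zeta *)

(* [pc a tau phi x] is the real part of [e^{i phi} x^{a + i tau}]. *)
Definition pc (a tau phi x : R) : R := Rpower x a * cos (tau * ln x + phi).

(* A primitive of [pc a tau phi]. *)
Definition pF (a tau phi x : R) : R :=
  ((a + 1) * pc (a + 1) tau phi x + tau * pc (a + 1) tau (phi - PI / 2) x)
  / ((a + 1) ^ 2 + tau ^ 2).

Lemma cos_minus_half x : cos (x - PI / 2) = sin x.
Proof. rewrite cos_minus, cos_PI2, sin_PI2. ring. Qed.

Lemma sin_minus_half x : sin (x - PI / 2) = - cos x.
Proof. rewrite sin_minus, cos_PI2, sin_PI2. ring. Qed.

Lemma pc_derive a tau phi x : 0 < x ->
  is_derive (pc a tau phi) x (a * pc (a - 1) tau phi x - tau * pc (a - 1) tau (phi - PI / 2) x).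
Proof.
  intros Hx. unfold pc.
  replace (tau * ln x + (phi - PI / 2)) with (tau * ln x + phi - PI / 2) by ring.
  rewrite cos_minus_half.
  assert (E : Rpower x (a - 1) = Rpower x a / x).
  { unfold Rminus. rewrite Rpower_plus, Rpower_Ropp, Rpower_1 by auto. auto. }
  rewrite E. unfold Rpower. auto_derive; auto. field. lra.
Qed.

Lemma pc_bound a tau phi x : Rabs (pc a tau phi x) <= Rpower x a.
Proof.
  unfold pc. rewrite Rabs_mult, (Rabs_pos_eq (Rpower x a)) by (apply Rlt_le, Rpower_pos).
  assert (H := COS_bound (tau * ln x + phi)).
  assert (Rabs (cos (tau * ln x + phi)) <= 1) by (apply Rabs_le; lra).
  generalize (Rpower_pos x a). nra.
Qed.

(** Two phase shifts by [PI/2] change the sign of [pc], so in the derivative the cross terms cancel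
    and [(a + 1)^2 + tau^2] remains as a factor. *)
Lemma pF_derive a tau phi x : 0 < x -> (a + 1) ^ 2 + tau ^ 2 <> 0 ->
  is_derive (pF a tau phi) x (pc a tau phi x).
Proof.
  intros Hx Hn. unfold pF.
  assert (D1 := pc_derive (a + 1) tau phi x Hx).
  assert (D2 := pc_derive (a + 1) tau (phi - PI / 2) x Hx).
  replace (a + 1 - 1) with a in * by ring.
  assert (E : pc a tau (phi - PI / 2 - PI / 2) x = - pc a tau phi x).
  { unfold pc. replace (tau * ln x + (phi - PI / 2 - PI / 2)) with
      (tau * ln x + phi - PI / 2 - PI / 2) by ring.
    rewrite cos_minus_half, sin_minus_half. ring. }
  rewrite E in D2.
  apply (is_derive_ext (fun x => / ((a + 1) ^ 2 + tau ^ 2) *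
    ((a + 1) * pc (a + 1) tau phi x + tau * pc (a + 1) tau (phi - PI / 2) x))).
  { intros t. unfold Rdiv. apply Rmult_comm. }
  evar_last.
  - apply is_derive_scal. apply (is_derive_plus (V := R_NormedModule)).
    + apply is_derive_scal. apply D1.
    + apply is_derive_scal. apply D2.
  - unfold plus; simpl. field. simpl in Hn. lra.
Qed.

(* [nterm sigma tau n = n^{-sigma + i tau}], the [n]-th term of [zeta (sigma - i tau)]. *)
Definition nterm (sigma tau : R) (n : nat) : C :=
  Cmult (RtoC (Rpower (INR n) (- sigma))) (cis (tau * ln (INR n))).

(* [polef sigma tau x = x^{1-s} / (1-s)] with [s = sigma - i tau]. *)
Definition polef (sigma tau x : R) : C :=
  (pF (- sigma) tau 0 x, pF (- sigma) tau (- (PI / 2)) x).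

(* Tends to [zeta (sigma - i tau)]: the partial sum without its pole term. *)
Definition zu (sigma tau : R) (N : nat) : C :=
  Cminus (csum (nterm sigma tau) N) (polef sigma tau (INR N)).

Lemma nterm_pc sigma tau n :
  nterm sigma tau n = (pc (- sigma) tau 0 (INR n), pc (- sigma) tau (- (PI / 2)) (INR n)).
Proof.
  unfold nterm, pc, cis, Cmult, RtoC; simpl. rewrite Rplus_0_r.
  change (tau * ln (INR n) + - (PI / 2)) with (tau * ln (INR n) - PI / 2).
  rewrite cos_minus_half. f_equal; ring.
Qed.

Lemma polef_alt sigma tau x : (1 - sigma) ^ 2 + tau ^ 2 <> 0 ->
  polef sigma tau x =
  Cmult (Cinv (1 - sigma, tau)) (Cmult (RtoC (Rpower x (1 - sigma))) (cis (tau * ln x))).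
Proof.
  intros H. unfold polef, pF, pc, cis, Cmult, Cinv, RtoC; simpl.
  replace (- sigma + 1) with (1 - sigma) by ring.
  replace (tau * ln x + (0 - PI / 2)) with (tau * ln x - PI / 2) by ring.
  replace (tau * ln x + (- (PI / 2) - PI / 2)) with (tau * ln x - PI / 2 - PI / 2) by ring.
  change (tau * ln x + - (PI / 2)) with (tau * ln x - PI / 2).
  rewrite !cos_minus_half, !sin_minus_half, Rplus_0_r. simpl in H.
  f_equal; field; lra.
Qed.

Lemma pc_em1 sigma tau phi x : 0 < sigma -> (1 - sigma) ^ 2 + tau ^ 2 <> 0 -> 1 <= x ->
  Rabs (pc (- sigma) tau phi (x + 1)
        - (pF (- sigma) tau phi (x + 1) - pF (- sigma) tau phi x))
  <= (sigma + Rabs tau) * Rpower x (- sigma - 1).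
Proof.
  intros Hs Hn Hx.
  apply (euler_maclaurin1 (pF (- sigma) tau phi) (pc (- sigma) tau phi)
    (fun y => - sigma * pc (- sigma - 1) tau phi y
              - tau * pc (- sigma - 1) tau (phi - PI / 2) y)).
  - intros t Ht. apply pF_derive; [lra|]. replace (- sigma + 1) with (1 - sigma) by ring; auto.
  - intros t Ht. apply pc_derive; lra.
  - intros t Ht. unfold Rminus at 1. eapply Rle_trans; [apply Rabs_triang|].
    rewrite Rabs_Ropp, !Rabs_mult, Rabs_Ropp, (Rabs_pos_eq sigma) by lra.
    assert (H1 := pc_bound (- sigma - 1) tau phi t).
    assert (H2 := pc_bound (- sigma - 1) tau (phi - PI / 2) t).
    assert (H3 : Rpower t (- sigma - 1) <= Rpower x (- sigma - 1)) by (apply Rpower_le_base_neg; lra).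
    generalize (Rabs_pos tau); intros. rewrite Rmult_plus_distr_r.
    apply Rplus_le_compat; apply Rmult_le_compat_l; lra.
Qed.

Definition em_const (sigma tau : R) : R := (sigma + Rabs tau) * (Rpower 2 (sigma + 1) / sigma).

Lemma em_const_pos sigma tau : 0 < sigma -> 0 < em_const sigma tau.
Proof.
  intros. unfold em_const. generalize (Rabs_pos tau) (Rpower_pos 2 (sigma + 1)); intros.
  apply Rmult_lt_0_compat; [lra|]. apply Rdiv_lt_0_compat; auto.
Qed.

Lemma lim_scal_Rpower_neg a s : 0 < s -> is_lim_seq (fun n => a * Rpower (INR n) (- s)) 0.
Proof.
  intros Hs. replace (Finite 0) with (Rbar_mult a 0) by (simpl; f_equal; ring).
  apply is_lim_seq_scal_l. apply lim_Rpower_neg; auto.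
Qed.

(** Real and imaginary parts are the phases 0 and [- PI/2] of [pc] and are treated at once by the
    claim [G]; adding their two errors gives the factor 2. *)
Lemma zu_lim sigma tau : 0 < sigma -> (1 - sigma) ^ 2 + tau ^ 2 <> 0 ->
  exists Z : C, forall N, (1 <= N)%nat ->
    Cmod (Cminus Z (zu sigma tau N)) <= 2 * em_const sigma tau * Rpower (INR N) (- sigma).
Proof.
  intros Hs Hn.
  assert (G : forall phi, exists l : R, forall N, (1 <= N)%nat ->
    Rabs (l - (rsum (fun k => pc (- sigma) tau phi (INR k)) N - pF (- sigma) tau phi (INR N)))
    <= em_const sigma tau * Rpower (INR N) (- sigma)).
  { intros phi.
    destruct (tele_lim
      (fun N => rsum (fun k => pc (- sigma) tau phi (INR k)) N - pF (- sigma) tau phi (INR N))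
      (fun N => em_const sigma tau * Rpower (INR N) (- sigma))) as [l [_ Hl]].
    - intros n Hn1. rewrite S_INR. cbn [rsum]. rewrite S_INR.
      match goal with |- Rabs ?e <= _ => replace e with
        (pc (- sigma) tau phi (INR n + 1)
        - (pF (- sigma) tau phi (INR n + 1) - pF (- sigma) tau phi (INR n))) by ring end.
      assert (N1 := INR_ge1 n Hn1).
      eapply Rle_trans; [apply pc_em1; auto|]. unfold em_const.
      rewrite <- Rmult_minus_distr_l, Rmult_assoc.
      apply Rmult_le_compat_l; [generalize (Rabs_pos tau); lra|].
      apply Rpower_tele; auto.
    - apply lim_scal_Rpower_neg; auto.
    - exists l; auto. }
  destruct (G 0) as [l1 H1]. destruct (G (- (PI / 2))) as [l2 H2].
  exists (l1, l2). intros N HN. specialize (H1 N HN). specialize (H2 N HN).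
  eapply Rle_trans; [apply Cmod_le_sum|].
  assert (E : csum (nterm sigma tau) N =
    (rsum (fun k => pc (- sigma) tau 0 (INR k)) N,
     rsum (fun k => pc (- sigma) tau (- (PI / 2)) (INR k)) N)).
  { clear. induction N as [|N IH]; [auto|]. cbn [csum rsum]. rewrite IH, nterm_pc. auto. }
  unfold zu. rewrite E. unfold polef, Cminus, Cplus, Copp; cbn [fst snd].
  unfold Rminus in H1, H2.
  lra.
Qed.

(** The even-numbered terms have the wrong sign in eta, and twice the [2n]-th term is [2^{1-s}]
    times the [n]-th. The index [2 M + 1] stands for [2 M + 2] terms, as [eta_partial] counts from
    0. *)
Lemma eta_partial_odd sigma tau M :
  eta_partial sigma (- tau) (2 * M + 1) =
  Cminus (csum (nterm sigma tau) (2 * M + 2))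
    (Cmult (two_pow_1ms sigma (- tau)) (csum (nterm sigma tau) (M + 1))).
Proof.
  assert (Hnp : forall n, npow_neg n sigma (- tau) = nterm sigma tau n).
  { intros n. unfold npow_neg, nterm, cis, Cmult, RtoC; simpl.
    replace (- tau * ln (INR n)) with (- (tau * ln (INR n))) by ring.
    rewrite cos_neg, sin_neg. f_equal; ring. }
  assert (Hdbl : forall n, (1 <= n)%nat -> Cmult (two_pow_1ms sigma (- tau)) (nterm sigma tau n)
     = Cmult (RtoC 2) (nterm sigma tau (2 * n))).
  { intros n Hn. unfold nterm, two_pow_1ms. rewrite mult_INR. change (INR 2) with 2.
    assert (0 < INR n) by (apply lt_0_INR; lia).
    rewrite ln_mult, Rmult_plus_distr_l, cis_plus, <- Rpower_mult_distr by lra.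
    unfold Rminus. rewrite Rpower_plus, Rpower_1 by lra.
    replace (- tau * ln 2) with (- (tau * ln 2)) by ring. rewrite cos_neg, sin_neg.
    unfold cis, Cmult, RtoC; simpl. f_equal; ring. }
  assert (Hpow : forall n, ((-1) ^ (2 * n) = 1)%R).
  { intros n. rewrite pow_mult. replace ((-1) ^ 2) with 1 by ring. apply pow1. }
  unfold eta_partial.
  induction M as [|M IH].
  - simpl. rewrite sum_Sn, sum_O. rewrite !Hnp. simpl.
    change plus with Cplus.
    replace (Cmult (two_pow_1ms sigma (- tau)) (Cplus (RtoC 0) (nterm sigma tau 1)))
      with (Cmult (two_pow_1ms sigma (- tau)) (nterm sigma tau 1)) by ring.
    rewrite Hdbl by lia. simpl. rewrite Rmult_1_r. ring.
  - replace (2 * S M + 1)%nat with (S (S (2 * M + 1))) by lia.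
    rewrite !sum_Sn, IH.
    replace (2 * S M + 2)%nat with (S (S (2 * M + 2))) by lia.
    replace (S M + 1)%nat with (S (M + 1)) by lia. cbn [csum].
    rewrite !Hnp. change plus with Cplus.
    rewrite (Cmult_plus_distr_l (two_pow_1ms _ _)), Hdbl by lia.
    replace (S (2 * M + 1)) with (2 * (M + 1))%nat by lia.
    replace ((-1) ^ S (2 * (M + 1)))%R with (-1)%R by (rewrite <- tech_pow_Rmult, Hpow; ring).
    rewrite Hpow.
    replace (S (2 * (M + 1))) with (S (2 * M + 2)) by lia.
    replace (2 * S (M + 1))%nat with (S (S (2 * M + 2))) by lia.
    ring.
Qed.

Lemma lim_of_bound (u : nat -> C) (Z : C) (v : nat -> R) :
  (forall N, (1 <= N)%nat -> Cmod (Cminus (u N) Z) <= v N) -> is_lim_seq v 0 ->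
  is_lim_seq (fun N => fst (u N)) (fst Z) /\ is_lim_seq (fun N => snd (u N)) (snd Z).
Proof.
  intros H Hv.
  assert (G : forall p : C -> R, (forall a b, p (Cminus a b) = p a - p b) ->
    (forall z, Rabs (p z) <= Cmod z) -> is_lim_seq (fun N => p (u N)) (p Z)).
  { intros p Hp Hb. apply is_lim_seq_spec. intros eps. apply is_lim_seq_spec in Hv.
    destruct (Hv eps) as [N HN]. exists (S N). intros n Hn.
    rewrite <- Hp. eapply Rle_lt_trans; [apply Hb|].
    eapply Rle_lt_trans; [apply H; lia|].
    specialize (HN n ltac:(lia)). rewrite Rminus_0_r in HN.
    eapply Rle_lt_trans; [apply Rle_abs|exact HN]. }
  split; apply G; auto using fst_le_Cmod, snd_le_Cmod.
Qed.

Lemma two_pow_1ms_cis sigma tau :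
  two_pow_1ms sigma (- tau) = Cmult (RtoC (Rpower 2 (1 - sigma))) (cis (tau * ln 2)).
Proof.
  unfold two_pow_1ms, cis, Cmult, RtoC; simpl.
  replace (- tau * ln 2) with (- (tau * ln 2)) by ring. rewrite cos_neg, sin_neg.
  f_equal; ring.
Qed.

Lemma polef_double sigma tau x : (1 - sigma) ^ 2 + tau ^ 2 <> 0 -> 0 < x ->
  polef sigma tau (2 * x) = Cmult (two_pow_1ms sigma (- tau)) (polef sigma tau x).
Proof.
  intros H Hx. rewrite !polef_alt by auto. rewrite two_pow_1ms_cis.
  rewrite ln_mult, Rmult_plus_distr_l, cis_plus, <- Rpower_mult_distr, RtoC_mult by lra. ring.
Qed.

Lemma Cmod_two_pow sigma tau : Cmod (two_pow_1ms sigma (- tau)) = Rpower 2 (1 - sigma).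
Proof.
  rewrite two_pow_1ms_cis, Cmod_Rmult, Cmod_cis by (apply Rlt_le, Rpower_pos). ring.
Qed.

Lemma Cmod_nterm sigma tau n : Cmod (nterm sigma tau n) = Rpower (INR n) (- sigma).
Proof. unfold nterm. rewrite Cmod_Rmult, Cmod_cis by (apply Rlt_le, Rpower_pos). ring. Qed.

Lemma npow_neg_nterm sigma tau n : npow_neg n sigma (- tau) = nterm sigma tau n.
Proof.
  unfold npow_neg, nterm, cis, Cmult, RtoC; simpl.
  replace (- tau * ln (INR n)) with (- (tau * ln (INR n))) by ring.
  rewrite cos_neg, sin_neg. f_equal; ring.
Qed.

(** By [polef_double] the pole terms of the two sums in [eta_partial_odd] cancel, so odd-indexed
    partial sums approach [(1 - 2^{1-s}) Z]. An even index differs from the preceding odd one by a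
    single term, which tends to 0. *)
Lemma eta_lim sigma tau Z B : 0 < sigma -> (1 - sigma) ^ 2 + tau ^ 2 <> 0 -> 0 <= B ->
  (forall N, (1 <= N)%nat -> Cmod (Cminus Z (zu sigma tau N)) <= B * Rpower (INR N) (- sigma)) ->
  eta sigma (- tau) = Cmult (Cminus (RtoC 1) (two_pow_1ms sigma (- tau))) Z.
Proof.
  intros Hs Hn HB HZ. set (w := two_pow_1ms sigma (- tau)).
  set (L := Cmult (Cminus (RtoC 1) w) Z).
  set (D := B + Cmod w * (B * Rpower 2 sigma)).
  assert (P2 := Rpower_pos 2 sigma). assert (Hw := Cmod_ge_0 w).
  assert (HD : 0 <= D).
  { unfold D. apply Rplus_le_le_0_compat; auto. repeat apply Rmult_le_pos; lra. }
  assert (Hdbl : forall x, 0 < x -> Rpower x (- sigma) = Rpower 2 sigma * Rpower (2 * x) (- sigma)).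
  { intros x Hx. rewrite <- Rpower_mult_distr by lra. rewrite <- Rmult_assoc, <- Rpower_plus.
    replace (sigma + - sigma) with 0 by ring. rewrite Rpower_O by lra. ring. }
  assert (Hodd : forall M, Cmod (Cminus (eta_partial sigma (- tau) (2 * M + 1)) L) <=
     D * Rpower (INR (2 * M + 2)) (- sigma)).
  { intros M. rewrite eta_partial_odd. fold w.
    assert (E : Cminus (csum (nterm sigma tau) (2 * M + 2)) (Cmult w (csum (nterm sigma tau) (M + 1)))
      = Cminus (zu sigma tau (2 * M + 2)) (Cmult w (zu sigma tau (M + 1)))).
    { unfold zu. replace (INR (2 * M + 2)) with (2 * INR (M + 1)).
      - rewrite polef_double; auto; [|apply lt_0_INR; lia]. fold w. ring.
      - replace (2 * M + 2)%nat with (2 * (M + 1))%nat by lia. rewrite mult_INR. auto. }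
    rewrite E. unfold L.
    replace (Cminus (Cminus (zu sigma tau (2 * M + 2)) (Cmult w (zu sigma tau (M + 1))))
      (Cmult (Cminus (RtoC 1) w) Z)) with
      (Cplus (Copp (Cminus Z (zu sigma tau (2 * M + 2)))) (Cmult w (Cminus Z (zu sigma tau (M + 1)))))
      by ring.
    eapply Rle_trans; [apply Cmod_triangle|]. rewrite Cmod_opp, Cmod_mult.
    unfold D. rewrite Rmult_plus_distr_r. apply Rplus_le_compat; [apply HZ; lia|].
    rewrite Rmult_assoc. apply Rmult_le_compat_l; auto.
    eapply Rle_trans; [apply HZ; lia|]. rewrite Rmult_assoc. apply Rmult_le_compat_l; auto.
    rewrite (Hdbl (INR (M + 1))) by (apply lt_0_INR; lia).
    replace (2 * INR (M + 1)) with (INR (2 * M + 2)); [lra|].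
    replace (2 * M + 2)%nat with (2 * (M + 1))%nat by lia. rewrite mult_INR. auto. }
  set (D2 := D * Rpower 2 sigma + D + 1).
  assert (Hall : forall N, (1 <= N)%nat ->
     Cmod (Cminus (eta_partial sigma (- tau) N) L) <= D2 * Rpower (INR (S N)) (- sigma)).
  { intros N HN. destruct (Nat.Even_or_Odd N) as [[M HM]|[M HM]].
    - destruct M as [|M]; [lia|]. replace N with (S (2 * M + 1)) by lia.
      unfold eta_partial at 1. rewrite sum_Sn. change plus with Cplus.
      fold (eta_partial sigma (- tau) (2 * M + 1)). rewrite npow_neg_nterm.
      match goal with |- Cmod (Cminus (Cplus ?a ?b) L) <= _ =>
        replace (Cminus (Cplus a b) L) with (Cplus (Cminus a L) b) by ring end.
      eapply Rle_trans; [apply Cmod_triangle|].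
      rewrite Cmod_mult, Cmod_nterm, Cmod_R, <- RPow_abs.
      replace (Rabs (-1)) with 1 by (rewrite Rabs_left; lra). rewrite pow1, Rmult_1_l.
      specialize (Hodd M).
      assert (H1 : Rpower (INR (2 * M + 2)) (- sigma) <=
         Rpower 2 sigma * Rpower (INR (S (S (2 * M + 1)))) (- sigma)).
      { rewrite Hdbl by (apply lt_0_INR; lia). apply Rmult_le_compat_l; [lra|].
        assert (0 < INR (S (S (2 * M + 1)))) by (apply lt_0_INR; lia).
        apply Rpower_le_base_neg; [|lra]. split; auto. change 2 with (INR 2).
        rewrite <- mult_INR. apply le_INR; lia. }
      assert (P := Rpower_pos (INR (S (S (2 * M + 1)))) (- sigma)).
      assert (D * Rpower (INR (2 * M + 2)) (- sigma) <=
        D * (Rpower 2 sigma * Rpower (INR (S (S (2 * M + 1)))) (- sigma)))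
        by (apply Rmult_le_compat_l; auto).
      unfold D2. nra.
    - subst N. eapply Rle_trans; [apply Hodd|].
      replace (S (2 * M + 1)) with (2 * M + 2)%nat by lia.
      apply Rmult_le_compat_r; [apply Rlt_le, Rpower_pos|].
      unfold D2. assert (0 <= D * Rpower 2 sigma) by (apply Rmult_le_pos; lra). lra. }
  destruct (lim_of_bound (eta_partial sigma (- tau)) L
    (fun N => D2 * Rpower (INR (S N)) (- sigma)) Hall) as [L1 L2].
  { apply (is_lim_seq_incr_1 (fun N => D2 * Rpower (INR N) (- sigma))).
    apply lim_scal_Rpower_neg; auto. }
  unfold eta. rewrite (is_lim_seq_unique _ _ L1), (is_lim_seq_unique _ _ L2). cbn [real].
  symmetry. apply surjective_pairing.
Qed.

(** Ties the eta quotient defining [zeta] to ordinary partial sums. The denominator does not vanish,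
    because [|2^{1-s}| = 2^{1-sigma}] differs from 1. *)
Lemma zeta_zu sigma tau N : 0 < sigma -> sigma <> 1 -> (1 <= N)%nat ->
  Cmod (Cminus (zeta sigma (- tau)) (zu sigma tau N)) <=
  2 * em_const sigma tau * Rpower (INR N) (- sigma).
Proof.
  intros Hs H1 HN.
  assert (Hn : (1 - sigma) ^ 2 + tau ^ 2 <> 0).
  { assert (0 < (1 - sigma) ^ 2) by (apply pow2_gt_0; lra).
    generalize (pow2_ge_0 tau); lra. }
  destruct (zu_lim sigma tau Hs Hn) as [Z HZ].
  replace (zeta sigma (- tau)) with Z; [apply HZ; auto|].
  unfold zeta. rewrite (eta_lim sigma tau Z (2 * em_const sigma tau) Hs Hn); auto.
  2:{ generalize (em_const_pos sigma tau Hs); lra. }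
  field. intros E.
  assert (E2 : two_pow_1ms sigma (- tau) = RtoC 1).
  { replace (RtoC 1) with (Cplus (Cminus (RtoC 1) (two_pow_1ms sigma (- tau)))
      (two_pow_1ms sigma (- tau))) by ring. rewrite E. ring. }
  assert (E3 := Cmod_two_pow sigma tau). rewrite E2, Cmod_1 in E3.
  assert (E4 : ln 1 = ln (Rpower 2 (1 - sigma))) by (f_equal; auto).
  rewrite ln_1, ln_Rpower in E4. assert (L2 := ln_lt_2).
  assert (1 - sigma = 0) by (apply Rmult_eq_reg_r with (ln 2); lra). lra.
Qed.

Lemma pc_em2 sigma tau phi x : 0 < sigma -> (1 - sigma) ^ 2 + tau ^ 2 <> 0 -> 1 <= x ->
  Rabs ((pc (- sigma) tau phi x + pc (- sigma) tau phi (x + 1)) / 2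
        - (pF (- sigma) tau phi (x + 1) - pF (- sigma) tau phi x))
  <= (sigma + Rabs tau) * (sigma + 1 + Rabs tau) * Rpower x (- (sigma + 1) - 1).
Proof.
  intros Hs Hn Hx.
  set (d := fun phi y => (- sigma - 1) * pc (- sigma - 1 - 1) tau phi y
              - tau * pc (- sigma - 1 - 1) tau (phi - PI / 2) y).
  apply (euler_maclaurin2 (pF (- sigma) tau phi) (pc (- sigma) tau phi)
    (fun y => - sigma * pc (- sigma - 1) tau phi y
              - tau * pc (- sigma - 1) tau (phi - PI / 2) y)
    (fun y => - sigma * d phi y - tau * d (phi - PI / 2) y)).
  - intros t Ht. apply pF_derive; [lra|]. replace (- sigma + 1) with (1 - sigma) by ring; auto.
  - intros t Ht. apply pc_derive; lra.
  - intros t Ht. apply (is_derive_minus (V := R_NormedModule)); apply is_derive_scal;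
      apply pc_derive; lra.
  - intros t Ht.
    assert (Hd : forall p, Rabs (d p t) <= (sigma + 1 + Rabs tau) * Rpower x (- (sigma + 1) - 1)).
    { intros p. unfold d, Rminus at 1. eapply Rle_trans; [apply Rabs_triang|].
      rewrite Rabs_Ropp, !Rabs_mult.
      replace (Rabs (- sigma - 1)) with (sigma + 1) by (rewrite Rabs_left; lra).
      assert (H1 := pc_bound (- sigma - 1 - 1) tau p t).
      assert (H2 := pc_bound (- sigma - 1 - 1) tau (p - PI / 2) t).
      replace (- sigma - 1 - 1) with (- (sigma + 1) - 1) in * by ring.
      assert (H3 : Rpower t (- (sigma + 1) - 1) <= Rpower x (- (sigma + 1) - 1))
        by (apply Rpower_le_base_neg; lra).
      generalize (Rabs_pos tau); intros. rewrite (Rmult_plus_distr_r (sigma + 1)).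
      apply Rplus_le_compat; apply Rmult_le_compat_l; lra. }
    unfold Rminus at 1. eapply Rle_trans; [apply Rabs_triang|].
    rewrite Rabs_Ropp, !Rabs_mult, Rabs_Ropp, (Rabs_pos_eq sigma) by lra.
    generalize (Rabs_pos tau); intros. rewrite Rmult_assoc, Rmult_plus_distr_r.
    apply Rplus_le_compat; apply Rmult_le_compat_l; auto; lra.
Qed.

Definition em2_const (sigma tau : R) : R :=
  (sigma + Rabs tau) * (sigma + 1 + Rabs tau) * (Rpower 2 (sigma + 1 + 1) / (sigma + 1)).

(** Removing half of the last term turns the rule into the trapezoidal one. The gain matters on the
    critical line with [N] about [tau^2]: the bound of [zeta_zu] is of order 1 there, this one of
    order [1/tau]. *)
Lemma zeta_zu2 sigma tau N : 0 < sigma -> sigma <> 1 -> (1 <= N)%nat ->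
  Cmod (Cminus (zeta sigma (- tau)) (zu sigma tau N)) <=
  / 2 * Rpower (INR N) (- sigma) + 2 * em2_const sigma tau * Rpower (INR N) (- (sigma + 1)).
Proof.
  intros Hs H1 HN.
  assert (Hn : (1 - sigma) ^ 2 + tau ^ 2 <> 0).
  { assert (0 < (1 - sigma) ^ 2) by (apply pow2_gt_0; lra).
    generalize (pow2_ge_0 tau); lra. }
  assert (E : forall N, csum (nterm sigma tau) N =
    (rsum (fun k => pc (- sigma) tau 0 (INR k)) N,
     rsum (fun k => pc (- sigma) tau (- (PI / 2)) (INR k)) N)).
  { clear. induction N as [|N IH]; [auto|]. cbn [csum rsum]. rewrite IH, nterm_pc. auto. }
  set (u := fun phi N => rsum (fun k => pc (- sigma) tau phi (INR k)) N
      - pF (- sigma) tau phi (INR N)).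
  assert (G : forall phi, exists l : R,
    is_lim_seq (u phi) l /\
    Rabs (l - (u phi N - / 2 * pc (- sigma) tau phi (INR N)))
    <= em2_const sigma tau * Rpower (INR N) (- (sigma + 1))).
  { intros phi.
    destruct (tele_lim
      (fun N => u phi N - / 2 * pc (- sigma) tau phi (INR N))
      (fun N => em2_const sigma tau * Rpower (INR N) (- (sigma + 1)))) as [l [Hl1 Hl]].
    - intros n Hn1. unfold u. rewrite S_INR. cbn [rsum]. rewrite S_INR.
      match goal with |- Rabs ?e <= _ => replace e with
        ((pc (- sigma) tau phi (INR n) + pc (- sigma) tau phi (INR n + 1)) / 2
        - (pF (- sigma) tau phi (INR n + 1) - pF (- sigma) tau phi (INR n))) by field end.
      assert (N1 := INR_ge1 n Hn1).
      eapply Rle_trans; [apply pc_em2; auto|]. unfold em2_const.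
      rewrite <- Rmult_minus_distr_l, Rmult_assoc, (Rmult_assoc _ (Rpower _ _ / _)), (Rmult_assoc (_ + _)).
      generalize (Rabs_pos tau); intros.
      apply Rmult_le_compat_l; [lra|]. apply Rmult_le_compat_l; [lra|].
      apply Rpower_tele; auto; lra.
    - apply lim_scal_Rpower_neg; lra.
    - exists l; split; auto.
      assert (L0 : is_lim_seq (fun N => / 2 * pc (- sigma) tau phi (INR N)) 0).
      { apply is_lim_seq_abs_0.
        apply (is_lim_seq_le_le (fun _ => 0) _ (fun N => / 2 * Rpower (INR N) (- sigma))).
        - intros n. split; [apply Rabs_pos|]. rewrite Rabs_mult, (Rabs_pos_eq (/ 2)) by lra.
          generalize (pc_bound (- sigma) tau phi (INR n)); lra.
        - apply is_lim_seq_const.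
        - apply lim_scal_Rpower_neg; auto. }
      replace l with (l + 0) by ring.
      apply (is_lim_seq_ext (fun N => (u phi N - / 2 * pc (- sigma) tau phi (INR N))
         + / 2 * pc (- sigma) tau phi (INR N))); [intros; ring|].
      apply is_lim_seq_plus'; auto. }
  destruct (G 0) as [l1 [L1 B1]]. destruct (G (- (PI / 2))) as [l2 [L2 B2]].
  destruct (lim_of_bound (zu sigma tau) (zeta sigma (- tau))
    (fun N => 2 * em_const sigma tau * Rpower (INR N) (- sigma))) as [M1 M2].
  { intros n Hn1. rewrite Cmod_minus_sym. apply zeta_zu; auto. }
  { apply lim_scal_Rpower_neg; auto. }
  assert (E1 : fst (zeta sigma (- tau)) = l1).
  { apply is_lim_seq_unique in M1.
    rewrite (Lim_seq_ext _ (u 0)) in M1.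
    - apply is_lim_seq_unique in L1. rewrite L1 in M1. injection M1; auto.
    - intros n. unfold zu. rewrite E. reflexivity. }
  assert (E2 : snd (zeta sigma (- tau)) = l2).
  { apply is_lim_seq_unique in M2.
    rewrite (Lim_seq_ext _ (u (- (PI / 2)))) in M2.
    - apply is_lim_seq_unique in L2. rewrite L2 in M2. injection M2; auto.
    - intros n. unfold zu. rewrite E. reflexivity. }
  rewrite (surjective_pairing (zeta sigma (- tau))), E1, E2.
  replace (Cminus (l1, l2) (zu sigma tau N)) with
    (Cplus (Copp (Cmult (RtoC (/ 2)) (nterm sigma tau N)))
      (Cminus (l1, l2) (Cminus (zu sigma tau N) (Cmult (RtoC (/ 2)) (nterm sigma tau N))))) by ring.
  eapply Rle_trans; [apply Cmod_triangle|].
  rewrite Cmod_opp, Cmod_Rmult, Cmod_nterm by lra. apply Rplus_le_compat_l.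
  eapply Rle_trans; [apply Cmod_le_sum|].
  unfold zu. rewrite E, nterm_pc. unfold polef, Cminus, Cplus, Copp, Cmult, RtoC; cbn [fst snd].
  unfold u, Rminus in B1, B2.
  match goal with |- Rabs ?a + Rabs ?b <= _ =>
    match type of B1 with Rabs ?c <= _ => replace a with c by ring end;
    match type of B2 with Rabs ?c <= _ => replace b with c by ring end end.
  lra.
Qed.

(** * Averaged partial sums on the critical line *)

Lemma zterm_nterm tau n : (1 <= n)%nat -> zterm tau n = nterm (1 / 2) tau n.
Proof.
  intros. unfold zterm, nterm. rewrite Rpower_half; auto. apply lt_0_INR; lia.
Qed.

(* The partial sums of [zeta (1/2 - i tau)], averaged over the cut-offs [M + k], [1 <= k <= M]. *)
Definition Zavg (M : nat) (tau : R) : C :=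
  Cmult (RtoC (/ INR M)) (csum (fun k => csum (zterm tau) (M + k)) M).

Lemma Rpower_m32 x : 0 < x -> Rpower x (- (1 / 2 + 1)) = / (x * sqrt x).
Proof.
  intros. rewrite Rpower_Ropp, Rpower_plus, Rpower_1 by auto.
  replace (1 / 2) with (/ 2) by field. rewrite Rpower_sqrt by auto. f_equal; ring.
Qed.

Lemma Rpower_p12 x : 0 < x -> Rpower x (1 - 1 / 2) = sqrt x.
Proof. intros. replace (1 - 1 / 2) with (/ 2) by field. apply Rpower_sqrt; auto. Qed.

Lemma Cmod_inv_half tau : 0 < tau -> Cmod (Cinv (1 - 1 / 2, tau)) <= / tau.
Proof.
  intros Ht. assert (Hm : tau <= Cmod (1 - 1 / 2, tau)).
  { eapply Rle_trans; [|apply (snd_le_Cmod (1 - 1 / 2, tau))]. simpl. apply Rle_abs. }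
  rewrite Cmod_inv.
  - apply Rinv_le_contravar; auto.
  - intros E. rewrite E, Cmod_0 in Hm. lra.
Qed.

(* Averaging the cut-off damps the pole term [N^{1-s} / (1-s)] by a factor [tau]. *)
Lemma Zavg_zeta (M : nat) tau D : 1 <= tau -> tau ^ 2 <= INR M -> INR M <= D ^ 2 * tau ^ 2 ->
  0 <= D -> Cmod (Cminus (zeta (1 / 2) (- tau)) (Zavg M tau)) <= (100 + 500 * D) / tau.
Proof.
  intros Ht HM1 HM2 HD.
  assert (M0 : 0 < INR M) by nra.
  assert (MN : (1 <= M)%nat). { apply INR_lt. simpl. auto. }
  assert (ssM : sqrt (INR M) * sqrt (INR M) = INR M) by (apply sqrt_sqrt; lra).
  assert (H1 : tau <= sqrt (INR M)).
  { rewrite <- (sqrt_pow2 tau) by lra. apply sqrt_le_1; nra. }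
  assert (H2 : sqrt (INR M) <= D * tau).
  { rewrite <- (sqrt_pow2 (D * tau)) by nra. apply sqrt_le_1; nra. }
  assert (Hn : (1 - 1 / 2) ^ 2 + tau ^ 2 <> 0) by nra.
  assert (Hi : 0 < / INR M) by (apply Rinv_0_lt_compat; auto).
  assert (E : Cminus (zeta (1 / 2) (- tau)) (Zavg M tau) =
    Cmult (RtoC (/ INR M)) (Cminus
      (csum (fun k => Cminus (zeta (1 / 2) (- tau)) (zu (1 / 2) tau (M + k))) M)
      (Cmult (Cinv (1 - 1 / 2, tau))
        (csum (fun k => Cmult (cis (tau * ln (INR (M + k)))) (RtoC (sqrt (INR (M + k))))) M)))).
  { rewrite <- csum_scal, <- csum_minus.
    rewrite (csum_ext _ (fun k => Cminus (zeta (1 / 2) (- tau)) (csum (zterm tau) (M + k)))).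
    - rewrite csum_minus, csum_const. unfold Zavg.
      rewrite <- (Cmult_1_l (zeta (1 / 2) (- tau))) at 1.
      replace (RtoC 1) with (Cmult (RtoC (/ INR M)) (RtoC (INR M))).
      + ring.
      + rewrite <- RtoC_mult, Rinv_l by lra. auto.
    - intros k Hk. unfold zu. rewrite polef_alt by auto.
      rewrite Rpower_p12 by (apply lt_0_INR; lia).
      rewrite (csum_ext (zterm tau) (nterm (1 / 2) tau)) by (intros; apply zterm_nterm; lia).
      ring. }
  rewrite E, Cmod_Rmult by lra.
  assert (T1 : Cmod (csum (fun k => Cminus (zeta (1 / 2) (- tau)) (zu (1 / 2) tau (M + k))) M)
     <= INR M * (100 / tau)).
  { rewrite <- rsum_const. apply csum_bound. intros k Hk.
    eapply Rle_trans; [apply zeta_zu2; try lra; lia|].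
    assert (MK : INR M <= INR (M + k)) by (apply le_INR; lia).
    rewrite Rpower_half, Rpower_m32 by lra.
    assert (sMK : sqrt (INR M) <= sqrt (INR (M + k))) by (apply sqrt_le_1; lra).
    assert (I1 : / sqrt (INR (M + k)) <= / tau) by (apply Rinv_le_contravar; lra).
    assert (I2 : / (INR (M + k) * sqrt (INR (M + k))) <= / (tau ^ 2 * tau)).
    { apply Rinv_le_contravar; [nra|]. apply Rmult_le_compat; try lra; nra. }
    assert (EC : em2_const (1 / 2) tau <= 20 * tau ^ 2).
    { unfold em2_const. rewrite Rabs_pos_eq by lra.
      replace (1 / 2 + 1 + 1) with (2 + / 2) by field.
      rewrite Rpower_plus, Rpower_sqrt by lra.
      replace (Rpower 2 2) with 4.
      2:{ replace 2 with (INR 2) at 2 by auto. rewrite Rpower_pow by lra. ring. }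
      assert (sqrt 2 <= 3 / 2).
      { rewrite <- (sqrt_pow2 (3 / 2)) by lra. apply sqrt_le_1; lra. }
      replace (4 * sqrt 2 / (1 / 2 + 1)) with (8 / 3 * sqrt 2) by field.
       nra. }
    assert (T : 2 * em2_const (1 / 2) tau * / (INR (M + k) * sqrt (INR (M + k))) <=
       40 * tau ^ 2 * / (tau ^ 2 * tau)).
    { apply Rmult_le_compat; try nra.
      - unfold em2_const. rewrite Rabs_pos_eq by lra.
        assert (0 < Rpower 2 (1 / 2 + 1 + 1) / (1 / 2 + 1))
          by (apply Rdiv_lt_0_compat; [apply Rpower_pos|lra]).
        apply Rmult_le_pos; [lra|]. repeat apply Rmult_le_pos; lra.
      - apply Rlt_le, Rinv_0_lt_compat. apply Rmult_lt_0_compat; lra. }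
    replace (40 * tau ^ 2 * / (tau ^ 2 * tau)) with (40 * / tau) in T by (field; lra).
    unfold Rdiv. assert (0 < / tau) by (apply Rinv_0_lt_compat; lra). lra. }
  (* Partial summation: the exponential sums are at most [118 M / tau], and the weights
     [sqrt (M + k)] have variation plus last value at most [4 sqrt M <= 4 D tau]. Dividing by [M]
     and by [|1 - s| >= tau] then leaves [O(D / tau)]. *)
  assert (T2 : Cmod (csum (fun k => Cmult (cis (tau * ln (INR (M + k)))) (RtoC (sqrt (INR (M + k))))) M)
     <= INR M * (500 * D)).
  { destruct M as [|m]; [lia|]. set (M := S m) in *.
    eapply Rle_trans; [apply (abel_bound (fun k => cis (tau * ln (INR (M + k))))
       (fun k => RtoC (sqrt (INR (M + k)))) m (118 * (INR M / tau)))|].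
    - intros j Hj.
      assert (HtM : tau <= INR M ^ 2).
      { assert (tau <= INR M) by nra. nra. }
      eapply Rle_trans; [apply (block_bound tau M); auto; try lia; lra|].
      assert (sqrt tau <= INR M / tau).
      { apply Rle_div_r; [lra|]. apply Rle_trans with (tau * tau); [|nra].
        apply Rmult_le_compat_r; [lra|]. rewrite <- (sqrt_pow2 tau) at 2 by lra.
        apply sqrt_le_1; nra. }
      unfold Rdiv in *. lra.
    - rewrite (rsum_ext _ (fun k => - sqrt (INR (M + k)) - - sqrt (INR (M + S k)))).
      + rewrite (rsum_tele (fun k => - sqrt (INR (M + k)))).
        rewrite Cmod_R, Rabs_pos_eq by apply sqrt_pos. fold M.
        assert (S1 : sqrt (INR (M + M)) <= 2 * sqrt (INR M)).
        { apply Rsqr_incr_0_var; [|lra]. unfold Rsqr. rewrite sqrt_sqrt by apply pos_INR.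
          rewrite plus_INR. nra. }
        assert (0 <= sqrt (INR (M + 1))) by apply sqrt_pos.
        apply Rle_trans with (118 * (INR M / tau) * (4 * (D * tau))).
        * apply Rmult_le_compat_l; [|lra]. apply Rmult_le_pos; [lra|]. apply Rdiv_le_0_compat; lra.
        * replace (118 * (INR M / tau) * (4 * (D * tau))) with (INR M * (472 * D)) by (field; lra).
          apply Rmult_le_compat_l; nra.
      + intros k Hk. rewrite <- RtoC_minus, Cmod_R, Rabs_left1; [ring|].
        apply Rle_minus. apply sqrt_le_1; try apply pos_INR. apply le_INR; lia. }
  assert (T3 := Cmod_inv_half tau ltac:(lra)).
  assert (T4 : Cmod (Cminus
      (csum (fun k => Cminus (zeta (1 / 2) (- tau)) (zu (1 / 2) tau (M + k))) M)
      (Cmult (Cinv (1 - 1 / 2, tau))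
        (csum (fun k => Cmult (cis (tau * ln (INR (M + k)))) (RtoC (sqrt (INR (M + k))))) M)))
     <= INR M * (100 / tau) + / tau * (INR M * (500 * D))).
  { unfold Cminus at 1. eapply Rle_trans; [apply Cmod_triangle|]. rewrite Cmod_opp, Cmod_mult.
    apply Rplus_le_compat; auto. apply Rmult_le_compat; auto using Cmod_ge_0. }
  eapply Rle_trans; [apply Rmult_le_compat_l; [lra|exact T4]|].
  apply Req_le. field. lra.
Qed.

Lemma fst_csum f N : fst (csum f N) = rsum (fun k => fst (f k)) N.
Proof. induction N as [|N IH]; simpl; auto. rewrite IH; auto. Qed.

Lemma zetaR_nat a N : 0 < a -> a <> 1 -> (1 <= N)%nat ->
  Rabs (rsum (fun n => Rpower (INR n) (- a)) N - Rpower (INR N) (1 - a) / (1 - a) - zetaR a)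
  <= 2 * Rpower 2 (a + 1) * Rpower (INR N) (- a).
Proof.
  intros Ha H1 HN. assert (H := zeta_zu a 0 N Ha H1 HN). rewrite Ropp_0 in H.
  unfold em_const in H. rewrite Rabs_R0, Rplus_0_r in H.
  replace (a * (Rpower 2 (a + 1) / a)) with (Rpower 2 (a + 1)) in H by (field; lra).
  eapply Rle_trans; [|exact H]. eapply Rle_trans; [|apply fst_le_Cmod].
  rewrite Rabs_minus_sym. apply Req_le. f_equal.
  unfold zu, zetaR, Cminus, Cplus, Copp; cbn [fst]. rewrite fst_csum.
  unfold polef, pF, pc; cbn [fst].
  rewrite (rsum_ext (fun k => fst (nterm a 0 k)) (fun n => Rpower (INR n) (- a))).
  2:{ intros. unfold nterm, cis, Cmult, RtoC; simpl. rewrite Rmult_0_l, cos_0. ring. }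
  rewrite Rmult_0_l, Rplus_0_l, cos_0. replace (- a + 1) with (1 - a) by ring.
  field. simpl. nra.
Qed.

Lemma nat_floor_ge1 x : 1 <= x -> (1 <= nat_floor x)%nat.
Proof. intros. apply nat_floor_le; simpl; lra. Qed.

Lemma floor_bounds x : 1 <= x ->
  1 <= INR (nat_floor x) <= x /\ x < INR (nat_floor x) + 1 /\ x / 2 <= INR (nat_floor x).
Proof.
  intros Hx. destruct (nat_floor_spec x) as [H1 H2]; [lra|].
  assert (H := INR_ge1 _ (nat_floor_ge1 x Hx)). repeat split; lra.
Qed.

Lemma Rpower_half_base x y a : 0 < x -> x / 2 <= y -> 0 <= a ->
  Rpower y (- a) <= Rpower 2 a * Rpower x (- a).
Proof.
  intros Hx Hy Ha. apply Rle_trans with (Rpower (x / 2) (- a)).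
  - apply Rpower_le_base_neg; lra.
  - apply Req_le. replace (Rpower x (- a)) with (Rpower (2 * (x / 2)) (- a)) by (f_equal; field).
    rewrite <- Rpower_mult_distr by lra. rewrite <- Rmult_assoc, <- Rpower_plus.
    replace (a + - a) with 0 by ring. rewrite Rpower_O; lra.
Qed.

(** * Real zeta sums *)

Definition psum (a x : R) : R := rsum (fun n => Rpower (INR n) (- a)) (nat_floor x).

(* Moves an asymptotic formula from integers to reals: [f] is a primitive of the summand. *)
Lemma to_real_cutoff (s : nat -> R) (F f : R -> R) l K K' e : 0 <= e -> 0 <= K ->
  (forall N, (1 <= N)%nat -> Rabs (s N - F (INR N) - l) <= K * Rpower (INR N) (- e)) ->
  (forall t, 1 <= t -> is_derive F t (f t)) ->
  (forall t, 1 <= t -> Rabs (f t) <= K' * Rpower t (- e)) -> 0 <= K' ->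
  forall x, 1 <= x -> Rabs (s (nat_floor x) - F x - l) <= (K + K') * Rpower 2 e * Rpower x (- e).
Proof.
  intros He HK Hs HF Hf HK' x Hx.
  destruct (floor_bounds x Hx) as [[F1 F2] [F3 F4]]. set (N := nat_floor x) in *.
  assert (HN : (1 <= N)%nat) by (apply nat_floor_ge1; auto).
  assert (P : Rpower (INR N) (- e) <= Rpower 2 e * Rpower x (- e)) by (apply Rpower_half_base; lra).
  replace (s N - F x - l) with ((s N - F (INR N) - l) - (F x - F (INR N))) by ring.
  unfold Rminus at 1. eapply Rle_trans; [apply Rabs_triang|]. rewrite Rabs_Ropp.
  assert (A1 := Hs N HN).
  assert (A2 : Rabs (F x - F (INR N)) <= K' * Rpower (INR N) (- e)).
  { destruct (Req_dec x (INR N)) as [Hn|Hn].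
    - rewrite <- Hn, Rminus_diag, Rabs_R0. apply Rmult_le_pos; auto. apply Rlt_le, Rpower_pos.
    - destruct (mvt_le F f (INR N) x) as [c [Hc E]]; [lra|intros; apply HF; lra|].
      rewrite E, Rabs_mult, (Rabs_pos_eq (x - INR N)) by lra.
      assert (A := Hf c ltac:(lra)).
      assert (Rpower c (- e) <= Rpower (INR N) (- e)) by (apply Rpower_le_base_neg; lra).
      generalize (Rabs_pos (f c)); nra. }

  nra.
Qed.

Lemma psum_asymp a : 0 < a -> a <> 1 -> exists K, 0 < K /\ forall x, 1 <= x ->
  Rabs (psum a x - Rpower x (1 - a) / (1 - a) - zetaR a) <= K * Rpower x (- a).
Proof.
  intros Ha H1. exists ((2 * Rpower 2 (a + 1) + 1) * Rpower 2 a).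
  assert (P := Rpower_pos 2 (a + 1)). assert (P2 := Rpower_pos 2 a). split.
  { apply Rmult_lt_0_compat; lra. }
  apply (to_real_cutoff (rsum (fun n => Rpower (INR n) (- a)))
    (fun x => Rpower x (1 - a) / (1 - a)) (fun x => Rpower x (- a))); try lra.
  - intros N HN. apply zetaR_nat; auto.
  - intros t Ht. apply (is_derive_ext (fun x => / (1 - a) * Rpower x (1 - a))).
    { intros t0; unfold Rdiv; apply Rmult_comm. }
    evar_last; [apply is_derive_scal, Rpower_derive; lra|].
    replace (1 - a - 1) with (- a) by ring. field; lra.
  - intros t Ht. rewrite Rabs_pos_eq by (apply Rlt_le, Rpower_pos). lra.
Qed.

Definition hsum (x : R) : R := rsum (fun n => / INR n) (nat_floor x).

Lemma inv_seq_lim K : is_lim_seq (fun n => K * / INR n) 0.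
Proof.
  replace (Finite 0) with (Rbar_mult K 0) by (simpl; f_equal; ring).
  apply is_lim_seq_scal_l. apply (is_lim_seq_inv INR p_infty); [apply is_lim_seq_INR|discriminate].
Qed.

Lemma hsum_asymp : exists K, 0 < K /\ forall x, 1 <= x ->
  Rabs (hsum x - ln x - euler_gamma) <= K * / x.
Proof.
  assert (Hn : forall N, (1 <= N)%nat ->
     Rabs (rsum (fun n => / INR n) N - ln (INR N) - euler_gamma) <= 2 * / INR N).
  { destruct (tele_lim (fun N => rsum (fun n => / INR n) N - ln (INR N)) (fun N => 2 * / INR N))
      as [l [L1 L2]].
    - intros n Hn. cbn [rsum]. rewrite S_INR. assert (N1 := INR_ge1 n Hn).
      replace (rsum (fun n0 => / INR n0) n + / (INR n + 1) - ln (INR n + 1)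
        - (rsum (fun n0 => / INR n0) n - ln (INR n)))
        with (- ((ln (INR n + 1) - ln (INR n)) - / (INR n + 1))) by ring.
      assert (B := ln_step_bounds (INR n) N1).
      rewrite Rabs_Ropp, Rabs_pos_eq by lra.
       lra.
    - apply inv_seq_lim.
    - assert (El : euler_gamma = l).
      (* [sum_n] starts at 0 and has [n + 1] terms, so the sequence in [euler_gamma] is the shifted
         one. *)
      { unfold euler_gamma. rewrite (Lim_seq_ext _ (fun n => rsum (fun n => / INR n) (S n) - ln (INR (S n)))).
        - apply is_lim_seq_incr_1 in L1. rewrite (is_lim_seq_unique _ _ L1). auto.
        - intros n. f_equal. induction n as [|n IH].
          + rewrite sum_O. simpl. ring.
          + rewrite sum_Sn, IH. reflexivity. }
      intros N HN. rewrite El, Rabs_minus_sym. apply L2; auto. }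
  exists (3 * 2). split; [lra|]. intros x Hx.
  assert (G := to_real_cutoff (rsum (fun n => / INR n)) ln (fun x => / x) euler_gamma 2 1 1).
  assert (R1 : forall y, 1 <= y -> Rpower y (- (1)) = / y).
  { intros. rewrite Rpower_Ropp, Rpower_1; auto; lra. }
  unfold hsum. rewrite <- R1 by auto.
  replace (3 * 2 * Rpower x (- (1))) with ((2 + 1) * Rpower 2 1 * Rpower x (- (1)))
    by (rewrite Rpower_1 by lra; ring).
  apply G; auto; try lra.
  - intros N HN. rewrite R1 by (apply INR_ge1; auto). auto.
  - intros t Ht. apply is_derive_ln; lra.
  - intros t Ht. rewrite R1 by auto.
    assert (0 < / t) by (apply Rinv_0_lt_compat; lra). rewrite Rabs_pos_eq; lra.
Qed.

(** This is [exp y >= 1 + y] at [y = (a/2) ln t]. *)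
Lemma ln_absorb a t : 0 < a -> 0 < t -> 1 + a * ln t <= 2 * Rpower t (a / 2).
Proof.
  intros Ha Ht. assert (H := exp_ineq1_le (a / 2 * ln t)). unfold Rpower.
   lra.
Qed.

(* The primitive of [x^{-a} ln x]. *)
Definition lF (a x : R) : R :=
  Rpower x (1 - a) * ln x / (1 - a) - Rpower x (1 - a) / (1 - a) ^ 2.

Lemma lF_derive a x : a <> 1 -> 0 < x -> is_derive (lF a) x (Rpower x (- a) * ln x).
Proof.
  intros Ha Hx. unfold lF.
  assert (E : Rpower x (- a) = Rpower x (1 - a) / x).
  { replace (- a) with ((1 - a) + - (1)) by ring. rewrite Rpower_plus, Rpower_Ropp, Rpower_1; auto. }
  rewrite E. unfold Rpower. auto_derive; [lra|]. field. split; lra.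
Qed.

Lemma lf_derive a x : 0 < x ->
  is_derive (fun x => Rpower x (- a) * ln x) x (Rpower x (- a - 1) * (1 - a * ln x)).
Proof.
  intros Hx.
  assert (E : Rpower x (- a - 1) = Rpower x (- a) / x).
  { unfold Rminus. rewrite Rpower_plus, Rpower_Ropp, (Rpower_Ropp _ 1), Rpower_1; auto. }
  rewrite E. unfold Rpower. auto_derive; [lra|]. field. lra.
Qed.

Lemma lf_bound a x : 0 < a -> 1 <= x -> Rabs (Rpower x (- a) * ln x) <= 2 / a * Rpower x (- (a / 2)).
Proof.
  intros Ha Hx. assert (L := ln_nonneg x Hx). assert (P := Rpower_pos x (- a)).
  rewrite Rabs_pos_eq by (apply Rmult_le_pos; lra).
  assert (H := ln_absorb a x Ha ltac:(lra)).
  replace (Rpower x (- (a / 2))) with (Rpower x (- a) * Rpower x (a / 2))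
    by (rewrite <- Rpower_plus; f_equal; field).
  apply Rmult_le_reg_r with a; auto.
  replace (2 / a * (Rpower x (- a) * Rpower x (a / 2)) * a) with (2 * (Rpower x (- a) * Rpower x (a / 2)))
    by (field; lra). nra.
Qed.

Definition lu (a : R) (N : nat) : R :=
  rsum (fun n => Rpower (INR n) (- a) * ln (INR n)) N - lF a (INR N).

(** The derivative of [x^{-a} ln x] carries a logarithm; absorbing it by [ln_absorb] costs half of
    the exponent, hence the rate [N^{-a/2}]. *)
Lemma lu_lim a : 0 < a -> a <> 1 -> exists l : R, is_lim_seq (lu a) l /\
  forall N, (1 <= N)%nat ->
  Rabs (l - lu a N) <= 2 * (Rpower 2 (a / 2 + 1) / (a / 2)) * Rpower (INR N) (- (a / 2)).
Proof.
  intros Ha H1.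
  destruct (tele_lim (lu a)
    (fun N => 2 * (Rpower 2 (a / 2 + 1) / (a / 2)) * Rpower (INR N) (- (a / 2)))) as [l Hl].
  - intros n Hn. assert (N1 := INR_ge1 n Hn). unfold lu. cbn [rsum]. rewrite S_INR.
    match goal with |- Rabs ?e <= _ => replace e with
      (Rpower (INR n + 1) (- a) * ln (INR n + 1) - (lF a (INR n + 1) - lF a (INR n))) by ring end.
    apply Rle_trans with (2 * Rpower (INR n) (- (a / 2) - 1)).
    + apply (euler_maclaurin1 (lF a) (fun x => Rpower x (- a) * ln x)
        (fun x => Rpower x (- a - 1) * (1 - a * ln x))).
      * intros; apply lF_derive; auto; lra.
      * intros; apply lf_derive; lra.
      * intros t Ht. rewrite Rabs_mult, (Rabs_pos_eq (Rpower _ _)) by (apply Rlt_le, Rpower_pos).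
        assert (L := ln_nonneg t ltac:(lra)). assert (A := ln_absorb a t Ha ltac:(lra)).
        assert (B : Rabs (1 - a * ln t) <= 2 * Rpower t (a / 2)).
        { assert (0 <= a * ln t) by (apply Rmult_le_pos; lra). apply Rabs_le. lra. }
        apply Rle_trans with (2 * Rpower t (- (a / 2) - 1)).
        -- replace (Rpower t (- (a / 2) - 1)) with (Rpower t (- a - 1) * Rpower t (a / 2)).
           ++ assert (P := Rpower_pos t (- a - 1)). nra.
           ++ rewrite <- Rpower_plus. f_equal. field.
        -- apply Rmult_le_compat_l; [lra|]. apply Rpower_le_base_neg; lra.
    + rewrite <- Rmult_minus_distr_l, Rmult_assoc. apply Rmult_le_compat_l; [lra|].
      apply Rpower_tele; lra.
  - apply lim_scal_Rpower_neg; lra.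
  - exists l; auto.
Qed.

(** Termwise differentiation in the exponent. The approximations [fn N] of [zetaR] have derivatives
    [- lu], and both sequences converge uniformly near [a], because the error bounds of [zetaR_nat]
    and [lu_lim] are uniform in the exponent there. *)
Lemma zetaR_deriv_lim a (l : R) : 0 < a -> a <> 1 -> is_lim_seq (lu a) l -> zetaR' a = - l.
Proof.
  intros Ha H1 Hl.
  (* The interval stays on the side of the pole 1 on which [a] lies, and its positive lower end
     gives a common rate. *)
  assert (HD : exists lo hi, 0 < lo < a /\ a < hi /\ forall y, lo < y < hi -> y <> 1).
  { destruct (Rtotal_order a 1) as [H|[H|H]]; [|lra|].
    - exists (a / 2), 1. split; [lra|split; [lra|intros; lra]].
    - exists 1, (a + 1). split; [lra|split; [lra|intros; lra]]. }
  destruct HD as [lo [hi [Hlo [Hhi H11]]]].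
  set (D := fun y => lo < y < hi).
  set (fn := fun (N : nat) y => rsum (fun n => Rpower (INR n) (- y)) (S N)
     - Rpower (INR (S N)) (1 - y) / (1 - y)).
  assert (Hfn : forall y, D y -> is_lim_seq (fun N => fn N y) (zetaR y)).
  { intros y Hy. unfold D in Hy.
    apply (is_lim_seq_incr_1 (fun N => rsum (fun n => Rpower (INR n) (- y)) N
     - Rpower (INR N) (1 - y) / (1 - y))).
    apply is_lim_seq_spec. intros eps.
    assert (L := lim_scal_Rpower_neg (2 * Rpower 2 (y + 1)) y ltac:(lra)).
    apply is_lim_seq_spec in L. destruct (L eps) as [N HN]. exists (S N). intros n Hn.
    eapply Rle_lt_trans; [apply zetaR_nat; try lra; auto; lia|].
    specialize (HN n ltac:(lia)). rewrite Rminus_0_r in HN.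
    eapply Rle_lt_trans; [apply Rle_abs|exact HN]. }
  assert (Hder : forall N y, D y -> is_derive (fn N) y (- lu y (S N))).
  { intros N y Hy. assert (y <> 1) by (apply H11; auto). unfold fn, lu.
    assert (G : forall M, is_derive (fun y => rsum (fun n => Rpower (INR n) (- y)) M) y
       (- rsum (fun n => Rpower (INR n) (- y) * ln (INR n)) M)).
    { induction M as [|M IH].
      - simpl. rewrite Ropp_0. apply (is_derive_const (V := R_NormedModule)).
      - cbn [rsum]. rewrite Ropp_plus_distr.
        apply (is_derive_plus (V := R_NormedModule)); auto.
        generalize (INR (S M)). intros x. unfold Rpower. auto_derive; auto. ring. }
    set (m := S N) in *. clearbody m.
    replace (- (rsum (fun n => Rpower (INR n) (- y) * ln (INR n)) m - lF y (INR m))) with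
      (- rsum (fun n => Rpower (INR n) (- y) * ln (INR n)) m - - lF y (INR m)) by ring.
    apply (is_derive_minus (V := R_NormedModule)); auto.
    unfold lF, Rpower. auto_derive; [lra|]. change (1 + - y) with (1 - y). field. lra. }
  assert (HE : forall N y, D y -> Derive (fn N) y = - lu y (S N)).
  { intros; apply is_derive_unique; auto. }
  set (K := 2 * (Rpower 2 (hi / 2 + 1) / (lo / 2))).
  assert (HK : forall y N, D y -> (1 <= N)%nat -> exists l : R, is_lim_seq (lu y) l /\
    Rabs (l - lu y N) <= K * Rpower (INR N) (- (lo / 2))).
  { intros y N Hy HN. unfold D in Hy.
    destruct (lu_lim y ltac:(lra) ltac:(auto)) as [l' [L1 L2]]. exists l'. split; auto.
    eapply Rle_trans; [apply L2; auto|]. assert (N1 := INR_ge1 N HN).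
    apply Rmult_le_compat.
    - apply Rmult_le_pos; [lra|]. apply Rdiv_le_0_compat; [apply Rlt_le, Rpower_pos|lra].
    - apply Rlt_le, Rpower_pos.
    - unfold K. apply Rmult_le_compat_l; [lra|]. unfold Rdiv at 1 4.
      apply Rmult_le_compat.
      + apply Rlt_le, Rpower_pos.
      + apply Rlt_le, Rinv_0_lt_compat; lra.
      + apply Rle_Rpower; lra.
      + apply Rinv_le_contravar; lra.
    - apply Rle_Rpower; lra. }
  assert (Hlim : forall y, D y -> Lim_seq (fun N => fn N y) = zetaR y).
  { intros; apply is_lim_seq_unique; auto. }
  assert (HDer : is_derive (fun y => real (Lim_seq (fun n => fn n y))) a
     (real (Lim_seq (fun n => Derive (fn n) a)))).
  { apply (CVU_Derive fn D).
    - apply open_and; [apply open_gt|apply open_lt].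
    - intros x y z Hx Hz Hxyz. unfold D in *; lra.
    - intros eps.
      assert (L := lim_scal_Rpower_neg (2 * Rpower 2 (hi + 1)) lo ltac:(lra)).
      apply is_lim_seq_spec in L. destruct (L eps) as [N HN]. exists N. intros n Hn y Hy.
      rewrite Hlim by auto. unfold D in Hy.
      unfold fn. eapply Rle_lt_trans; [apply zetaR_nat; try lra; auto; lia|].
      specialize (HN (S n) ltac:(lia)). rewrite Rminus_0_r in HN.
      eapply Rle_lt_trans; [|exact HN]. eapply Rle_trans; [|apply Rle_abs].
      assert (N1 := INR_ge1 (S n) ltac:(lia)).
      apply Rmult_le_compat; try (apply Rlt_le, Rpower_pos).
      + apply Rmult_le_pos; [lra|apply Rlt_le, Rpower_pos].
      + apply Rmult_le_compat_l; [lra|]. apply Rle_Rpower; lra.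
      + apply Rle_Rpower; lra.
    - intros n y Hy. eexists; apply Hder; auto.
    - intros n y Hy.
      assert (Hloc : locally y D).
      { apply (open_and _ _ (open_gt lo) (open_lt hi)). auto. }
      apply (continuity_pt_ext_loc (fun y => - lu y (S n))).
      + revert Hloc. apply filter_imp. intros; symmetry; apply HE; auto.
      + assert (y <> 1) by (apply H11; auto).
        assert (G : forall M, ex_derive (fun y => rsum (fun n => Rpower (INR n) (- y) * ln (INR n)) M) y).
        { induction M as [|M IH]; [exact (ex_derive_const (V := R_NormedModule) 0 y)|].
          cbn [rsum]. apply (ex_derive_plus (V := R_NormedModule)); auto.
          generalize (INR (S M)). intros x. unfold Rpower. auto_derive; auto. }
        apply derivable_continuous_pt, ex_derive_Reals_0.
        apply (ex_derive_opp (V := R_NormedModule)). unfold lu.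
        apply (ex_derive_minus (V := R_NormedModule)); auto.
        unfold lF, Rpower. auto_derive. assert (1 + - y <> 0) by lra. repeat split; auto; try lra.
    - intros eps.
      assert (L := lim_scal_Rpower_neg K (lo / 2) ltac:(lra)).
      apply is_lim_seq_spec in L. destruct (L eps) as [N HN]. exists N. intros n Hn y Hy.
      destruct (HK y (S n) Hy ltac:(lia)) as [l' [L1 L2]].
      rewrite (Lim_seq_ext _ (fun N => - lu y (S N))) by (intros; apply HE; auto).
      rewrite HE by auto.
      assert (L3 : is_lim_seq (fun N => - lu y (S N)) (- l')).
      { apply (is_lim_seq_opp (fun N => lu y (S N)) l'). apply (is_lim_seq_incr_1 (lu y)); auto. }
      rewrite (is_lim_seq_unique _ _ L3). cbn [real].
      replace (- lu y (S n) - - l') with (l' - lu y (S n)) by ring.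
      eapply Rle_lt_trans; [exact L2|].
      specialize (HN (S n) ltac:(lia)). rewrite Rminus_0_r in HN.
      eapply Rle_lt_trans; [apply Rle_abs|exact HN].
    - unfold D; lra. }
  unfold zetaR'. apply is_derive_unique.
  assert (E : real (Lim_seq (fun n => Derive (fn n) a)) = - l).
  { rewrite (Lim_seq_ext _ (fun N => - lu a (S N))) by (intros; apply HE; unfold D; lra).
    assert (L3 : is_lim_seq (fun N => - lu a (S N)) (- l)).
    { apply (is_lim_seq_opp (fun N => lu a (S N)) l). apply (is_lim_seq_incr_1 (lu a)); auto. }
    rewrite (is_lim_seq_unique _ _ L3). auto. }
  rewrite <- E. eapply is_derive_ext_loc; [|exact HDer].
  assert (Hloc : locally a D).
  { apply (open_and _ _ (open_gt lo) (open_lt hi)). unfold D; lra. }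
  revert Hloc. apply filter_imp. intros y Hy. rewrite Hlim; auto.
Qed.

Definition lsum (a x : R) : R := rsum (fun n => Rpower (INR n) (- a) * ln (INR n)) (nat_floor x).

Lemma lsum_asymp a : 0 < a -> a <> 1 -> exists K, 0 < K /\ forall x, 1 <= x ->
  Rabs (lsum a x - lF a x + zetaR' a) <= K * Rpower x (- (a / 2)).
Proof.
  intros Ha H1. destruct (lu_lim a Ha H1) as [l [L1 L2]].
  rewrite (zetaR_deriv_lim a l Ha H1 L1).
  set (K := 2 * (Rpower 2 (a / 2 + 1) / (a / 2))) in *.
  assert (HK : 0 < K).
  { unfold K. apply Rmult_lt_0_compat; [lra|]. apply Rdiv_lt_0_compat; [apply Rpower_pos|lra]. }
  assert (HK2 : 0 < 2 / a) by (apply Rdiv_lt_0_compat; lra).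
  assert (P2 := Rpower_pos 2 (a / 2)).
  exists ((K + 2 / a) * Rpower 2 (a / 2)). split; [apply Rmult_lt_0_compat; lra|].
  intros x Hx. unfold lsum.
  assert (G := to_real_cutoff (rsum (fun n => Rpower (INR n) (- a) * ln (INR n)))
    (lF a) (fun x => Rpower x (- a) * ln x) l K (2 / a) (a / 2)).
  replace (- - l) with l in * by ring. unfold Rminus at 1.
  replace (rsum (fun n => Rpower (INR n) (- a) * ln (INR n)) (nat_floor x) - lF a x + - l)
    with (rsum (fun n => Rpower (INR n) (- a) * ln (INR n)) (nat_floor x) - lF a x - l) by ring.
  apply G; try lra.
  - intros N HN. rewrite Rabs_minus_sym. apply L2; auto.
  - intros; apply lF_derive; lra.
  - intros; apply lf_bound; lra.
Qed.

(** * Off-diagonal terms *)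

(** Componentwise, to match the pair of real integrals in [M11]; a relation rather than a value, so
    that integrability travels with each computation. *)
Definition is_CInt (f : R -> C) (u v : R) (I : C) : Prop :=
  is_RInt (fun t => fst (f t)) u v (fst I) /\ is_RInt (fun t => snd (f t)) u v (snd I).

Lemma is_CInt_ext f g u v I : u <= v -> (forall t, u < t < v -> f t = g t) ->
  is_CInt f u v I -> is_CInt g u v I.
Proof.
  intros Huv H [H1 H2]. split.
  - apply (is_RInt_ext (fun t => fst (f t))); auto.
    rewrite Rmin_left, Rmax_right by lra. intros; rewrite H; auto.
  - apply (is_RInt_ext (fun t => snd (f t))); auto.
    rewrite Rmin_left, Rmax_right by lra. intros; rewrite H; auto.
Qed.

Lemma is_CInt_plus f g u v I J : is_CInt f u v I -> is_CInt g u v J ->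
  is_CInt (fun t => Cplus (f t) (g t)) u v (Cplus I J).
Proof.
  intros [H1 H2] [H3 H4]. split; apply (is_RInt_plus (V := R_NormedModule)); auto.
Qed.

Lemma is_CInt_scal a f u v I : is_CInt f u v I ->
  is_CInt (fun t => Cmult a (f t)) u v (Cmult a I).
Proof.
  intros [H1 H2]. split; simpl.
  - apply (is_RInt_minus (V := R_NormedModule)); apply (is_RInt_scal (V := R_NormedModule)); auto.
  - apply (is_RInt_plus (V := R_NormedModule)); apply (is_RInt_scal (V := R_NormedModule)); auto.
Qed.

Lemma is_CInt_minus f g u v I J : is_CInt f u v I -> is_CInt g u v J ->
  is_CInt (fun t => Cminus (f t) (g t)) u v (Cminus I J).
Proof.
  intros [H1 H2] [H3 H4]. split; apply (is_RInt_minus (V := R_NormedModule)); auto.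
Qed.

Lemma is_CInt_const a u v : is_CInt (fun _ => a) u v (Cmult (RtoC (v - u)) a).
Proof.
  split; simpl.
  - replace ((v - u) * fst a - 0 * snd a) with (scal (v - u) (fst a))
      by (unfold scal; simpl; unfold mult; simpl; ring).
    apply (is_RInt_const (V := R_NormedModule)).
  - replace ((v - u) * snd a + 0 * fst a) with (scal (v - u) (snd a))
      by (unfold scal; simpl; unfold mult; simpl; ring).
    apply (is_RInt_const (V := R_NormedModule)).
Qed.

Lemma is_CInt_zero u v : is_CInt (fun _ => RtoC 0) u v (RtoC 0).
Proof.
  assert (H := is_CInt_const (RtoC 0) u v). rewrite Cmult_0_r in H. exact H.
Qed.

Lemma is_CInt_csum (f : nat -> R -> C) u v (I : nat -> C) n :
  (forall k, (1 <= k <= n)%nat -> is_CInt (f k) u v (I k)) ->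
  is_CInt (fun t => csum (fun k => f k t) n) u v (csum I n).
Proof.
  induction n as [|n IH]; intros H.
  - apply is_CInt_zero.
  - cbn [csum]. apply is_CInt_plus; [apply IH; intros|]; apply H; lia.
Qed.

Lemma is_CInt_Chasles f u v w I J : is_CInt f u v I -> is_CInt f v w J ->
  is_CInt f u w (Cplus I J).
Proof.
  intros [H1 H2] [H3 H4].
  split; apply (is_RInt_Chasles (V := R_NormedModule)) with v; auto.
Qed.

(** Used for a pair [(m, n)], whose term is switched on once both have entered the Dirichlet
    polynomial. *)
Lemma is_CInt_step f u w v I : u <= w <= v -> is_CInt f w v I ->
  is_CInt (fun t => if Rle_dec w t then f t else RtoC 0) u v I.
Proof.
  intros Hw H. replace I with (Cplus (RtoC 0) I) by ring.
  apply is_CInt_Chasles with w.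
  - apply (is_CInt_ext (fun _ => RtoC 0)); [lra| |apply is_CInt_zero].
    intros t Ht. destruct (Rle_dec w t); auto; lra.
  - apply (is_CInt_ext f); [lra| |auto].
    intros t Ht. destruct (Rle_dec w t); auto; lra.
Qed.

Lemma is_RInt_Rabs_bound (f : R -> R) u v I B : u <= v -> is_RInt f u v I ->
  (forall t, u < t < v -> Rabs (f t) <= B) -> Rabs I <= B * (v - u).
Proof.
  intros Huv HI HB. apply Rabs_le. split.
  - apply (is_RInt_le (fun _ => - B) f u v); auto.
    + replace (- (B * (v - u))) with (scal (v - u) (- B))
        by (unfold scal; simpl; unfold mult; simpl; ring).
      apply (is_RInt_const (V := R_NormedModule)).
    + intros t Ht. specialize (HB t Ht). apply Rabs_le_between in HB. lra.
  - apply (is_RInt_le f (fun _ => B) u v); auto.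
    + replace (B * (v - u)) with (scal (v - u) B)
        by (unfold scal; simpl; unfold mult; simpl; ring).
      apply (is_RInt_const (V := R_NormedModule)).
    + intros t Ht. specialize (HB t Ht). apply Rabs_le_between in HB. lra.
Qed.

Lemma is_CInt_bound f u v I B : u <= v -> is_CInt f u v I ->
  (forall t, u < t < v -> Cmod (f t) <= B) -> Cmod I <= 2 * B * (v - u).
Proof.
  intros Huv [H1 H2] HB. eapply Rle_trans; [apply Cmod_le_sum|].
  assert (Rabs (fst I) <= B * (v - u)).
  { apply (is_RInt_Rabs_bound (fun t => fst (f t)) u v); auto. intros.
    eapply Rle_trans; [apply fst_le_Cmod|auto]. }
  assert (Rabs (snd I) <= B * (v - u)).
  { apply (is_RInt_Rabs_bound (fun t => snd (f t)) u v); auto. intros.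
    eapply Rle_trans; [apply snd_le_Cmod|auto]. }
  lra.
Qed.

Lemma is_CInt_unique f u v I J : is_CInt f u v I -> is_CInt f u v J -> I = J.
Proof.
  intros [H1 H2] [H3 H4].
  rewrite (surjective_pairing I), (surjective_pairing J). f_equal.
  - rewrite <- (is_RInt_unique _ _ _ _ H1). apply is_RInt_unique; auto.
  - rewrite <- (is_RInt_unique _ _ _ _ H2). apply is_RInt_unique; auto.
Qed.

Lemma is_CInt_cis w u v : w <> 0 ->
  is_CInt (fun t => cis (t * w)) u v
    (Cmult (RtoC (/ w)) (Cmult (Copp Ci) (Cminus (cis (v * w)) (cis (u * w))))).
Proof.
  intros Hw. split; simpl.
  - match goal with |- is_RInt _ _ _ ?I =>
      replace I with (minus (sin (v * w) / w) (sin (u * w) / w))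
        by (unfold minus, plus, opp; simpl; field; auto) end.
    apply (is_RInt_derive (V := R_CompleteNormedModule) (fun t => sin (t * w) / w) (fun t => cos (t * w))).
    + intros t Ht. auto_derive; auto. field; auto.
    + intros t Ht. apply (ex_derive_continuous (V := R_NormedModule)). auto_derive; auto.
  - match goal with |- is_RInt _ _ _ ?I =>
      replace I with (minus (- cos (v * w) / w) (- cos (u * w) / w))
        by (unfold minus, plus, opp; simpl; field; auto) end.
    apply (is_RInt_derive (V := R_CompleteNormedModule) (fun t => - cos (t * w) / w) (fun t => sin (t * w))).
    + intros t Ht. auto_derive; auto. field; auto.
    + intros t Ht. apply (ex_derive_continuous (V := R_NormedModule)). auto_derive; auto.
Qed.

Definition Ccont (f : R -> C) (t : R) : Prop :=
  continuous (fun x => fst (f x)) t /\ continuous (fun x => snd (f x)) t.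

Lemma Ccont_mult f g t : Ccont f t -> Ccont g t -> Ccont (fun x => Cmult (f x) (g x)) t.
Proof.
  intros [H1 H2] [H3 H4]. split; simpl.
  - apply (continuous_minus (V := R_NormedModule)); apply (continuous_mult (K := R_AbsRing)); auto.
  - apply (continuous_plus (V := R_NormedModule)); apply (continuous_mult (K := R_AbsRing)); auto.
Qed.

Lemma Ccont_plus f g t : Ccont f t -> Ccont g t -> Ccont (fun x => Cplus (f x) (g x)) t.
Proof.
  intros [H1 H2] [H3 H4]. split; simpl; apply (continuous_plus (V := R_NormedModule)); auto.
Qed.

Lemma Ccont_const a t : Ccont (fun _ => a) t.
Proof. split; apply continuous_const. Qed.

Lemma Ccont_cis w t : Ccont (fun x => cis (x * w)) t.
Proof.
  split; simpl; apply (ex_derive_continuous (V := R_NormedModule)); auto_derive; auto.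
Qed.

Lemma Ccont_csum (f : nat -> R -> C) n t : (forall k, (1 <= k <= n)%nat -> Ccont (f k) t) ->
  Ccont (fun x => csum (fun k => f k x) n) t.
Proof.
  induction n as [|n IH]; intros H; [apply Ccont_const|].
  cbn [csum]. apply Ccont_plus; [apply IH; intros|]; apply H; lia.
Qed.

Lemma Ccont_CInt f u v : u <= v -> (forall t, Ccont f t) ->
  is_CInt f u v (RInt (fun t => fst (f t)) u v, RInt (fun t => snd (f t)) u v).
Proof.
  intros Huv H.
  split; apply (RInt_correct (V := R_CompleteNormedModule));
    apply (ex_RInt_continuous (V := R_CompleteNormedModule)); intros; apply H.
Qed.

Lemma zu_half_cont N t : Ccont (fun tau => zu (1 / 2) tau N) t.
Proof.
  unfold zu. unfold Cminus. apply Ccont_plus.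
  - apply Ccont_csum. intros k Hk. unfold nterm. apply Ccont_mult; [apply Ccont_const|apply Ccont_cis].
  - assert (Hd : forall x, (- (1 / 2) + 1) * ((- (1 / 2) + 1) * 1) + x * (x * 1) <> 0).
    { intros x. assert (0 <= x * x) by apply Rle_0_sqr. lra. }
    split; simpl; apply (ex_derive_continuous (V := R_NormedModule)); unfold pF, pc;
      generalize (ln (INR N)) (Rpower (INR N) (- (1 / 2) + 1)); intros; auto_derive; apply Hd.
Qed.

(** A locally uniform limit of the continuous functions [zu (1/2) tau N], by a three-epsilon
    argument; this is what makes the integrals in [M11] exist. *)
Lemma zeta_half_cont t : Ccont (fun tau => zeta (1 / 2) (- tau)) t.
Proof.
  assert (G : forall p : C -> R, (forall a b, p (Cminus a b) = p a - p b) ->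
    (forall z, Rabs (p z) <= Cmod z) ->
    (forall N x, continuous (fun tau => p (zu (1 / 2) tau N)) x) ->
    continuous (fun tau => p (zeta (1 / 2) (- tau))) t).
  { intros p Hp Hb Hc. apply continuity_pt_filterlim. intros eps Heps.
    (* A constant for [zeta_zu] valid at all heights within 1 of [t]. *)
    set (K := 2 * ((1 / 2 + (Rabs t + 1)) * (Rpower 2 (1 / 2 + 1) / (1 / 2)))).
    assert (HK : 0 <= K).
    { unfold K. assert (P := Rpower_pos 2 (1 / 2 + 1)). generalize (Rabs_pos t); intros.
      apply Rmult_le_pos; [lra|]. apply Rmult_le_pos; [lra|].
      apply Rdiv_le_0_compat; lra. }
    assert (L := lim_scal_Rpower_neg K (1 / 2) ltac:(lra)).
    apply is_lim_seq_spec in L.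
    destruct (L (mkposreal (eps / 3) ltac:(lra))) as [N0 HN]. simpl in HN.
    set (N := S N0). specialize (HN N ltac:(unfold N; lia)). rewrite Rminus_0_r in HN.
    assert (HN2 : K * Rpower (INR N) (- (1 / 2)) < eps / 3).
    { eapply Rle_lt_trans; [apply Rle_abs|exact HN]. }
    assert (Hz : forall x, Rabs (x - t) < 1 ->
      Rabs (p (zeta (1 / 2) (- x)) - p (zu (1 / 2) x N)) < eps / 3).
    { intros x Hx. rewrite <- Hp. eapply Rle_lt_trans; [apply Hb|].
      eapply Rle_lt_trans; [apply zeta_zu; try lra; unfold N; lia|].
      eapply Rle_lt_trans; [|exact HN2]. apply Rmult_le_compat_r; [apply Rlt_le, Rpower_pos|].
      unfold em_const, K. apply Rmult_le_compat_l; [lra|]. apply Rmult_le_compat_r.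
      - apply Rdiv_le_0_compat; [apply Rlt_le, Rpower_pos|lra].
      - apply Rplus_le_compat_l. replace x with ((x - t) + t) by ring.
        eapply Rle_trans; [apply Rabs_triang|]. lra. }
    assert (Hc1 := Hc N t). apply continuity_pt_filterlim in Hc1.
    destruct (Hc1 (eps / 3)) as [d [Hd1 Hd2]]; [lra|].
    exists (Rmin d 1). split; [apply Rmin_pos; lra|].
    intros x [Hx1 Hx2]. simpl in *. unfold R_dist in *.
    assert (Hxd : Rabs (x - t) < d) by (eapply Rlt_le_trans; [apply Hx2|apply Rmin_l]).
    assert (Hx11 : Rabs (x - t) < 1) by (eapply Rlt_le_trans; [apply Hx2|apply Rmin_r]).
    assert (A1 := Hz x Hx11).
    assert (A2 := Hz t). rewrite Rminus_diag, Rabs_R0 in A2. specialize (A2 ltac:(lra)).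
    assert (A3 := Hd2 x (conj Hx1 Hxd)).
    apply Rabs_def2 in A1. apply Rabs_def2 in A2. apply Rabs_def2 in A3. apply Rabs_def1; lra. }
  split.
  - apply (G fst); [reflexivity|exact fst_le_Cmod|intros N x; exact (proj1 (zu_half_cont N x))].
  - apply (G snd); [reflexivity|exact snd_le_Cmod|intros N x; exact (proj2 (zu_half_cont N x))].
Qed.

(** * Sums of reciprocal logarithms near the diagonal *)

Lemma rsum_rev f n : rsum f n = rsum (fun k => f (S n - k)%nat) n.
Proof.
  induction n as [|n IH]; auto.
  replace (rsum (fun k => f (S (S n) - k)%nat) (S n)) with
    (rsum (fun k => f (S (S n) - k)%nat) (1 + n)) by auto.
  rewrite rsum_app. cbn [rsum]. rewrite IH. replace (S (S n) - 1)%nat with (S n) by lia.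
  change (fun k => f (S (S n) - (1 + k))%nat) with (fun k => f (S n - k)%nat). ring.
Qed.

Definition H_ (n : nat) : R := rsum (fun k => / INR k) n.

Lemma H_mono m n : (m <= n)%nat -> H_ m <= H_ n.
Proof.
  intros. apply rsum_mono; auto. intros. apply Rlt_le, Rinv_0_lt_compat, lt_0_INR; lia.
Qed.

(** Crude, but it keeps logarithms out: the near-diagonal total becomes of order [X^2], which
    [X <= sqrt T] absorbs. *)
Lemma H_sqrt n : H_ n <= 2 * sqrt (INR n).
Proof.
  eapply Rle_trans; [|apply sum_inv_sqrt]. apply rsum_le. intros k Hk.
  assert (K1 := INR_ge1 k ltac:(lia)). apply Rinv_le_contravar; [apply sqrt_INR_pos; lia|].
  rewrite <- (sqrt_sqrt (INR k)) at 2 by lra.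
  assert (1 <= sqrt (INR k)) by (rewrite <- sqrt_1; apply sqrt_le_1; lra). nra.
Qed.

Lemma sum_above q N :
  rsum (fun m => if Nat.ltb q m then / (INR m - INR q) else 0) N <= H_ N.
Proof.
  apply Rle_trans with (H_ (N - q)); [|apply H_mono; lia]. apply Req_le.
  induction N as [|N IH]; auto. cbn [rsum]. rewrite IH.
  destruct (Nat.ltb_spec q (S N)).
  - replace (S N - q)%nat with (S (N - q)) by lia. unfold H_. cbn [rsum]. do 2 f_equal.
    replace (S (N - q)) with (S N - q)%nat by lia. rewrite minus_INR by lia. auto.
  - replace (S N - q)%nat with (N - q)%nat by lia. ring.
Qed.

Lemma sum_below_aux q N : (N < q)%nat -> rsum (fun m => / (INR q - INR m)) N <= H_ N.
Proof.
  intros H. unfold H_. rewrite (rsum_rev (fun k => / INR k)). apply rsum_le. intros k Hk.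
  apply Rinv_le_contravar; [apply lt_0_INR; lia|]. rewrite <- minus_INR by lia.
  apply le_INR; lia.
Qed.

Lemma sum_below q N :
  rsum (fun m => if Nat.ltb m q then / (INR q - INR m) else 0) N <= H_ N.
Proof.
  destruct (le_lt_dec q N) as [Hq|Hq].
  - rewrite (rsum_trunc _ (q - 1) N).
    + destruct q as [|q].
      { simpl. unfold H_. apply (rsum_nonneg (fun k => / INR k)).
        intros. apply Rlt_le, Rinv_0_lt_compat, lt_0_INR; lia. }
      rewrite (rsum_ext _ (fun m => / (INR (S q) - INR m))).
      * eapply Rle_trans; [apply sum_below_aux; lia|]. apply H_mono; lia.
      * intros k Hk. destruct (Nat.ltb_spec k (S q)); auto; lia.
    + lia.
    + intros k Hk. destruct (Nat.ltb_spec k q); auto; lia.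
  - rewrite (rsum_ext _ (fun m => / (INR q - INR m))).
    + apply sum_below_aux; auto.
    + intros k Hk. destruct (Nat.ltb_spec k q); auto; lia.
Qed.

(* Diagonal terms ([q = m]) get the weight [0]. *)
Definition offw (q m : nat) (w : R) : R := if Nat.eqb q m then 0 else / w.

(** From [ln z >= 1 - 1/z] at [z = y/x]. *)
Lemma inv_ln_gap x y : 1 <= x -> x < y -> / (ln y - ln x) <= 1 + x * / (y - x).
Proof.
  intros Hx Hy. assert (B := ln_ge_1m (y / x) ltac:(apply Rdiv_lt_0_compat; lra)).
  rewrite ln_div in B by lra. replace (/ (y / x)) with (x / y) in B by (field; lra).
  replace (1 + x * / (y - x)) with (/ (1 - x / y)) by (field; lra).
  apply Rinv_le_contravar; auto.
  replace (1 - x / y) with ((y - x) / y) by (field; lra). apply Rdiv_lt_0_compat; lra.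
Qed.

(** On either side of the diagonal the numerator in [inv_ln_gap] is the smaller of [q] and [m],
    hence at most [m], and [m / sqrt m = sqrt m]. *)
Lemma inv_ln_ratio q m : (1 <= q)%nat -> (1 <= m)%nat ->
  / sqrt (INR m) * Rabs (offw q m (ln (INR q) - ln (INR m))) <=
  / sqrt (INR m) + sqrt (INR m) * ((if Nat.ltb q m then / (INR m - INR q) else 0) +
     (if Nat.ltb m q then / (INR q - INR m) else 0)).
Proof.
  intros Hq Hm. unfold offw.
  assert (Q1 := INR_ge1 q Hq). assert (M1 := INR_ge1 m Hm).
  assert (Sm := sqrt_INR_pos m Hm).
  assert (SS : sqrt (INR m) * sqrt (INR m) = INR m) by (apply sqrt_sqrt; lra).
  assert (Im : 0 < / sqrt (INR m)) by (apply Rinv_0_lt_compat; auto).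
  assert (Em : / sqrt (INR m) * INR m = sqrt (INR m)).
  { rewrite <- SS at 2. field; lra. }
  destruct (Nat.eqb_spec q m) as [->|Hn].
  - rewrite Rabs_R0, Rmult_0_r, !Nat.ltb_irrefl. lra.
  - destruct (Nat.ltb_spec q m) as [Hl|Hl].
    + destruct (Nat.ltb_spec m q); [lia|].
      apply lt_INR in Hl. assert (L := ln_increasing (INR q) (INR m) ltac:(lra) Hl).
      rewrite Rabs_inv, Rabs_left by lra. rewrite Rplus_0_r.
      replace (- (ln (INR q) - ln (INR m))) with (ln (INR m) - ln (INR q)) by ring.
      assert (G := inv_ln_gap (INR q) (INR m) Q1 Hl).
      assert (0 < / (INR m - INR q)) by (apply Rinv_0_lt_compat; lra).
      apply Rle_trans with (/ sqrt (INR m) * (1 + INR m * / (INR m - INR q))).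
      * apply Rmult_le_compat_l; [lra|]. nra.
      * rewrite Rmult_plus_distr_l, <- Rmult_assoc, Em. lra.
    + destruct (Nat.ltb_spec m q) as [Hl2|]; [|lia].
      apply lt_INR in Hl2. assert (L := ln_increasing (INR m) (INR q) ltac:(lra) Hl2).
      rewrite Rabs_inv, Rabs_pos_eq by lra. rewrite Rplus_0_l.
      assert (G := inv_ln_gap (INR m) (INR q) M1 Hl2).
      apply Rle_trans with (/ sqrt (INR m) * (1 + INR m * / (INR q - INR m))).
      * apply Rmult_le_compat_l; lra.
      * rewrite Rmult_plus_distr_l, <- Rmult_assoc, Em. lra.
Qed.

(** With [q] fixed the gaps [|m - q|] are distinct positive integers on each side, so harmonic sums
    bound the total uniformly in [q], however large [q] is. *)
Lemma near_sum_m q N : (1 <= q)%nat ->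
  rsum (fun m => / sqrt (INR m) * Rabs (offw q m (ln (INR q) - ln (INR m)))) N
  <= 2 * sqrt (INR N) + 4 * INR N.
Proof.
  intros Hq.
  apply Rle_trans with (rsum (fun m => / sqrt (INR m) + sqrt (INR N) *
     ((if Nat.ltb q m then / (INR m - INR q) else 0) +
     (if Nat.ltb m q then / (INR q - INR m) else 0))) N).
  - apply rsum_le. intros m Hm. eapply Rle_trans; [apply inv_ln_ratio; auto; lia|].
    apply Rplus_le_compat_l. apply Rmult_le_compat_r.
    + apply Rplus_le_le_0_compat.
      * destruct (Nat.ltb_spec q m) as [Hl|]; [|lra]. apply lt_INR in Hl.
        apply Rlt_le, Rinv_0_lt_compat; lra.
      * destruct (Nat.ltb_spec m q) as [Hl|]; [|lra]. apply lt_INR in Hl.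
        apply Rlt_le, Rinv_0_lt_compat; lra.
    + apply sqrt_le_1; try apply pos_INR. apply le_INR; lia.
  - rewrite rsum_plus, rsum_scal, rsum_plus.
    assert (A1 := sum_inv_sqrt N). assert (A2 := sum_above q N). assert (A3 := sum_below q N).
    assert (A4 := H_sqrt N). assert (S0 := sqrt_pos (INR N)).
    assert (SS : sqrt (INR N) * sqrt (INR N) = INR N) by (apply sqrt_sqrt, pos_INR).
    set (U := rsum (fun k => if Nat.ltb q k then / (INR k - INR q) else 0) N) in *.
    set (W := rsum (fun k => if Nat.ltb k q then / (INR q - INR k) else 0) N) in *.
    assert (sqrt (INR N) * (U + W) <= sqrt (INR N) * (4 * sqrt (INR N)))
      by (apply Rmult_le_compat_l; lra).
    lra.
Qed.

Definition qn (b c n k l : nat) : nat := (n * k ^ b * l ^ c)%nat.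

Lemma qn_pos b c n k l : (1 <= n)%nat -> (1 <= k)%nat -> (1 <= l)%nat -> (1 <= qn b c n k l)%nat.
Proof.
  intros. unfold qn. assert (k ^ b <> 0)%nat by (apply Nat.pow_nonzero; lia).
  assert (l ^ c <> 0)%nat by (apply Nat.pow_nonzero; lia).
   lia.
Qed.

Lemma INR_qn b c n k l : INR (qn b c n k l) = INR n * INR k ^ b * INR l ^ c.
Proof. unfold qn. rewrite !mult_INR, !pow_INR. auto. Qed.

Lemma ln_qn b c n k l : (1 <= n)%nat -> (1 <= k)%nat -> (1 <= l)%nat ->
  ln (INR (qn b c n k l)) = ln (INR n) + INR b * ln (INR k) + INR c * ln (INR l).
Proof.
  intros Hn Hk Hl. rewrite INR_qn.
  assert (0 < INR n) by (apply lt_0_INR; lia). assert (0 < INR k) by (apply lt_0_INR; lia).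
  assert (0 < INR l) by (apply lt_0_INR; lia).
  assert (0 < INR k ^ b) by (apply pow_lt; auto). assert (0 < INR l ^ c) by (apply pow_lt; auto).
  rewrite !ln_mult, !ln_pow; auto. apply Rmult_lt_0_compat; auto.
Qed.

(* [ln (n k^b l^c / m)] *)
Definition omega (b c m n k l : nat) : R :=
  ln (INR n) - ln (INR m) + INR b * ln (INR k) + INR c * ln (INR l).

Lemma omega_qn b c m n k l : (1 <= n)%nat -> (1 <= k)%nat -> (1 <= l)%nat ->
  omega b c m n k l = ln (INR (qn b c n k l)) - ln (INR m).
Proof. intros. unfold omega. rewrite ln_qn by auto. ring. Qed.

(** The box [k, l <= P] of [Off], with absolute values inside. For [P] about [sqrt (2 X)] it is the
    only place where [n k^b l^c] can be close to [m]. *)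
Definition near (b c m n P : nat) : R :=
  rsum (fun k => rsum (fun l => / sqrt (INR k) * / sqrt (INR l) *
    Rabs (offw (qn b c n k l) m (omega b c m n k l))) P) P.

(** The sum over [m] is taken innermost with [q = n k^b l^c] held fixed, so the arithmetic of [q]
    never enters. *)
Lemma near_total b c X0 P :
  rsum (fun m => rsum (fun n => / sqrt (INR m) * / sqrt (INR n) * near b c m n P) X0) X0
  <= (2 * sqrt (INR X0) + 4 * INR X0) * (2 * sqrt (INR X0)) * ((2 * sqrt (INR P)) * (2 * sqrt (INR P))).
Proof.
  rewrite rsum_swap.
  apply Rle_trans with (rsum (fun n => rsum (fun k => rsum (fun l =>
    (2 * sqrt (INR X0) + 4 * INR X0) * (/ sqrt (INR n) * (/ sqrt (INR k) * / sqrt (INR l)))) P) P) X0).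
  - apply rsum_le. intros n Hn. unfold near.
    rewrite (rsum_ext _ (fun m => rsum (fun k => rsum (fun l =>
      (/ sqrt (INR n) * (/ sqrt (INR k) * / sqrt (INR l))) * (/ sqrt (INR m) *
       Rabs (offw (qn b c n k l) m (omega b c m n k l)))) P) P)).
    2:{ intros m Hm. rewrite <- rsum_scal. apply rsum_ext; intros k Hk.
        rewrite <- rsum_scal. apply rsum_ext; intros l Hl. ring. }
    rewrite rsum_swap. apply rsum_le. intros k Hk. rewrite rsum_swap. apply rsum_le. intros l Hl.
    rewrite rsum_scal, Rmult_comm. apply Rmult_le_compat_r.
    + assert (A1 := sqrt_INR_pos n ltac:(lia)). assert (A2 := sqrt_INR_pos k ltac:(lia)).
      assert (A3 := sqrt_INR_pos l ltac:(lia)).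
      repeat apply Rmult_le_pos; apply Rlt_le, Rinv_0_lt_compat; auto.
    + rewrite (rsum_ext _ (fun m => / sqrt (INR m) *
        Rabs (offw (qn b c n k l) m (ln (INR (qn b c n k l)) - ln (INR m))))).
      * apply near_sum_m. apply qn_pos; lia.
      * intros m Hm. rewrite omega_qn by lia. auto.
  - rewrite (rsum_ext _ (fun n => (2 * sqrt (INR X0) + 4 * INR X0) * / sqrt (INR n) *
       (rsum (fun k => / sqrt (INR k)) P * rsum (fun l => / sqrt (INR l)) P))).
    + rewrite rsum_scal_r, rsum_scal.
      assert (A1 := sum_inv_sqrt X0). assert (A2 := sum_inv_sqrt P).
        assert (S2 := pos_INR X0).
      assert (Z : 0 <= rsum (fun k => / sqrt (INR k)) P).
      { apply rsum_nonneg. intros. apply Rlt_le, Rinv_0_lt_compat, sqrt_INR_pos; lia. }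
      assert (Z2 : 0 <= rsum (fun k => / sqrt (INR k)) X0).
      { apply rsum_nonneg. intros. apply Rlt_le, Rinv_0_lt_compat, sqrt_INR_pos; lia. }
      apply Rmult_le_compat.
      * apply Rmult_le_pos; auto; lra.
      * apply Rmult_le_pos; auto.
      * apply Rmult_le_compat_l; auto; lra.
      * apply Rmult_le_compat; auto.
    + intros n Hn. rewrite <- rsum_prod, <- rsum_scal. apply rsum_ext; intros k Hk.
      rewrite <- rsum_scal. apply rsum_ext; intros l Hl. ring.
Qed.

(* The terms with [n k^b l^c <> m] of a primitive of the integrand, taken at [u]. *)
Definition Off (b c m n N1 N2 : nat) (u : R) : C :=
  csum (fun k => csum (fun l => Cmult (Cmult (zterm (INR b * u) k) (zterm (INR c * u) l))
    (RtoC (offw (qn b c n k l) m (omega b c m n k l)))) N2) N1.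

(* [1/x - 1/(x + d) = d / (x (x + d))] decreases in [x]: this is the mixed
   monotonicity needed for double partial summation. *)
Lemma inv_sum_mixed x y d : 0 < x -> x <= y -> 0 <= d ->
  / y - / (y + d) <= / x - / (x + d).
Proof.
  intros Hx Hxy Hd.
  replace (/ y - / (y + d)) with (d * / (y * (y + d))) by (field; lra).
  replace (/ x - / (x + d)) with (d * / (x * (x + d))) by (field; lra).
  apply Rmult_le_compat_l; auto. apply Rinv_le_contravar; nra.
Qed.

Lemma csum_shift_bound f A P j : (forall i, (i <= P + j)%nat -> Cmod (csum f i) <= A) ->
  Cmod (csum (fun k => f (P + k)%nat) j) <= 2 * A.
Proof.
  intros H. replace (csum (fun k => f (P + k)%nat) j) with (Cminus (csum f (P + j)) (csum f P))
    by (rewrite csum_app; ring).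
  eapply Rle_trans; [apply Cmod_triangle|]. rewrite Cmod_opp.
  assert (H1 := H (P + j)%nat ltac:(lia)). assert (H2 := H P ltac:(lia)). lra.
Qed.

Lemma inv_le_2 x : / 2 <= x -> / x <= 2.
Proof. intros. replace 2 with (/ / 2) by field. apply Rinv_le_contravar; lra. Qed.

(** As [b, c >= 2], having [k] or [l] above [P] forces [n k^b l^c >= (P + 1)^2 >= 2 X >= 2 m]. Hence
    [omega >= ln 2 >= 1/2] there: no diagonal term occurs, and [1/omega] is a monotone weight
    bounded by 2, fit for partial summation. Only the box [near] is estimated with absolute
    values. *)
Lemma Off_bound b c m n N1 N2 P u X A :
  (2 <= b)%nat -> (2 <= c)%nat -> (1 <= m)%nat -> (1 <= n)%nat ->
  1 <= X -> INR m <= X -> 2 * X <= INR (P + 1) ^ 2 -> (P <= N1)%nat -> (P <= N2)%nat -> 0 <= A ->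
  (forall j, (j <= N1)%nat -> Cmod (csum (zterm (INR b * u)) j) <= A) ->
  (forall j, (j <= N2)%nat -> Cmod (csum (zterm (INR c * u)) j) <= A) ->
  Cmod (Off b c m n N1 N2 u) <= near b c m n P + 4 * A ^ 2 + 8 * sqrt (INR P) * A.
Proof.
  intros Hb Hc Hm Hn HX HmX HP HN1 HN2 HA Ha1 Ha2.
  assert (M1 := INR_ge1 m Hm). assert (N1' := INR_ge1 n Hn).
  assert (P1 := INR_ge1 (P + 1) ltac:(lia)).
  assert (B2 : 2 <= INR b) by (apply (le_INR 2); auto).
  assert (C2 : 2 <= INR c) by (apply (le_INR 2); auto).
  assert (Hln : / 2 <= ln 2) by (apply Rlt_le, ln_lt_2).
  assert (LP : ln 2 + ln X <= 2 * ln (INR (P + 1))).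
  { rewrite <- ln_mult by lra. apply Rle_trans with (ln (INR (P + 1) ^ 2)).
    - apply ln_le; lra.
    - rewrite ln_pow by lra. simpl; lra. }
  assert (Lm : ln (INR m) <= ln X) by (apply ln_le; lra).
  assert (Ln : 0 <= ln (INR n)) by (apply ln_nonneg; auto).
  assert (Lmon : forall k, (1 <= k)%nat -> ln (INR k) <= ln (INR (S k))).
  { intros. apply ln_le; [apply lt_0_INR; lia|apply le_INR; lia]. }
  assert (Lpos : forall k, (1 <= k)%nat -> 0 <= ln (INR k)).
  { intros. apply ln_nonneg, INR_ge1; auto. }
  assert (LPk : forall k, (1 <= k)%nat -> ln (INR (P + 1)) <= ln (INR (P + k))).
  { intros. apply ln_le; [lra|apply le_INR; lia]. }
  assert (H1 : forall k l, (1 <= k)%nat -> (1 <= l)%nat -> ln 2 <= omega b c m n (P + k) l).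
  { intros k l Hk Hl. unfold omega. specialize (LPk k Hk). specialize (Lpos l Hl).
    assert (2 * ln (INR (P + k)) <= INR b * ln (INR (P + k))).
    { apply Rmult_le_compat_r; auto. apply ln_nonneg, INR_ge1; lia. }
    assert (0 <= INR c * ln (INR l)) by (apply Rmult_le_pos; lra). lra. }
  assert (H2 : forall k l, (1 <= k)%nat -> (1 <= l)%nat -> ln 2 <= omega b c m n k (P + l)).
  { intros k l Hk Hl. unfold omega. specialize (LPk l Hl). specialize (Lpos k Hk).
    assert (2 * ln (INR (P + l)) <= INR c * ln (INR (P + l))).
    { apply Rmult_le_compat_r; auto. apply ln_nonneg, INR_ge1; lia. }
    assert (0 <= INR b * ln (INR k)) by (apply Rmult_le_pos; lra). lra. }
  assert (Hoff : forall k l, (1 <= k)%nat -> (1 <= l)%nat -> ln 2 <= omega b c m n k l ->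
    offw (qn b c n k l) m (omega b c m n k l) = / omega b c m n k l).
  { intros k l Hk Hl Hw. unfold offw. destruct (Nat.eqb_spec (qn b c n k l) m) as [E|]; auto.
    rewrite omega_qn, E in Hw by auto. lra. }
  unfold Off.
  replace N1 with (P + (N1 - P))%nat by lia. rewrite csum_app.
  rewrite (csum_ext _ (fun k => Cplus
    (csum (fun l => Cmult (Cmult (zterm (INR b * u) k) (zterm (INR c * u) l))
      (RtoC (offw (qn b c n k l) m (omega b c m n k l)))) P)
    (Cmult (zterm (INR b * u) k) (csum (fun l => Cmult (zterm (INR c * u) (P + l))
      (RtoC (/ omega b c m n k (P + l)))) (N2 - P)))) P).
  2:{ intros k Hk. replace N2 with (P + (N2 - P))%nat at 1 by lia. rewrite csum_app.
      f_equal. rewrite <- csum_scal. apply csum_ext. intros l Hl.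
      rewrite Hoff; try lia; [ring|]. apply H2; lia. }
  rewrite csum_plus.
  assert (T1 : Cmod (csum (fun k => csum (fun l =>
      Cmult (Cmult (zterm (INR b * u) k) (zterm (INR c * u) l))
      (RtoC (offw (qn b c n k l) m (omega b c m n k l)))) P) P) <= near b c m n P).
  { unfold near. apply csum_bound. intros k Hk. apply csum_bound. intros l Hl.
    rewrite !Cmod_mult, !Cmod_zterm, Cmod_R. lra. }
  (* The region [k <= P < l]: trivial in [k], partial summation in [l], where starting at [P]
     doubles the bound [A]. *)
  assert (T2 : Cmod (csum (fun k => Cmult (zterm (INR b * u) k)
     (csum (fun l => Cmult (zterm (INR c * u) (P + l))
      (RtoC (/ omega b c m n k (P + l)))) (N2 - P))) P) <= 8 * sqrt (INR P) * A).
  { eapply Rle_trans; [apply (csum_bound _ (fun k => / sqrt (INR k) * (4 * A)))|].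
    - intros k Hk. rewrite Cmod_mult, Cmod_zterm. apply Rmult_le_compat_l.
      + apply Rlt_le, Rinv_0_lt_compat, sqrt_INR_pos; lia.
      + eapply Rle_trans; [apply (abel_mono _ (fun l => / omega b c m n k (P + l)) (N2 - P) (2 * A))|].
        * intros j Hj. apply csum_shift_bound. intros i Hi. apply Ha2; lia.
        * intros l Hl. assert (W := H2 k l ltac:(lia) ltac:(lia)).
          apply Rlt_le, Rinv_0_lt_compat; lra.
        * intros l Hl. assert (W := H2 k l ltac:(lia) ltac:(lia)).
          apply Rinv_le_contravar; [lra|]. unfold omega. apply Rplus_le_compat_l.
          apply Rmult_le_compat_l; [lra|]. rewrite Nat.add_succ_r. apply Lmon; lia.
        * lra.
        * assert (W := H2 k 1%nat ltac:(lia) ltac:(lia)). apply Rlt_le, Rinv_0_lt_compat; lra.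
        * assert (W := H2 k 1%nat ltac:(lia) ltac:(lia)).
          replace (4 * A) with (2 * A * 2) by ring.
          apply Rmult_le_compat_l; [lra|]. apply inv_le_2; lra.
    - rewrite rsum_scal_r. assert (A1 := sum_inv_sqrt P).
      replace (8 * sqrt (INR P) * A) with (2 * sqrt (INR P) * (4 * A)) by ring.
      apply Rmult_le_compat_r; lra. }
  (* The region [k > P] with all [l]: double partial summation, using cancellation in both
     variables. *)
  assert (T3 : Cmod (csum (fun k => csum (fun l =>
      Cmult (Cmult (zterm (INR b * u) (P + k)) (zterm (INR c * u) l))
      (RtoC (offw (qn b c n (P + k) l) m (omega b c m n (P + k) l)))) N2) (N1 - P)) <= 4 * A ^ 2).
  { rewrite (csum_ext _ (fun k => csum (fun l =>
      Cmult (Cmult (zterm (INR b * u) (P + k)) (zterm (INR c * u) l))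
      (RtoC (/ omega b c m n (P + k) l))) N2)).
    2:{ intros k Hk. apply csum_ext. intros l Hl. rewrite Hoff; auto; try lia. apply H1; lia. }
    eapply Rle_trans; [apply (abel_mono2 (fun k => zterm (INR b * u) (P + k)) (zterm (INR c * u))
       (fun k l => / omega b c m n (P + k) l) _ _ (2 * A) A)|].
    - intros j Hj. apply csum_shift_bound. intros i Hi. apply Ha1; lia.
    - intros j Hj. apply Ha2; lia.
    - lra.
    - lra.
    - intros k l Hk Hl. assert (W := H1 k l Hk Hl). apply Rlt_le, Rinv_0_lt_compat; lra.
    - intros k l Hk Hl. assert (W := H1 k l Hk Hl). apply Rinv_le_contravar; [lra|].
      unfold omega. rewrite Nat.add_succ_r. assert (Lk := Lmon (P + k)%nat ltac:(lia)).
      apply Rplus_le_compat_r, Rplus_le_compat_l.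
      apply Rmult_le_compat_l; lra.
    - intros k l Hk Hl. assert (W := H1 k l Hk Hl). apply Rinv_le_contravar; [lra|].
      unfold omega. assert (Lk := Lmon l ltac:(lia)). apply Rplus_le_compat_l.
      apply Rmult_le_compat_l; lra.
    - intros k l Hk Hl. assert (W := H1 k l Hk Hl).
      (* Moving [k] by one shifts [omega] by an amount independent of [l], which is the situation of
         [inv_sum_mixed]. *)
      set (d := INR b * (ln (INR (P + S k)) - ln (INR (P + k)))).
      assert (Ed : forall l, omega b c m n (P + S k) l = omega b c m n (P + k) l + d).
      { intros. unfold omega, d. ring. }
      rewrite !Ed. apply inv_sum_mixed; [lra| |].
      + unfold omega. assert (Lk := Lmon l ltac:(lia)). apply Rplus_le_compat_l.
        apply Rmult_le_compat_l; lra.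
      + unfold d. rewrite Nat.add_succ_r. assert (Lk := Lmon (P + k)%nat ltac:(lia)).
        apply Rmult_le_pos; lra.
    - assert (W := H1 1%nat 1%nat ltac:(lia) ltac:(lia)).
      replace (4 * A ^ 2) with (2 * A * A * 2) by ring.
      apply Rmult_le_compat_l; [nra|]. apply inv_le_2; lra. }
  eapply Rle_trans; [apply Cmod_triangle|].
  eapply Rle_trans; [apply Rplus_le_compat; [apply Cmod_triangle|apply T3]|]. lra.
Qed.

(** * Expansion of the integrand and termwise integration *)

Definition XT (theta t : R) : R := Rpower (t / (2 * PI)) theta.

(* The time at which [m] enters the sum [Dtheta]: [m <= XT theta t] iff [tm theta m <= t]. *)
Definition tm (theta : R) (m : nat) : R := 2 * PI * Rpower (INR m) (/ theta).

Lemma tm_le theta m t : 0 < theta -> (1 <= m)%nat -> 0 < t ->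
  (INR m <= XT theta t <-> tm theta m <= t).
Proof.
  intros Hth Hm Ht. assert (P := PI_RGT_0). assert (M1 := INR_ge1 m Hm).
  assert (Hit : 0 < / theta) by (apply Rinv_0_lt_compat; auto).
  assert (Hy : 0 < t / (2 * PI)) by (apply Rdiv_lt_0_compat; lra).
  unfold XT, tm. set (y := t / (2 * PI)) in *.
  replace t with (2 * PI * y) by (unfold y; field; lra). split; intros H.
  - apply Rmult_le_compat_l; [lra|].
    replace y with (Rpower (Rpower y theta) (/ theta)).
    + apply Rpower_le_base; lra.
    + rewrite Rpower_mult, Rinv_r, Rpower_1; lra.
  - assert (H2 : Rpower (INR m) (/ theta) <= y) by (apply Rmult_le_reg_l with (2 * PI); lra).
    replace (INR m) with (Rpower (Rpower (INR m) (/ theta)) theta).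
    + apply Rpower_le_base; [|lra]. split; auto. apply Rpower_pos.
    + rewrite Rpower_mult, Rinv_l, Rpower_1; lra.
Qed.

Lemma XT_pos theta t : 0 < XT theta t.
Proof. apply Rpower_pos. Qed.

Lemma tm_floor theta m t : 0 < theta -> (1 <= m)%nat -> 0 < t ->
  ((m <= nat_floor (XT theta t))%nat <-> tm theta m <= t).
Proof.
  intros. rewrite nat_floor_le by (apply Rlt_le, XT_pos). apply tm_le; auto.
Qed.

Lemma tm_mono theta m n : 0 < theta -> (1 <= m <= n)%nat -> tm theta m <= tm theta n.
Proof.
  intros Hth H. unfold tm. assert (P := PI_RGT_0). apply Rmult_le_compat_l; [lra|].
  apply Rpower_le_base.
  - split; [apply lt_0_INR; lia|apply le_INR; lia].
  - apply Rlt_le, Rinv_0_lt_compat; auto.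
Qed.

Lemma csum_trunc f m n :
  (m <= n)%nat -> (forall k, (m < k <= n)%nat -> f k = RtoC 0) -> csum f n = csum f m.
Proof.
  intros Hmn H. replace n with (m + (n - m))%nat by lia. rewrite csum_app.
  rewrite (csum_ext (fun k => f (m + k)%nat) (fun _ => RtoC 0)), csum_const.
  - rewrite Cmult_0_r. ring.
  - intros; apply H; lia.
Qed.

Lemma csum_conj f n : Cconj (csum f n) = csum (fun k => Cconj (f k)) n.
Proof.
  induction n as [|n IH]; cbn [csum].
  - unfold Cconj, RtoC; simpl. f_equal; ring.
  - rewrite Cplus_conj, IH. auto.
Qed.

Lemma npow_neg_conj t m : (1 <= m)%nat -> npow_neg m (1 / 2) t = Cconj (zterm t m).
Proof.
  intros Hm. unfold npow_neg, zterm, Cconj, cis, Cmult, RtoC; simpl.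
  rewrite Rpower_half by (apply lt_0_INR; lia). f_equal; ring.
Qed.

(** Freezes the length at its value for [T] and moves the dependence on [t] into an indicator, so
    that sum and integral can be interchanged. The conjugate appears because [zterm] carries
    [+ i t]. *)
Lemma Dtheta_expand theta t T : 0 < theta -> 0 < t <= T ->
  Dtheta theta (1 / 2) t =
  csum (fun m => if Rle_dec (tm theta m) t then Cconj (zterm t m) else RtoC 0)
    (nat_floor (XT theta T)).
Proof.
  intros Hth Ht. unfold Dtheta. destruct (Rlt_dec 0 t) as [_|]; [|lra].
  fold (XT theta t).
  assert (HX : XT theta t <= XT theta T).
  { unfold XT. assert (P := PI_RGT_0). apply Rpower_le_base; [|lra]. split.
    - apply Rdiv_lt_0_compat; lra.
    - apply Rmult_le_compat_r; [apply Rlt_le, Rinv_0_lt_compat|]; lra. }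
  assert (Hfl : (nat_floor (XT theta t) <= nat_floor (XT theta T))%nat).
  { apply nat_floor_le; [apply Rlt_le, XT_pos|].
    eapply Rle_trans; [apply nat_floor_spec, Rlt_le, XT_pos|auto]. }
  rewrite (csum_trunc _ (nat_floor (XT theta t))); auto.
  - rewrite (csum_ext _ (fun m => npow_neg m (1 / 2) t)).
    + generalize (nat_floor (XT theta t)). induction n as [|n IH].
      * rewrite sum_O. auto.
      * rewrite sum_Sn, IH. reflexivity.
    + intros k Hk. rewrite npow_neg_conj by lia.
      destruct (Rle_dec (tm theta k) t) as [|Hn]; auto. exfalso; apply Hn.
      apply tm_floor; auto; lia || lra.
  - intros k Hk. destruct (Rle_dec (tm theta k) t) as [Hle|]; auto.
    apply tm_floor in Hle; auto; try lia; lra.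
Qed.

Definition wmn (m n : nat) : R := / sqrt (INR m) * / sqrt (INR n).

(** Expansion of [|D_theta|^2 g]. The factor [g] is a parameter because it stands both for the
    product of zeta values and for its averaged approximation. *)
Definition stepsum (theta : R) (X0 : nat) (g : R -> C) (t : R) : C :=
  csum (fun m => csum (fun n =>
    if Rle_dec (Rmax (tm theta m) (tm theta n)) t then
      Cmult (RtoC (wmn m n)) (Cmult (cis (t * (ln (INR n) - ln (INR m)))) (g t))
    else RtoC 0) X0) X0.

Definition zz (b c : nat) (t : R) : C :=
  Cmult (zeta (1 / 2) (- (INR b * t))) (zeta (1 / 2) (- (INR c * t))).

Lemma Mint_expand theta b c t T : 0 < theta -> 0 < t <= T ->
  Mintegrand theta (INR b) (INR c) t = stepsum theta (nat_floor (XT theta T)) (zz b c) t.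
Proof.
  intros Hth Ht. unfold Mintegrand. fold (zz b c t). rewrite RtoC_pow.
  replace ((RtoC (Cmod (Dtheta theta (1 / 2) t)) ^ 2)%C) with
    (RtoC (Cmod (Dtheta theta (1 / 2) t) ^ 2)) by apply RtoC_pow.
  rewrite Cmod2_conj. rewrite (Dtheta_expand theta t T Hth Ht).
  rewrite csum_conj, <- csum_prod, <- csum_scal_r. unfold stepsum.
  apply csum_ext. intros m Hm. rewrite <- csum_scal_r. apply csum_ext. intros n Hn.
  destruct (Rle_dec (tm theta m) t) as [H1|H1];
  destruct (Rle_dec (tm theta n) t) as [H2|H2];
  destruct (Rle_dec (Rmax (tm theta m) (tm theta n)) t) as [H3|H3];
  try (exfalso; apply H3; apply Rmax_lub; assumption);
  try (exfalso; apply H1; eapply Rle_trans; [apply Rmax_l|exact H3]);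
  try (exfalso; apply H2; eapply Rle_trans; [apply Rmax_r|exact H3]).
  - rewrite Cconj_conj. unfold zterm, wmn.
    rewrite Cmult_conj, <- cis_opp.
    replace (Cconj (RtoC (/ sqrt (INR m)))) with (RtoC (/ sqrt (INR m)))
      by (unfold Cconj, RtoC; simpl; f_equal; ring).
    replace (t * (ln (INR n) - ln (INR m))) with (- (t * ln (INR m)) + t * ln (INR n)) by ring.
    rewrite cis_plus, RtoC_mult. ring.
  - replace (Cconj (RtoC 0)) with (RtoC 0) by (unfold Cconj, RtoC; simpl; f_equal; ring). ring.
  - ring.
  - replace (Cconj (RtoC 0)) with (RtoC 0) by (unfold Cconj, RtoC; simpl; f_equal; ring). ring.
Qed.

Definition low (theta u : R) (m n : nat) : R := Rmax u (Rmax (tm theta m) (tm theta n)).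

Lemma stepsum_CInt theta X0 g u v (J : nat -> nat -> C) : u <= v ->
  (forall m, (1 <= m <= X0)%nat -> tm theta m <= v) ->
  (forall m n, (1 <= m <= X0)%nat -> (1 <= n <= X0)%nat ->
     is_CInt (fun t => Cmult (cis (t * (ln (INR n) - ln (INR m)))) (g t)) (low theta u m n) v (J m n)) ->
  is_CInt (stepsum theta X0 g) u v
    (csum (fun m => csum (fun n => Cmult (RtoC (wmn m n)) (J m n)) X0) X0).
Proof.
  intros Huv Htm HJ. unfold stepsum.
  apply is_CInt_csum. intros m Hm. apply is_CInt_csum. intros n Hn.
  assert (Hlow : u <= low theta u m n <= v).
  { unfold low. split; [apply Rmax_l|]. apply Rmax_lub; auto. apply Rmax_lub; apply Htm; auto. }
  apply (is_CInt_ext (fun t => if Rle_dec (low theta u m n) t then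
     Cmult (RtoC (wmn m n)) (Cmult (cis (t * (ln (INR n) - ln (INR m)))) (g t)) else RtoC 0)); auto.
  - intros t Ht. unfold low.
    destruct (Rle_dec (Rmax (tm theta m) (tm theta n)) t) as [H1|H1];
    destruct (Rle_dec (Rmax u (Rmax (tm theta m) (tm theta n))) t) as [H2|H2]; auto.
    + exfalso; apply H2. apply Rmax_lub; lra.
    + exfalso; apply H1. eapply Rle_trans; [apply Rmax_r|exact H2].
  - apply is_CInt_step; auto. apply is_CInt_scal. apply HJ; auto.
Qed.

Lemma zz_cont b c t : Ccont (zz b c) t.
Proof.
  unfold zz.
  assert (G : forall a, Ccont (fun t => zeta (1 / 2) (- (a * t))) t).
  { intros a. destruct (zeta_half_cont (a * t)) as [H1 H2].
    assert (Ha : continuous (fun x => a * x) t).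
    { apply (ex_derive_continuous (V := R_NormedModule)). auto_derive; auto. }
    split.
    - apply (continuous_comp (fun x => a * x) (fun tau => fst (zeta (1 / 2) (- tau)))); auto.
    - apply (continuous_comp (fun x => a * x) (fun tau => snd (zeta (1 / 2) (- tau)))); auto. }
  apply Ccont_mult; apply G.
Qed.

(** [RInt] is a total function, so integrability must be proved before [M11] carries any
    information. The jumps of [Dtheta] are isolated by the steps in [stepsum]; the remaining factors
    are continuous. *)
Lemma Mint_CInt theta b c u v : 0 < theta -> 0 <= u <= v -> 0 < v ->
  exists I, is_CInt (Mintegrand theta (INR b) (INR c)) u v I.
Proof.
  intros Hth Huv Hv. set (X0 := nat_floor (XT theta v)).
  assert (Htm : forall m, (1 <= m <= X0)%nat -> tm theta m <= v).
  { intros m Hm. apply tm_floor; auto; lia. }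
  eexists. apply (is_CInt_ext (stepsum theta X0 (zz b c))); [lra| |].
  - intros t Ht. symmetry. apply Mint_expand; auto; lra.
  - apply stepsum_CInt; [lra|exact Htm|]. intros m n Hm Hn. apply Ccont_CInt.
    + apply Rmax_lub; [lra|]. apply Rmax_lub; apply Htm; auto.
    + intros t. apply Ccont_mult; [apply Ccont_cis|apply zz_cont].
Qed.

Definition Dd (b c m n N1 N2 : nat) : R :=
  rsum (fun k => rsum (fun l => wmn k l * (if Nat.eqb (qn b c n k l) m then 1 else 0)) N2) N1.

(** The integral over [[w, v]] of the [(m, n)] term with truncated zeta sums: zero frequencies
    contribute the length of the interval, the others [- i] times the increment of
    [cis (t omega) / omega]. *)
Definition Vint (b c m n N1 N2 : nat) (w v : R) : C :=
  Cplus (RtoC ((v - w) * Dd b c m n N1 N2))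
    (Cmult (Copp Ci) (Cminus
      (Cmult (cis (v * (ln (INR n) - ln (INR m)))) (Off b c m n N1 N2 v))
      (Cmult (cis (w * (ln (INR n) - ln (INR m)))) (Off b c m n N1 N2 w)))).

Lemma zterm_pair b c m n k l t :
  Cmult (cis (t * (ln (INR n) - ln (INR m))))
    (Cmult (zterm (INR b * t) k) (zterm (INR c * t) l)) =
  Cmult (RtoC (wmn k l)) (cis (t * omega b c m n k l)).
Proof.
  unfold zterm, wmn, omega. rewrite RtoC_mult.
  replace (t * (ln (INR n) - ln (INR m) + INR b * ln (INR k) + INR c * ln (INR l))) with
    (t * (ln (INR n) - ln (INR m)) + (INR b * t * ln (INR k) + INR c * t * ln (INR l))) by ring.
  rewrite !cis_plus. ring.
Qed.

Lemma SS_CInt b c m n N1 N2 w v : (1 <= m)%nat -> (1 <= n)%nat ->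
  is_CInt (fun t => Cmult (cis (t * (ln (INR n) - ln (INR m))))
    (Cmult (csum (zterm (INR b * t)) N1) (csum (zterm (INR c * t)) N2))) w v
    (Vint b c m n N1 N2 w v).
Proof.
  intros Hm Hn.
  set (V := fun k l => if Nat.eqb (qn b c n k l) m then RtoC (v - w) else
    Cmult (RtoC (/ omega b c m n k l)) (Cmult (Copp Ci)
      (Cminus (cis (v * omega b c m n k l)) (cis (w * omega b c m n k l))))).
  assert (E : Vint b c m n N1 N2 w v =
    csum (fun k => csum (fun l => Cmult (RtoC (wmn k l)) (V k l)) N2) N1).
  { unfold Vint, Dd, Off. rewrite <- rsum_scal, <- csum_RtoC, <- !csum_scal, <- csum_minus,
      <- csum_scal, <- csum_plus. apply csum_ext. intros k Hk.
    rewrite <- rsum_scal, <- csum_RtoC, <- !csum_scal, <- csum_minus,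
      <- csum_scal, <- csum_plus. apply csum_ext. intros l Hl.
    rewrite !(Cmult_assoc (cis _) (Cmult (zterm _ _) (zterm _ _))), !zterm_pair.
    unfold V, offw. destruct (Nat.eqb (qn b c n k l) m); rewrite !RtoC_mult; ring. }
  rewrite E.
  assert (G : is_CInt (fun t => csum (fun k => csum (fun l => Cmult (RtoC (wmn k l))
     (cis (t * omega b c m n k l))) N2) N1) w v
     (csum (fun k => csum (fun l => Cmult (RtoC (wmn k l)) (V k l)) N2) N1)).
  { apply is_CInt_csum. intros k Hk. apply is_CInt_csum. intros l Hl. apply is_CInt_scal.
    unfold V. destruct (Nat.eqb_spec (qn b c n k l) m) as [Eq|Nq].
    - assert (W : omega b c m n k l = 0) by (rewrite omega_qn, Eq by lia; ring).
      rewrite W. assert (K := is_CInt_const (RtoC 1) w v). rewrite Cmult_1_r in K.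
      destruct K as [K1 K2]. split.
      + apply (is_RInt_ext (fun _ => fst (RtoC 1))); auto.
        intros; rewrite Rmult_0_r, cis_0; auto.
      + apply (is_RInt_ext (fun _ => snd (RtoC 1))); auto.
        intros; rewrite Rmult_0_r, cis_0; auto.
    - apply is_CInt_cis. rewrite omega_qn by lia. intros H. apply Nq. apply INR_eq.
      assert (Q := qn_pos b c n k l ltac:(lia) ltac:(lia) ltac:(lia)).
      apply ln_inv; [apply lt_0_INR; lia|apply lt_0_INR; lia|lra]. }
  assert (Ef : forall t, csum (fun k => csum (fun l => Cmult (RtoC (wmn k l))
     (cis (t * omega b c m n k l))) N2) N1 =
     Cmult (cis (t * (ln (INR n) - ln (INR m))))
    (Cmult (csum (zterm (INR b * t)) N1) (csum (zterm (INR c * t)) N2))).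
  { intros t. rewrite <- csum_prod, <- csum_scal. apply csum_ext. intros k Hk.
    rewrite <- csum_scal. apply csum_ext. intros l Hl. symmetry. apply zterm_pair. }
  destruct G as [G1 G2]. split.
  - eapply is_RInt_ext; [|exact G1]. intros t _. cbv beta. rewrite Ef. auto.
  - eapply is_RInt_ext; [|exact G2]. intros t _. cbv beta. rewrite Ef. auto.
Qed.

Definition ZZ (b c M : nat) (t : R) : C := Cmult (Zavg M (INR b * t)) (Zavg M (INR c * t)).

Definition Javg (b c M m n : nat) (w v : R) : C :=
  Cmult (RtoC (/ INR M * / INR M))
    (csum (fun i => csum (fun j => Vint b c m n (M + i) (M + j) w v) M) M).

Lemma ZZ_CInt b c M m n w v : w <= v -> (1 <= m)%nat -> (1 <= n)%nat ->
  is_CInt (fun t => Cmult (cis (t * (ln (INR n) - ln (INR m)))) (ZZ b c M t)) w v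
    (Javg b c M m n w v).
Proof.
  intros Hwv Hm Hn.
  apply (is_CInt_ext (fun t => Cmult (RtoC (/ INR M * / INR M))
    (csum (fun i => csum (fun j => Cmult (cis (t * (ln (INR n) - ln (INR m))))
      (Cmult (csum (zterm (INR b * t)) (M + i)) (csum (zterm (INR c * t)) (M + j)))) M) M))); auto.
  - intros t _. unfold ZZ, Zavg.
    rewrite (csum_ext _ (fun i => Cmult (cis (t * (ln (INR n) - ln (INR m))))
      (csum (fun j => (Cmult (csum (zterm (INR b * t)) (M + i)) (csum (zterm (INR c * t)) (M + j)))) M)))
      by (intros; apply csum_scal).
    rewrite csum_scal, (csum_prod (fun i => csum (zterm (INR b * t)) (M + i))
       (fun j => csum (zterm (INR c * t)) (M + j))), RtoC_mult. ring.
  - apply is_CInt_scal. apply is_CInt_csum. intros i Hi. apply is_CInt_csum. intros j Hj.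
    apply SS_CInt; auto.
Qed.

Lemma le_pow_self k b : (1 <= b)%nat -> (k <= k ^ b)%nat.
Proof.
  intros Hb. destruct b as [|b]; [lia|]. destruct k as [|k]; [lia|].
  rewrite Nat.pow_succ_r'. assert (S k ^ b <> 0)%nat by (apply Nat.pow_nonzero; lia). nia.
Qed.

Lemma qn_ge b c n k l : (1 <= b)%nat -> (1 <= c)%nat -> (1 <= n)%nat -> (1 <= k)%nat -> (1 <= l)%nat ->
  (n <= qn b c n k l)%nat /\ (k <= qn b c n k l)%nat /\ (l <= qn b c n k l)%nat.
Proof.
  intros Hb Hc Hn Hk Hl. unfold qn.
  assert (H1 := le_pow_self k b Hb). assert (H2 := le_pow_self l c Hc).
  set (K := (k ^ b)%nat) in *.
  assert (1 <= n * K)%nat by nia. repeat split; nia.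
Qed.

(** A solution of [n k^b l^c = m] has [k, l <= m <= X0]. The diagonal is therefore insensitive to
    the cut-offs and passes through the averaging unchanged. *)
Lemma Dd_stable b c m n N1 N2 X0 : (1 <= b)%nat -> (1 <= c)%nat -> (1 <= n)%nat ->
  (m <= X0)%nat -> (X0 <= N1)%nat -> (X0 <= N2)%nat ->
  Dd b c m n N1 N2 = Dd b c m n X0 X0.
Proof.
  intros Hb Hc Hn Hm H1 H2. unfold Dd.
  rewrite (rsum_trunc _ X0 N1); auto.
  - apply rsum_ext. intros k Hk. apply rsum_trunc; auto. intros l Hl.
    destruct (Nat.eqb_spec (qn b c n k l) m) as [E|]; [|ring].
    assert (Q := qn_ge b c n k l Hb Hc Hn ltac:(lia) ltac:(lia)). lia.
  - intros k Hk. rewrite (rsum_ext _ (fun _ => 0)), rsum_zero; auto. intros l Hl.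
    destruct (Nat.eqb_spec (qn b c n k l) m) as [E|]; [|ring].
    assert (Q := qn_ge b c n k l Hb Hc Hn ltac:(lia) ltac:(lia)). lia.
Qed.

Lemma avg_bound (V : nat -> nat -> C) a B M : (1 <= M)%nat ->
  (forall i j, (1 <= i <= M)%nat -> (1 <= j <= M)%nat -> Cmod (Cminus (V i j) a) <= B) ->
  Cmod (Cminus (Cmult (RtoC (/ INR M * / INR M)) (csum (fun i => csum (fun j => V i j) M) M)) a) <= B.
Proof.
  intros HM H. assert (M0 : 0 < INR M) by (apply lt_0_INR; lia).
  assert (Mi : 0 < / INR M) by (apply Rinv_0_lt_compat; auto).
  assert (E : Cminus (Cmult (RtoC (/ INR M * / INR M)) (csum (fun i => csum (fun j => V i j) M) M)) a
    = Cmult (RtoC (/ INR M * / INR M)) (csum (fun i => csum (fun j => Cminus (V i j) a) M) M)).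
  { rewrite (csum_ext (fun i => csum (fun j => Cminus (V i j) a) M)
      (fun i => Cminus (csum (fun j => V i j) M) (Cmult (RtoC (INR M)) a))).
    - rewrite csum_minus, csum_const.
      replace a with (Cmult (Cmult (RtoC (/ INR M * / INR M)) (Cmult (RtoC (INR M)) (RtoC (INR M)))) a) at 1.
      + ring.
      + rewrite <- !RtoC_mult. replace (/ INR M * / INR M * (INR M * INR M)) with 1 by (field; lra). ring.
    - intros i Hi. rewrite csum_minus, csum_const. auto. }
  rewrite E, Cmod_Rmult by (apply Rmult_le_pos; lra).
  apply Rle_trans with (/ INR M * / INR M * (INR M * (INR M * B))).
  - apply Rmult_le_compat_l; [apply Rmult_le_pos; lra|].
    rewrite <- (rsum_const (INR M * B) M). apply csum_bound. intros i Hi.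
    rewrite <- (rsum_const B M). apply csum_bound. intros j Hj. auto.
  - apply Req_le. field. lra.
Qed.

Lemma Javg_est b c M m n X0 w v Bd : (1 <= b)%nat -> (1 <= c)%nat -> (1 <= m <= X0)%nat ->
  (1 <= n)%nat -> (X0 <= M)%nat ->
  (forall i j, (1 <= i <= M)%nat -> (1 <= j <= M)%nat ->
     Cmod (Off b c m n (M + i) (M + j) w) <= Bd /\ Cmod (Off b c m n (M + i) (M + j) v) <= Bd) ->
  Cmod (Cminus (Javg b c M m n w v) (RtoC ((v - w) * Dd b c m n X0 X0))) <= 2 * Bd.
Proof.
  intros Hb Hc Hm Hn HX H. apply avg_bound; [lia|]. intros i j Hi Hj.
  destruct (H i j Hi Hj) as [H1 H2]. unfold Vint.
  rewrite (Dd_stable b c m n (M + i) (M + j) X0) by lia.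
  match goal with |- Cmod (Cminus (Cplus ?a (Cmult ?x (Cminus ?y ?z))) ?a) <= _ =>
    replace (Cminus (Cplus a (Cmult x (Cminus y z))) a) with (Cmult x (Cminus y z)) by ring end.
  rewrite Cmod_mult, Cmod_opp, Cmod_Ci, Rmult_1_l.
  eapply Rle_trans; [apply Cmod_triangle|]. rewrite Cmod_opp, !Cmod_mult, !Cmod_cis. lra.
Qed.

(** * Isolating the diagonal on a dyadic window *)

Definition wgt (b c n k l : nat) : R :=
  / INR n * Rpower (INR k) (- ((1 + INR b) / 2)) * Rpower (INR l) (- ((1 + INR c) / 2)).

(* The diagonal [m = n k^b l^c] of the expanded mean value. *)
Definition DgR (b c : nat) (theta : R) (N : nat) (T : R) : R :=
  rsum (fun n => rsum (fun k => rsum (fun l =>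
    wgt b c n k l * Rmax 0 (T - tm theta (qn b c n k l))) N) N) N.

Lemma wmn_wgt b c n k l : (1 <= n)%nat -> (1 <= k)%nat -> (1 <= l)%nat ->
  wmn (qn b c n k l) n * wmn k l = wgt b c n k l.
Proof.
  intros Hn Hk Hl. unfold wmn, wgt.
  assert (0 < INR n) by (apply lt_0_INR; lia). assert (0 < INR k) by (apply lt_0_INR; lia).
  assert (0 < INR l) by (apply lt_0_INR; lia).
  assert (0 < INR (qn b c n k l)) by (apply lt_0_INR, qn_pos; auto).
  rewrite <- !Rpower_half by auto. replace (/ INR n) with (Rpower (INR n) (- (1)))
    by (rewrite Rpower_Ropp, Rpower_1; auto). unfold Rpower. rewrite ln_qn by auto. rewrite <- !exp_plus.
  f_equal. field.
Qed.

(** The sum over [m] collapses to [m = q]. As [n <= q], the later entry time is that of [q], and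
    [v - max(u, t_q)] is the difference of [max(0, v - t_q)] and [max(0, u - t_q)]; for [q > X0]
    both of these vanish. *)
Lemma diag_sum b c theta X0 u v : (1 <= b)%nat -> (1 <= c)%nat -> 0 < theta -> 0 < v -> u <= v ->
  X0 = nat_floor (XT theta v) ->
  rsum (fun m => rsum (fun n => wmn m n * ((v - low theta u m n) * Dd b c m n X0 X0)) X0) X0
  = DgR b c theta X0 v - DgR b c theta X0 u.
Proof.
  intros Hb Hc Hth Hv Huv HX0. rewrite rsum_swap. unfold DgR. rewrite <- rsum_minus.
  apply rsum_ext. intros n Hn. rewrite <- rsum_minus.
  rewrite (rsum_ext _ (fun m => rsum (fun k => rsum (fun l =>
    wmn m n * (v - low theta u m n) * (wmn k l * (if Nat.eqb (qn b c n k l) m then 1 else 0))) X0) X0)).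
  2:{ intros m Hm. unfold Dd. rewrite <- rsum_scal, <- rsum_scal. apply rsum_ext. intros k Hk.
      rewrite <- rsum_scal, <- rsum_scal. apply rsum_ext. intros l Hl. ring. }
  rewrite rsum_swap. apply rsum_ext. intros k Hk. rewrite rsum_swap, <- rsum_minus.
  apply rsum_ext. intros l Hl.
  set (q := qn b c n k l).
  assert (Hq1 : (1 <= q)%nat) by (apply qn_pos; lia).
  destruct (qn_ge b c n k l Hb Hc ltac:(lia) ltac:(lia) ltac:(lia)) as [Hqn _]. fold q in Hqn.
  destruct (le_lt_dec q X0) as [Hq|Hq].
  - rewrite (rsum_single _ X0 q); [|lia|].
    + rewrite Nat.eqb_refl. rewrite <- (wmn_wgt b c n k l) by lia. fold q.
      assert (Htv : tm theta q <= v) by (apply tm_floor; auto; subst X0; auto).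
      assert (Htn : tm theta n <= tm theta q) by (apply tm_mono; auto; lia).
      unfold low. rewrite (Rmax_left (tm theta q) (tm theta n)) by auto.
      rewrite (Rmax_right 0 (v - tm theta q)) by lra.
      destruct (Rle_dec u (tm theta q)).
      * rewrite (Rmax_right u), (Rmax_left 0) by lra. ring.
      * rewrite (Rmax_left u), (Rmax_right 0) by lra. ring.
    + intros m Hm Hne. destruct (Nat.eqb_spec q m); [lia|ring].
  - rewrite (rsum_ext _ (fun _ => 0)), rsum_zero.
    + assert (Htv : v < tm theta q).
      { apply Rnot_le_lt. intros H. apply tm_floor in H; auto. lia. }
      rewrite !Rmax_left by lra. ring.
    + intros m Hm. destruct (Nat.eqb_spec q m); [lia|ring].
Qed.

Lemma DgR_stable b c theta N T : (1 <= b)%nat -> (1 <= c)%nat -> 0 < theta -> 0 < T ->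
  (nat_floor (XT theta T) <= N)%nat -> DgR b c theta N T = DgR b c theta (nat_floor (XT theta T)) T.
Proof.
  intros Hb Hc Hth HT HN. set (X0 := nat_floor (XT theta T)) in *.
  assert (Z : forall n k l, (1 <= n)%nat -> (1 <= k)%nat -> (1 <= l)%nat ->
     (X0 < n \/ X0 < k \/ X0 < l)%nat -> wgt b c n k l * Rmax 0 (T - tm theta (qn b c n k l)) = 0).
  { intros n k l Hn Hk Hl H. destruct (qn_ge b c n k l Hb Hc Hn Hk Hl) as [H1 [H2 H3]].
    assert (Htv : T < tm theta (qn b c n k l)).
    { apply Rnot_le_lt. intros Hle. apply tm_floor in Hle; auto; [|lia]. unfold X0 in H. lia. }
    rewrite Rmax_left by lra. ring. }
  unfold DgR. rewrite (rsum_trunc _ X0 N); auto.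
  - apply rsum_ext. intros n Hn. rewrite (rsum_trunc _ X0 N); auto.
    + apply rsum_ext. intros k Hk. apply rsum_trunc; auto. intros l Hl. apply Z; lia.
    + intros k Hk. rewrite (rsum_ext _ (fun _ => 0)), rsum_zero; auto. intros; apply Z; lia.
  - intros n Hn. rewrite (rsum_ext _ (fun _ => 0)), rsum_zero; auto. intros k Hk.
    rewrite (rsum_ext _ (fun _ => 0)), rsum_zero; auto. intros; apply Z; lia.
Qed.

Lemma sum_wmn X0 : rsum (fun m => rsum (fun n => wmn m n) X0) X0 <= 4 * INR X0.
Proof.
  unfold wmn. rewrite rsum_prod. assert (H := sum_inv_sqrt X0).
  assert (H0 : 0 <= rsum (fun k => / sqrt (INR k)) X0).
  { apply rsum_nonneg. intros. apply Rlt_le, Rinv_0_lt_compat, sqrt_INR_pos; lia. }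
  assert (SS : sqrt (INR X0) * sqrt (INR X0) = INR X0) by (apply sqrt_sqrt, pos_INR).
  apply Rle_trans with ((2 * sqrt (INR X0)) * (2 * sqrt (INR X0))); [apply Rmult_le_compat; auto|lra].
Qed.

Lemma wmn_nonneg m n : (1 <= m)%nat -> (1 <= n)%nat -> 0 <= wmn m n.
Proof.
  intros. unfold wmn. apply Rmult_le_pos; apply Rlt_le, Rinv_0_lt_compat, sqrt_INR_pos; lia.
Qed.

Lemma stepsum_diff theta X0 g h t e : 0 <= e -> Cmod (Cminus (g t) (h t)) <= e ->
  Cmod (Cminus (stepsum theta X0 g t) (stepsum theta X0 h t)) <= 4 * INR X0 * e.
Proof.
  intros He H. unfold stepsum. rewrite <- csum_minus.
  apply Rle_trans with (rsum (fun m => rsum (fun n => wmn m n * e) X0) X0).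
  - apply csum_bound. intros m Hm. rewrite <- csum_minus. apply csum_bound. intros n Hn.
    assert (W := wmn_nonneg m n ltac:(lia) ltac:(lia)).
    destruct (Rle_dec (Rmax (tm theta m) (tm theta n)) t).
    + match goal with |- Cmod ?z <= _ => replace z with
        (Cmult (RtoC (wmn m n)) (Cmult (cis (t * (ln (INR n) - ln (INR m)))) (Cminus (g t) (h t))))
        by ring end.
      rewrite Cmod_Rmult, Cmod_mult, Cmod_cis, Rmult_1_l by auto. apply Rmult_le_compat_l; auto.
    + replace (Cminus (RtoC 0) (RtoC 0)) with (RtoC 0) by ring. rewrite Cmod_0.
      apply Rmult_le_pos; auto.
  - rewrite (rsum_ext _ (fun m => rsum (fun n => wmn m n) X0 * e)) by (intros; apply rsum_scal_r).
    rewrite rsum_scal_r. apply Rmult_le_compat_r; auto. apply sum_wmn.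
Qed.

Lemma Zavg_bound M tau A : (1 <= M)%nat ->
  (forall N, (N <= 2 * M)%nat -> Cmod (csum (zterm tau) N) <= A) -> Cmod (Zavg M tau) <= A.
Proof.
  intros HM H. assert (M0 : 0 < INR M) by (apply lt_0_INR; lia).
  unfold Zavg. rewrite Cmod_Rmult by (apply Rlt_le, Rinv_0_lt_compat; auto).
  apply Rle_trans with (/ INR M * (INR M * A)).
  - apply Rmult_le_compat_l; [apply Rlt_le, Rinv_0_lt_compat; auto|].
    rewrite <- rsum_const. apply csum_bound. intros k Hk. apply H; lia.
  - apply Req_le. field. lra.
Qed.

Lemma Cmod_prod_diff (x y x' y' : C) e A B : Cmod (Cminus x x') <= e -> Cmod (Cminus y y') <= e ->
  Cmod x' <= A -> Cmod y' <= A -> 0 <= e -> e <= B -> 0 <= A ->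
  Cmod (Cminus (Cmult x y) (Cmult x' y')) <= e * (2 * A + B).
Proof.
  intros H1 H2 H3 H4 He HB HA.
  replace (Cminus (Cmult x y) (Cmult x' y')) with
    (Cplus (Cmult (Cminus x x') (Cplus (Cminus y y') y')) (Cmult x' (Cminus y y'))) by ring.
  eapply Rle_trans; [apply Cmod_triangle|]. rewrite !Cmod_mult.
  assert (H5 : Cmod (Cplus (Cminus y y') y') <= B + A).
  { eapply Rle_trans; [apply Cmod_triangle|]. lra. }
  assert (Cmod (Cminus x x') * Cmod (Cplus (Cminus y y') y') <= e * (B + A))
    by (apply Rmult_le_compat; auto using Cmod_ge_0).
  assert (Cmod x' * Cmod (Cminus y y') <= A * e)
    by (apply Rmult_le_compat; auto using Cmod_ge_0).
  lra.
Qed.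

Lemma XT_ge1 theta T : 0 < theta -> 2 * PI <= T -> 1 <= XT theta T.
Proof.
  intros Hth HT. assert (P := PI_RGT_0). unfold XT. apply Rpower_ge1; [|lra].
  apply Rle_div_r; lra.
Qed.

Lemma XT_le_sqrt theta T : 0 < theta <= 1 / 2 -> 2 * PI <= T -> XT theta T <= sqrt T.
Proof.
  intros Hth HT. assert (P := PI2_3_2). unfold PI2 in P. unfold XT.
  apply Rle_trans with (Rpower (T / (2 * PI)) (/ 2)).
  - apply Rle_Rpower; [apply Rle_div_r; lra|lra].
  - assert (0 < T / (2 * PI)) by (apply Rdiv_lt_0_compat; lra).
    rewrite Rpower_sqrt by auto. apply sqrt_le_1; try lra.
    apply Rle_div_l; [lra|]. nra.
Qed.

Lemma sqrt_le_self x : 1 <= x -> sqrt x <= x.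
Proof.
  intros. rewrite <- (sqrt_pow2 x) at 2 by lra. apply sqrt_le_1; nra.
Qed.

Lemma sqrt_ge1 x : 1 <= x -> 1 <= sqrt x.
Proof. intros. rewrite <- sqrt_1 at 1. apply sqrt_le_1; lra. Qed.

(** On [[T/2, T]] the heights [b t] and [c t] lie between [T] and [D T], so one length [M] of order
    [T^2] serves both zeta factors. Three errors arise: replacing zeta by its averages, the
    off-diagonal terms outside the box, and those inside; each is [O(X sqrt T)]. *)
Lemma window_estimate b c theta : (2 <= b)%nat -> (2 <= c)%nat -> 0 < theta <= 1 / 2 ->
  exists K, 0 < K /\ forall T I, 2 * PI <= T ->
  is_CInt (Mintegrand theta (INR b) (INR c)) (T / 2) T I ->
  Cmod (Cminus I (RtoC (DgR b c theta (nat_floor (XT theta T)) T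
                        - DgR b c theta (nat_floor (XT theta T)) (T / 2))))
  <= K * (XT theta T * sqrt T).
Proof.
  intros Hb Hc Hth.
  assert (B2 : 2 <= INR b) by (apply (le_INR 2); auto).
  assert (C2 : 2 <= INR c) by (apply (le_INR 2); auto).
  set (D := INR b * INR c). assert (HD : 4 <= D) by (unfold D; nra).
  set (a := 962 * D). set (E1 := 200 + 3000 * D).
  exists (4 * E1 * (2 * a + E1) + 144 + 8 * (4 * a ^ 2 + 16 * a)).
  assert (Ha : 0 < a) by (unfold a; lra). assert (HE1 : 0 < E1) by (unfold E1; lra).
  split; [nra|].
  intros T I HT HI.
  assert (P := PI2_3_2). unfold PI2 in P.
  set (X := XT theta T). assert (HX1 : 1 <= X) by (apply XT_ge1; lra).
  assert (HXT : X <= sqrt T) by (apply XT_le_sqrt; lra).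
  set (X0 := nat_floor X). destruct (floor_bounds X HX1) as [[F1 F2] _]. fold X0 in F1, F2.
  set (Q := sqrt (sqrt T)).
  assert (HQ1 : 1 <= Q) by (apply sqrt_ge1; lra).
  assert (HQQ : Q * Q = sqrt T) by (apply sqrt_sqrt; lra).
  (* Between [(D T)^2] and twice that, so [tau^2 <= M <= (2 D)^2 tau^2] for [tau = b t] and
     [tau = c t] alike; [Zavg_zeta] is therefore applied with [2 D]. *)
  set (M := S (nat_floor ((D * T) ^ 2))).
  assert (HM : (D * T) ^ 2 <= INR M <= 2 * (D * T) ^ 2).
  { destruct (nat_floor_spec ((D * T) ^ 2)) as [G1 G2]; [apply pow2_ge_0|].
    unfold M. rewrite S_INR. assert (1 <= D * T) by nra. nra. }
  set (A := a * Q).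
  assert (HA : forall (d : nat), (2 <= d)%nat -> INR d <= D -> forall t, T / 2 <= t <= T ->
     forall N, (N <= 2 * M)%nat -> Cmod (csum (zterm (INR d * t)) N) <= A).
  { intros d Hd HdD t Ht N HN. assert (2 <= INR d) by (apply (le_INR 2); auto).
    assert (Htau : T <= INR d * t) by nra.
    eapply Rle_trans; [apply zterm_partial; nra|].
    assert (H1 : sqrt (sqrt (INR d * t)) <= D * Q).
    { unfold Q. rewrite <- (sqrt_pow2 D) by lra. rewrite <- sqrt_mult by (try apply sqrt_pos; nra).
      apply sqrt_le_1; try apply sqrt_pos.
      - apply Rmult_le_pos; [nra|apply sqrt_pos].
      - rewrite <- (sqrt_pow2 (D ^ 2)) by nra. rewrite <- sqrt_mult by nra.
        assert (Hd2 : D <= D ^ 2) by nra. assert (Hd4 : D ^ 2 <= (D ^ 2) ^ 2) by nra.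
        apply sqrt_le_1; [nra|apply Rmult_le_pos; nra|]. apply Rmult_le_compat; lra. }
    assert (H2 : sqrt (INR N) <= 2 * (D * T)).
    { rewrite <- (sqrt_pow2 (2 * (D * T))) by nra. apply sqrt_le_1; [apply pos_INR|nra|].
      apply Rle_trans with (INR (2 * M)); [apply le_INR; auto|].
      rewrite mult_INR. change (INR 2) with 2. replace ((2 * (D * T)) ^ 2) with (4 * (D * T) ^ 2) by ring. lra. }
    assert (H3 : sqrt (INR N) / (INR d * t) <= 2 * D).
    { apply Rle_div_l; [nra|].
      assert (D * T <= D * (INR d * t)) by (apply Rmult_le_compat_l; lra). lra. }
    unfold A, a. assert (D <= D * Q) by nra. lra. }
  assert (HbD : INR b <= D) by (unfold D; nra). assert (HcD : INR c <= D) by (unfold D; nra).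
  assert (HZ : forall (d : nat), (2 <= d)%nat -> INR d <= D -> forall t, T / 2 <= t <= T ->
     Cmod (Cminus (zeta (1 / 2) (- (INR d * t))) (Zavg M (INR d * t))) <= E1 / T).
  { intros d Hd HdD t Ht. assert (2 <= INR d) by (apply (le_INR 2); auto).
    assert (Htau : T <= INR d * t) by nra.
    assert (Z1 : INR d * t <= D * T) by (apply Rmult_le_compat; lra).
    assert (Z2 : (INR d * t) ^ 2 <= (D * T) ^ 2) by (apply pow_incr; lra).
    assert (Z3 : T ^ 2 <= (INR d * t) ^ 2) by (apply pow_incr; lra).
    assert (Z4 : D ^ 2 * T ^ 2 <= D ^ 2 * (INR d * t) ^ 2) by (apply Rmult_le_compat_l; [apply pow2_ge_0|auto]).
    rewrite (Rpow_mult_distr D) in HM, Z2.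
    eapply Rle_trans; [apply (Zavg_zeta M (INR d * t) (2 * D)); try lra|].
    unfold E1. apply Rle_div_l; [nra|].
    replace ((200 + 3000 * D) / T * (INR d * t)) with ((200 + 3000 * D) * ((INR d * t) / T)) by (field; lra).
    assert (1 <= INR d * t / T) by (apply Rle_div_r; lra). nra. }
  assert (HA0 : 0 < A) by (unfold A; nra).
  assert (HMM : (1 <= M)%nat) by (unfold M; lia).
  assert (HE : 0 <= E1 / T <= E1).
  { split; [apply Rdiv_le_0_compat; lra|]. apply Rle_div_l; nra. }
  assert (Hdiff : forall t, T / 2 <= t <= T ->
     Cmod (Cminus (zz b c t) (ZZ b c M t)) <= E1 / T * (2 * A + E1)).
  { intros t Ht. unfold zz, ZZ. apply Cmod_prod_diff; [apply HZ; auto|apply HZ; auto| | |lra|lra|lra].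
    - apply Zavg_bound; [exact HMM|]. intros N HN. apply (HA b); auto.
    - apply Zavg_bound; [exact HMM|]. intros N HN. apply (HA c); auto. }
  assert (Htm : forall m, (1 <= m <= X0)%nat -> tm theta m <= T).
  { intros m Hm. apply tm_floor; try lra; [lia|]. unfold X0, X in Hm; lia. }
  assert (HlowT : forall m n, (1 <= m <= X0)%nat -> (1 <= n <= X0)%nat ->
     T / 2 <= low theta (T / 2) m n <= T).
  { intros m n Hm Hn. unfold low. split; [apply Rmax_l|].
    apply Rmax_lub; [lra|]. apply Rmax_lub; apply Htm; auto. }
  set (It := csum (fun m => csum (fun n => Cmult (RtoC (wmn m n))
     (Javg b c M m n (low theta (T / 2) m n) T)) X0) X0).
  assert (HIt : is_CInt (stepsum theta X0 (ZZ b c M)) (T / 2) T It).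
  { apply stepsum_CInt; [lra|auto|]. intros m n Hm Hn.
    apply ZZ_CInt; try lia. apply HlowT; auto. }
  assert (HI2 : is_CInt (stepsum theta X0 (zz b c)) (T / 2) T I).
  { apply (is_CInt_ext (Mintegrand theta (INR b) (INR c))); [lra| |auto].
    intros t Ht. apply Mint_expand; lra. }
  (* Pointwise the replacement costs about [X * (1/T) * T^{1/4}]; over an interval of length [T/2]
     this is [X T^{1/4}]. *)
  assert (R1 : Cmod (Cminus I It) <= 4 * E1 * (2 * a + E1) * (X * sqrt T)).
  { eapply Rle_trans; [apply (is_CInt_bound (fun t => Cminus (stepsum theta X0 (zz b c) t) (stepsum theta X0 (ZZ b c M) t)) (T / 2) T (Cminus I It) (4 * INR X0 * (E1 / T * (2 * A + E1))));
      [lra|apply (is_CInt_minus _ _ _ _ _ _ HI2 HIt)|]|].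
    - intros t Ht. apply stepsum_diff; [|apply Hdiff; lra]. apply Rmult_le_pos; lra.
    - replace (2 * (4 * INR X0 * (E1 / T * (2 * A + E1))) * (T - T / 2)) with
        (4 * E1 * (INR X0 * (2 * A + E1))) by (field; lra).
      replace (4 * E1 * (2 * a + E1) * (X * sqrt T)) with (4 * E1 * (X * ((2 * a + E1) * sqrt T))) by ring.
      apply Rmult_le_compat_l; [lra|]. apply Rmult_le_compat; try lra.
      unfold A. assert (Q <= sqrt T) by nra.
      assert (a * Q <= a * sqrt T) by (apply Rmult_le_compat_l; lra).
      assert (E1 * 1 <= E1 * sqrt T) by (apply Rmult_le_compat_l; lra). lra. }
  assert (HDT : 2 * T <= (D * T) ^ 2).
  { assert (2 * T <= D * T) by nra. assert (D * T * 1 <= D * T * (D * T)) by (apply Rmult_le_compat_l; lra). lra. }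
  (* Side of the near box: the floor gives [(PP + 1)^2 >= 2 X], as [Off_bound] requires. *)
  set (PP := nat_floor (sqrt (2 * X))).
  assert (S2X : sqrt (2 * X) * sqrt (2 * X) = 2 * X) by (apply sqrt_sqrt; lra).
  destruct (nat_floor_spec (sqrt (2 * X)) (sqrt_pos _)) as [P1 P2]. fold PP in P1, P2.
  assert (HPP : 2 * X <= INR (PP + 1) ^ 2).
  { rewrite plus_INR. simpl INR. assert (0 <= sqrt (2 * X)) by apply sqrt_pos. nra. }
  assert (HXle : sqrt (2 * X) <= 2 * X) by (apply sqrt_le_self; lra).
  assert (HTs : sqrt T <= T) by (apply sqrt_le_self; lra).
  assert (HPM : (PP <= M)%nat).
  { apply INR_le. lra. }
  assert (HX0M : (X0 <= M)%nat).
  { apply INR_le. lra. }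
  assert (HsP : sqrt (INR PP) <= 2 * Q).
  { apply Rle_trans with (sqrt (4 * sqrt T)).
    - apply sqrt_le_1; [apply pos_INR|lra|].
       lra.
    - rewrite sqrt_mult by lra. replace 4 with (2 ^ 2) by ring. rewrite sqrt_pow2 by lra. fold Q. lra. }
  set (far := 4 * A ^ 2 + 8 * sqrt (INR PP) * A).
  assert (Hfar0 : 0 <= far).
  { unfold far. assert (0 <= sqrt (INR PP) * A) by (apply Rmult_le_pos; [apply sqrt_pos|lra]). nra. }
  assert (HJ : forall m n, (1 <= m <= X0)%nat -> (1 <= n <= X0)%nat ->
     Cmod (Cminus (Javg b c M m n (low theta (T / 2) m n) T)
       (RtoC ((T - low theta (T / 2) m n) * Dd b c m n X0 X0))) <= 2 * (near b c m n PP + far)).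
  { intros m n Hm Hn. apply Javg_est; try lia. intros i j Hi Hj.
    assert (G : forall u, T / 2 <= u <= T ->
      Cmod (Off b c m n (M + i) (M + j) u) <= near b c m n PP + far).
    { intros u Hu. unfold far.
      eapply Rle_trans; [apply (Off_bound b c m n (M + i) (M + j) PP u X A); auto; try lia; try lra|].
      - eapply Rle_trans; [apply le_INR; apply Hm|]. auto.
      - intros; apply (HA b); auto; lia.
      - intros; apply (HA c); auto; lia.
      - lra. }
    split; apply G; [apply HlowT; auto|lra]. }
  assert (R2 : Cmod (Cminus It (RtoC (DgR b c theta X0 T - DgR b c theta X0 (T / 2)))) <=
    (144 + 8 * (4 * a ^ 2 + 16 * a)) * (X * sqrt T)).
  { rewrite <- (diag_sum b c theta X0 (T / 2) T) by (auto; lia || lra).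
    unfold It. rewrite <- csum_RtoC, <- csum_minus.
    apply Rle_trans with (rsum (fun m => rsum (fun n => 2 * (wmn m n * near b c m n PP) + wmn m n * (2 * far)) X0) X0).
    - apply csum_bound. intros m Hm. rewrite <- csum_RtoC, <- csum_minus. apply csum_bound. intros n Hn.
      rewrite (RtoC_mult (wmn m n)).
      match goal with |- Cmod (Cminus (Cmult ?w ?x) (Cmult ?w ?y)) <= _ =>
        replace (Cminus (Cmult w x) (Cmult w y)) with (Cmult w (Cminus x y)) by ring end.
      assert (W := wmn_nonneg m n ltac:(lia) ltac:(lia)).
      rewrite Cmod_Rmult by auto. specialize (HJ m n Hm Hn).
      apply Rle_trans with (wmn m n * (2 * (near b c m n PP + far))); [apply Rmult_le_compat_l; auto|lra].
    - rewrite (rsum_ext _ (fun m => 2 * rsum (fun n => wmn m n * near b c m n PP) X0 + rsum (fun n => wmn m n) X0 * (2 * far)))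
        by (intros; rewrite rsum_plus, rsum_scal, rsum_scal_r; auto).
      rewrite rsum_plus, rsum_scal, rsum_scal_r.
      assert (N1 := near_total b c X0 PP). fold (wmn) in N1.
      assert (N2 := sum_wmn X0).
      (* [near_total] is of order [X^{3/2} PP], that is [X^2], and [X <= sqrt T] finishes. *)
      assert (N3 : rsum (fun m => rsum (fun n => wmn m n * near b c m n PP) X0) X0 <= 72 * (X * sqrt T)).
      { eapply Rle_trans; [exact N1|].
        assert (s1 : sqrt (INR PP) * sqrt (INR PP) = INR PP) by (apply sqrt_sqrt, pos_INR).
        assert (s2 : sqrt (INR X0) <= INR X0) by (apply sqrt_le_self; lra).
        assert (s3 : sqrt X * sqrt X = X) by (apply sqrt_sqrt; lra).
        assert (s4 : sqrt (INR X0) <= sqrt X) by (apply sqrt_le_1; lra).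
        assert (s5 : sqrt (2 * X) <= 3 / 2 * sqrt X).
        { apply Rsqr_incr_0_var; [unfold Rsqr; nra|]. generalize (sqrt_pos X); lra. }
        replace (2 * sqrt (INR PP) * (2 * sqrt (INR PP))) with (4 * (sqrt (INR PP) * sqrt (INR PP))) by ring.
        rewrite s1.
        assert (0 <= sqrt (INR X0)) by apply sqrt_pos.
        apply Rle_trans with ((6 * X) * (2 * sqrt X) * (4 * (3 / 2 * sqrt X))).
        - apply Rmult_le_compat; [apply Rmult_le_pos; lra|generalize (pos_INR PP); lra| |lra].
          apply Rmult_le_compat; lra.
        - replace (6 * X * (2 * sqrt X) * (4 * (3 / 2 * sqrt X))) with (72 * X * (sqrt X * sqrt X)) by field.
          rewrite s3, Rmult_assoc. apply Rmult_le_compat_l; [lra|]. apply Rmult_le_compat_l; lra. }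
      (* Both [A] and [sqrt PP] are at most of order [Q = T^{1/4}], and [Q^2 = sqrt T]. *)
      assert (N4 : far <= (4 * a ^ 2 + 16 * a) * sqrt T).
      { unfold far, A. rewrite <- HQQ. assert (0 <= a * Q) by nra.
        nra. }
      assert (rsum (fun m => rsum (fun n => wmn m n) X0) X0 * (2 * far) <=
         (4 * X) * (2 * ((4 * a ^ 2 + 16 * a) * sqrt T))).
      { apply Rmult_le_compat; try lra. apply rsum_nonneg. intros; apply rsum_nonneg; intros.
        apply wmn_nonneg; lia. }
      lra. }
  eapply Rle_trans; [apply (Cmod_tri3 I It)|]. lra.
Qed.

(** * From windows to the whole interval *)

Definition Dg (b c : nat) (theta T : R) : R := DgR b c theta (nat_floor (XT theta T)) T.

Lemma XT_mono theta s t : 0 < theta -> 0 < s <= t -> XT theta s <= XT theta t.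
Proof.
  intros Hth H. assert (P := PI_RGT_0). unfold XT. apply Rpower_le_base; [|lra]. split.
  - apply Rdiv_lt_0_compat; lra.
  - apply Rmult_le_compat_r; [apply Rlt_le, Rinv_0_lt_compat|]; lra.
Qed.

Lemma floor_XT_small theta t : 0 < theta -> 0 < t < 2 * PI -> nat_floor (XT theta t) = 0%nat.
Proof.
  intros Hth Ht.
  assert (H : XT theta t < 1).
  { unfold XT. rewrite <- (Rpower_1_l theta). apply Rlt_Rpower_l; auto. split.
    - apply Rdiv_lt_0_compat; lra.
    - apply Rlt_div_l; lra. }
  assert ((nat_floor (XT theta t) < 1)%nat); [|lia].
  apply nat_floor_lt; [apply Rlt_le, XT_pos|simpl; auto].
Qed.

Lemma M11_CInt b c theta T : 0 < theta -> 0 < T ->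
  is_CInt (Mintegrand theta (INR b) (INR c)) 0 T (M11 theta (INR b) (INR c) T).
Proof.
  intros Hth HT. destruct (Mint_CInt theta b c 0 T) as [I [H1 H2]]; try lra.
  unfold M11. rewrite (is_RInt_unique _ _ _ _ H1), (is_RInt_unique _ _ _ _ H2). split; auto.
Qed.

(** Halving down to [T < 2 PI], where the Dirichlet polynomial and the diagonal are both empty. The
    constant reproduces itself, [K + 4 K * 0.71 <= 4 K], because [sqrt (T/2) <= 0.71 sqrt T]; no
    logarithm is lost in adding up the windows. *)
Lemma offdiag_bound b c theta : (2 <= b)%nat -> (2 <= c)%nat -> 0 < theta <= 1 / 2 ->
  exists K, 0 < K /\ forall T, 0 < T ->
  Cmod (Cminus (M11 theta (INR b) (INR c) T) (RtoC (Dg b c theta T))) <= K * (XT theta T * sqrt T).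
Proof.
  intros Hb Hc Hth. destruct (window_estimate b c theta Hb Hc Hth) as [K [HK HW]].
  exists (4 * K). split; [lra|].
  assert (G : forall n T, 0 < T < 2 * PI * 2 ^ n ->
    Cmod (Cminus (M11 theta (INR b) (INR c) T) (RtoC (Dg b c theta T)))
    <= 4 * K * (XT theta T * sqrt T)).
  { induction n as [|n IH]; intros T HT.
    - simpl in HT.
      assert (E1 : M11 theta (INR b) (INR c) T = RtoC 0).
      { apply (is_CInt_unique (Mintegrand theta (INR b) (INR c)) 0 T); [apply M11_CInt; lra|].
        apply (is_CInt_ext (fun _ => RtoC 0)); [lra| |apply is_CInt_zero].
        intros t Ht. rewrite (Mint_expand theta b c t t) by lra.
        rewrite floor_XT_small by lra. reflexivity. }
      assert (E2 : Dg b c theta T = 0).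
      { unfold Dg. rewrite floor_XT_small by lra. reflexivity. }
      rewrite E1, E2. replace (Cminus (RtoC 0) (RtoC 0)) with (RtoC 0) by ring. rewrite Cmod_0.
      assert (X := XT_pos theta T). assert (S := sqrt_pos T).
      apply Rmult_le_pos; [lra|]. apply Rmult_le_pos; lra.
    - destruct (Rle_dec (2 * PI) T) as [H2|H2].
      2:{ apply IH. split; [lra|]. assert (1 <= 2 ^ n) by (apply pow_R1_Rle; lra). nra. }
      rewrite <- tech_pow_Rmult in HT.
      assert (HIH := IH (T / 2) ltac:(lra)).
      set (I := Cminus (M11 theta (INR b) (INR c) T) (M11 theta (INR b) (INR c) (T / 2))).
      assert (HI : is_CInt (Mintegrand theta (INR b) (INR c)) (T / 2) T I).
      { destruct (Mint_CInt theta b c (T / 2) T) as [J HJ]; try lra.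
        replace I with J; auto.
        assert (E : M11 theta (INR b) (INR c) T = Cplus (M11 theta (INR b) (INR c) (T / 2)) J).
        { apply (is_CInt_unique (Mintegrand theta (INR b) (INR c)) 0 T); [apply M11_CInt; lra|].
          apply is_CInt_Chasles with (T / 2); auto. apply M11_CInt; lra. }
        unfold I. rewrite E. ring. }
      assert (HWT := HW T I H2 HI).
      assert (HX := XT_mono theta (T / 2) T ltac:(lra) ltac:(lra)).
      (* The window yields the diagonal at [T/2] with the longer cut-off belonging to [T]; the extra
         terms vanish. *)
      assert (Est : DgR b c theta (nat_floor (XT theta T)) (T / 2) = Dg b c theta (T / 2)).
      { unfold Dg. apply DgR_stable; try lia; try lra.
        apply nat_floor_le; [apply Rlt_le, XT_pos|].
        eapply Rle_trans; [apply nat_floor_spec, Rlt_le, XT_pos|auto]. }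
      rewrite Est in HWT. fold (Dg b c theta T) in HWT.
      replace (Cminus (M11 theta (INR b) (INR c) T) (RtoC (Dg b c theta T))) with
        (Cplus (Cminus I (RtoC (Dg b c theta T - Dg b c theta (T / 2))))
          (Cminus (M11 theta (INR b) (INR c) (T / 2)) (RtoC (Dg b c theta (T / 2))))).
      2:{ unfold I. rewrite RtoC_minus. ring. }
      eapply Rle_trans; [apply Cmod_triangle|].
      assert (X0 := XT_pos theta (T / 2)). assert (S := sqrt_pos (T / 2)).
      assert (HS : sqrt (T / 2) <= 71 / 100 * sqrt T) by (apply sqrt_half_gap; lra).
      assert (XT theta (T / 2) * sqrt (T / 2) <= XT theta T * (71 / 100 * sqrt T))
        by (apply Rmult_le_compat; lra).
      assert (0 <= XT theta T * sqrt T).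
      { apply Rmult_le_pos; [apply Rlt_le, XT_pos|apply sqrt_pos]. }
      nra. }
  intros T HT.
  assert (Hn : exists n : nat, T < 2 * PI * 2 ^ n).
  { set (n := S (nat_floor T)). exists n. destruct (nat_floor_spec T) as [_ F]; [lra|].
    assert (HB : INR n <= 2 ^ n).
    { clear. induction n as [|n IH]; [simpl; lra|]. rewrite S_INR, <- tech_pow_Rmult.
      assert (1 <= 2 ^ n) by (apply pow_R1_Rle; lra). lra. }
    unfold n in *. rewrite S_INR in HB. assert (Q := PI2_3_2). unfold PI2 in Q.
     nra. }
  destruct Hn as [n Hn]. apply (G n). lra.
Qed.

(** * The hyperbola method *)

(* The abscissa at which a diagonal term is summed over [k]: the weight of [m = n k^b l^c] is
   [(m n k l)^{-1/2} = n^{-1} k^{-(1+b)/2} l^{-(1+c)/2}]. *)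
Definition al (b : nat) : R := (1 + INR b) / 2.

Definition wkl (b c k l : nat) : R := Rpower (INR k) (- al b) * Rpower (INR l) (- al c).

Definition kl (b c k l : nat) : R := INR k ^ b * INR l ^ c.

Definition stepR (x y : R) : R := if Rle_dec x y then 1 else 0.

Definition Hbox (b c N : nat) (x : R) : R :=
  rsum (fun k => rsum (fun l => wkl b c k l * stepR (kl b c k l) x) N) N.

(** Box form of the sum over [k^b l^c <= x]: that condition already forces [k, l <= x], so the box
    loses nothing. *)
Definition Hs (b c : nat) (x : R) : R := Hbox b c (nat_floor x) x.

Lemma kl_qn b c k l : kl b c k l = INR (qn b c 1 k l).
Proof. rewrite INR_qn. unfold kl. simpl. ring. Qed.

Lemma kl_ge b c k l : (1 <= b)%nat -> (1 <= c)%nat -> (1 <= k)%nat -> (1 <= l)%nat ->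
  1 <= kl b c k l /\ INR k <= kl b c k l /\ INR l <= kl b c k l.
Proof.
  intros. rewrite kl_qn. destruct (qn_ge b c 1 k l) as [H3 [H4 H5]]; auto.
  repeat split; [apply (le_INR 1)|apply le_INR|apply le_INR]; auto.
Qed.

Lemma stepR_0 x y : y < x -> stepR x y = 0.
Proof. intros. unfold stepR. destruct (Rle_dec x y); auto; lra. Qed.

Lemma stepR_1 x y : x <= y -> stepR x y = 1.
Proof. intros. unfold stepR. destruct (Rle_dec x y); auto; lra. Qed.

Lemma Hbox_stable b c N x : (1 <= b)%nat -> (1 <= c)%nat -> 0 <= x -> (nat_floor x <= N)%nat ->
  Hbox b c N x = Hs b c x.
Proof.
  intros Hb Hc Hx HN. unfold Hs, Hbox.
  assert (Z : forall k l, (1 <= k)%nat -> (1 <= l)%nat -> (nat_floor x < k \/ nat_floor x < l)%nat ->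
     wkl b c k l * stepR (kl b c k l) x = 0).
  { intros k l Hk Hl H. destruct (kl_ge b c k l Hb Hc Hk Hl) as [H1 [H2 H3]].
    rewrite stepR_0; [ring|]. destruct H as [H|H]; apply nat_floor_lt in H; lra. }
  rewrite (rsum_trunc _ (nat_floor x) N); auto.
  - apply rsum_ext. intros k Hk. apply rsum_trunc; auto. intros l Hl. apply Z; lia.
  - intros k Hk. rewrite (rsum_ext _ (fun _ => 0)), rsum_zero; auto. intros; apply Z; lia.
Qed.

Lemma Rpower_kl b c k l : (1 <= k)%nat -> (1 <= l)%nat ->
  ln (kl b c k l) = INR b * ln (INR k) + INR c * ln (INR l).
Proof.
  intros. rewrite kl_qn, ln_qn by lia. simpl. rewrite ln_1. ring.
Qed.

Lemma ln_le_iff x y : 0 < x -> 0 < y -> (x <= y <-> ln x <= ln y).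
Proof.
  intros Hx Hy. split; intros H; [apply ln_le; auto|].
  apply Rnot_lt_le. intros H2. apply ln_increasing in H2; auto. lra.
Qed.

(* [(x / k^b)^{1/c}]: the largest admissible [l] for a given [k]. *)
Definition Qk (b c : nat) (x : R) (k : nat) : R :=
  exp ((ln x - INR b * ln (INR k)) / INR c).

Lemma ln_Qk b c x k : ln (Qk b c x k) = (ln x - INR b * ln (INR k)) / INR c.
Proof. apply ln_exp. Qed.

(* The hyperbola method is split at [k <= kap], [l <= kap], where [kap^{b+c} = x]. *)
Definition kap (b c : nat) (x : R) : R := exp (ln x / (INR b + INR c)).

Lemma kl_le_Qk b c x k l : (1 <= c)%nat -> (1 <= k)%nat -> (1 <= l)%nat -> 0 < x ->
  (kl b c k l <= x <-> INR l <= Qk b c x k).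
Proof.
  intros Hc Hk Hl Hx. assert (C0 : 0 < INR c) by (apply lt_0_INR; lia).
  assert (L0 : 0 < INR l) by (apply lt_0_INR; lia).
  assert (KL : 0 < kl b c k l).
  { unfold kl. apply Rmult_lt_0_compat; apply pow_lt; apply lt_0_INR; lia. }
  rewrite (ln_le_iff (kl b c k l) x) by auto.
  rewrite (ln_le_iff (INR l)) by (auto; apply exp_pos).
  rewrite Rpower_kl, ln_Qk by auto. split; intros H.
  - apply Rle_div_r; lra.
  - apply Rle_div_r in H; lra.
Qed.

Lemma rsum_stepR f N Q : 0 <= Q -> (nat_floor Q <= N)%nat ->
  rsum (fun l => f l * stepR (INR l) Q) N = rsum f (nat_floor Q).
Proof.
  intros HQ HN. rewrite (rsum_trunc _ (nat_floor Q) N); auto.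
  - apply rsum_ext. intros l Hl. rewrite stepR_1; [ring|]. apply nat_floor_le; auto; lia.
  - intros l Hl. rewrite stepR_0; [ring|]. apply nat_floor_lt; auto; lia.
Qed.

Lemma stepR_iff x y x' y' : (x <= y <-> x' <= y') -> stepR x y = stepR x' y'.
Proof. intros H. unfold stepR. destruct (Rle_dec x y), (Rle_dec x' y'); tauto. Qed.

(** Since [kap^{b+c} = x], the condition [k <= kap] gives [x / k^b >= kap^c]: the inner range is
    never shorter than [kap]. *)
Lemma Qk_bounds b c x k : (1 <= b)%nat -> (1 <= c)%nat -> 1 <= x -> (1 <= k)%nat ->
  INR k <= kap b c x -> kap b c x <= Qk b c x k <= x.
Proof.
  intros Hb Hc Hx Hk Hkk.
  assert (B1 : 1 <= INR b) by (apply (le_INR 1); auto).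
  assert (C1 : 1 <= INR c) by (apply (le_INR 1); auto).
  assert (K1 := INR_ge1 k Hk). assert (Lk := ln_nonneg _ K1). assert (Lx := ln_nonneg _ Hx).
  apply ln_le in Hkk; [|lra]. unfold kap in Hkk. rewrite ln_exp in Hkk.
  apply Rle_div_r in Hkk; [|lra].
  split.
  - apply (ln_le_iff _ _ (exp_pos _) (exp_pos _)). unfold kap, Qk. rewrite !ln_exp.
    apply (Rle_div_r (ln x / (INR b + INR c)) _ (INR c)); [lra|].
    assert (E : INR b * ln (INR k) <= INR b * (ln x / (INR b + INR c))).
    { apply Rmult_le_compat_l; [lra|]. apply Rle_div_r; lra. }
    apply Rle_trans with (ln x - INR b * (ln x / (INR b + INR c))); [|lra].
    apply Req_le. field. lra.
  - apply (ln_le_iff _ _ (exp_pos _)); [lra|]. rewrite ln_exp. apply Rle_div_l; [lra|].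
     nra.
Qed.

Lemma kl_sym b c k l : kl b c k l = kl c b l k.
Proof. unfold kl. ring. Qed.

Lemma wkl_sym b c k l : wkl b c k l = wkl c b l k.
Proof. unfold wkl. ring. Qed.

Lemma kap_sym b c x : kap b c x = kap c b x.
Proof. unfold kap. do 2 f_equal. ring. Qed.

Lemma kap_ge1 b c x : (1 <= b)%nat -> 1 <= x -> 1 <= kap b c x.
Proof.
  intros Hb Hx. assert (B1 : 1 <= INR b) by (apply (le_INR 1); auto).
  assert (C0 := pos_INR c). assert (L := ln_nonneg x Hx).
  unfold kap. rewrite <- exp_0. destruct (Req_dec (ln x) 0) as [->|Hn].
  - unfold Rdiv; rewrite Rmult_0_l; lra.
  - apply Rlt_le, exp_increasing. apply Rdiv_lt_0_compat; lra.
Qed.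

Lemma kap_le b c x : (1 <= b)%nat -> 1 <= x -> kap b c x <= x.
Proof.
  intros Hb Hx. assert (B1 : 1 <= INR b) by (apply (le_INR 1); auto).
  assert (C0 := pos_INR c). assert (L := ln_nonneg x Hx).
  apply (ln_le_iff _ _ (exp_pos _)); [lra|]. rewrite ln_exp. apply Rle_div_l; nra.
Qed.

(** Dirichlet's hyperbola method at the symmetric split point: pairs with both coordinates at most
    [kap] all satisfy [k^b l^c <= x] and are counted twice (claim [O]), and no pair with both above
    [kap] does (claim [Z]). *)
Lemma hyperbola b c x : (1 <= b)%nat -> (1 <= c)%nat -> 1 <= x ->
  Hs b c x =
  rsum (fun k => Rpower (INR k) (- al b) * psum (al c) (Qk b c x k)) (nat_floor (kap b c x))
  + rsum (fun l => Rpower (INR l) (- al c) * psum (al b) (Qk c b x l)) (nat_floor (kap b c x))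
  - psum (al b) (kap b c x) * psum (al c) (kap b c x).
Proof.
  intros Hb Hc Hx. set (N := nat_floor x). set (r := nat_floor (kap b c x)).
  assert (K1 := kap_ge1 b c x Hb Hx). assert (Kx := kap_le b c x Hb Hx).
  assert (B1 : 1 <= INR b) by (apply (le_INR 1); auto).
  assert (C1 : 1 <= INR c) by (apply (le_INR 1); auto).
  assert (Hr : (r <= N)%nat).
  { apply nat_floor_le; [lra|]. eapply Rle_trans; [apply nat_floor_spec; lra|auto]. }
  assert (G1 : forall k, (1 <= k <= r)%nat ->
    rsum (fun l => wkl b c k l * stepR (kl b c k l) x) N =
    Rpower (INR k) (- al b) * psum (al c) (Qk b c x k)).
  { intros k Hk. assert (Hkk : INR k <= kap b c x) by (apply nat_floor_le; [lra|lia]).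
    assert (Q := Qk_bounds b c x k Hb Hc Hx ltac:(lia) Hkk).
    unfold psum. rewrite <- (rsum_stepR _ N).
    - rewrite <- rsum_scal. apply rsum_ext. intros l Hl. unfold wkl.
      rewrite (stepR_iff _ _ (INR l) (Qk b c x k)); [ring|]. apply kl_le_Qk; lia || lra.
    - lra.
    - apply nat_floor_le; [lra|]. eapply Rle_trans; [apply nat_floor_spec; lra|]. lra. }
  assert (G2 : forall l, (1 <= l <= r)%nat ->
    rsum (fun k => wkl b c k l * stepR (kl b c k l) x) N =
    Rpower (INR l) (- al c) * psum (al b) (Qk c b x l)).
  { intros l Hl. rewrite kap_sym in *.
    assert (Hkk : INR l <= kap c b x) by (apply nat_floor_le; [lra|]; unfold r in Hl; rewrite kap_sym in Hl; lia).
    assert (Q := Qk_bounds c b x l Hc Hb Hx ltac:(lia) Hkk).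
    unfold psum. rewrite <- (rsum_stepR _ N).
    - rewrite <- rsum_scal. apply rsum_ext. intros k Hk. rewrite wkl_sym, kl_sym. unfold wkl.
      rewrite (stepR_iff _ _ (INR k) (Qk c b x l)); [ring|]. apply kl_le_Qk; lia || lra.
    - lra.
    - apply nat_floor_le; [lra|]. eapply Rle_trans; [apply nat_floor_spec; lra|]. lra. }
  rewrite <- (rsum_ext _ _ r G1), <- (rsum_ext _ _ r G2).
  unfold Hs, Hbox. fold N.
  assert (Hlog : (INR b + INR c) * ln (kap b c x) = ln x) by (unfold kap; rewrite ln_exp; field; lra).
  assert (Z : forall k l, (r < k)%nat -> (r < l)%nat -> stepR (kl b c k l) x = 0).
  { intros k l Hk Hl. apply nat_floor_lt in Hk; [|lra]. apply nat_floor_lt in Hl; [|lra].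
    apply stepR_0. apply ln_lt_inv; [lra| |].
    - unfold kl. apply Rmult_lt_0_compat; apply pow_lt; lra.
    - assert (k <> 0)%nat by (intros ->; simpl in Hk; lra).
      assert (l <> 0)%nat by (intros ->; simpl in Hl; lra).
      rewrite Rpower_kl by lia. apply ln_increasing in Hk; [|lra]. apply ln_increasing in Hl; [|lra]. nra. }
  assert (O : forall k l, (1 <= k <= r)%nat -> (1 <= l <= r)%nat -> stepR (kl b c k l) x = 1).
  { intros k l Hk Hl. assert (Hk2 : INR k <= kap b c x) by (apply nat_floor_le; [lra|lia]).
    assert (Hl2 : INR l <= kap b c x) by (apply nat_floor_le; [lra|lia]).
    assert (k1 := INR_ge1 k ltac:(lia)). assert (l1 := INR_ge1 l ltac:(lia)).
    apply stepR_1. apply ln_le_iff; [|lra|].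
    - unfold kl. apply Rmult_lt_0_compat; apply pow_lt; lra.
    - rewrite Rpower_kl by lia. apply ln_le in Hk2; [|lra]. apply ln_le in Hl2; [|lra]. nra. }
  assert (E : psum (al b) (kap b c x) * psum (al c) (kap b c x) =
    rsum (fun k => rsum (fun l => wkl b c k l * stepR (kl b c k l) x) r) r).
  { unfold psum. fold r. rewrite <- rsum_prod. apply rsum_ext. intros k Hk. apply rsum_ext. intros l Hl.
    rewrite O by auto. unfold wkl. ring. }
  rewrite E. rewrite (rsum_swap (fun l k => wkl b c k l * stepR (kl b c k l) x)).
  replace N with (r + (N - r))%nat by lia. rewrite (rsum_app _ r (N - r)).
  rewrite (rsum_app (fun j => rsum (fun i => wkl b c j i * stepR (kl b c j i) x) r) r (N - r)).
  rewrite (rsum_ext (fun k => rsum (fun l => wkl b c (r + k) l * stepR (kl b c (r + k) l) x) (r + (N - r)))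
    (fun k => rsum (fun l => wkl b c (r + k) l * stepR (kl b c (r + k) l) x) r)); [ring|].
  intros k Hk. apply rsum_trunc; [lia|]. intros l Hl. rewrite Z by lia. ring.
Qed.

(** The exponent left on [k] when the main term [Q^{1 - al c}] of the inner sum,
    [Q = (x / k^b)^{1/c}], is inserted: [k^{-al b} Q^{1 - al c} = x^{sx c} k^{-alp b c}]. *)
Definition alp (b c : nat) : R := 1 / 2 + INR b / (2 * INR c).

(** The secondary exponent [(1 - al c) / c]; for [c >= 2] it lies strictly between [-1/2] and 0. *)
Definition sx (c : nat) : R := - (1 / 2) + 1 / (2 * INR c).

(** The error of the inner sum is [k^{-al b} Q^{-al c} = x^{-1/2} Q^{-1/2} k^{-1/2}]. As [Q >= kap]
    on this range and the [k^{-1/2}] add up to at most [2 sqrt kap], the total is [O(x^{-1/2})]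
    without loss. *)
Lemma hyper_half b c : (2 <= b)%nat -> (2 <= c)%nat -> exists K, 0 < K /\ forall x, 1 <= x ->
  Rabs (rsum (fun k => Rpower (INR k) (- al b) * psum (al c) (Qk b c x k)) (nat_floor (kap b c x))
    - zetaR (al c) * psum (al b) (kap b c x)
    - Rpower x (sx c) / (1 - al c) * psum (alp b c) (kap b c x)) <= K * Rpower x (- (1 / 2)).
Proof.
  intros Hb Hc.
  assert (C1 : 2 <= INR c) by (apply (le_INR 2); auto).
  destruct (psum_asymp (al c)) as [K [HK HKa]]; try (unfold al; lra).
  exists (K * 2). split; [lra|]. intros x Hx. set (r := nat_floor (kap b c x)).
  assert (K1 := kap_ge1 b c x ltac:(lia) Hx).
  unfold psum at 2 3. fold r. rewrite <- !rsum_scal, <- !rsum_minus.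
  apply Rle_trans with (rsum (fun k => K * (Rpower x (- (1 / 2)) * / sqrt (kap b c x) * / sqrt (INR k))) r).
  - apply rsum_bound. intros k Hk.
    assert (Hkk : INR k <= kap b c x) by (apply nat_floor_le; [lra|unfold r in Hk; lia]).
    destruct (Qk_bounds b c x k ltac:(lia) ltac:(lia) Hx ltac:(lia) Hkk) as [Q1 Q2].
    assert (k1 := INR_ge1 k ltac:(lia)).
    assert (E1 : Rpower (INR k) (- al b) * Rpower (Qk b c x k) (1 - al c) =
       Rpower x (sx c) * Rpower (INR k) (- alp b c)).
    { unfold Rpower. rewrite ln_Qk, <- !exp_plus. f_equal. unfold al, sx, alp. field. lra. }
    replace (Rpower (INR k) (- al b) * psum (al c) (Qk b c x k)
       - zetaR (al c) * Rpower (INR k) (- al b)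
       - Rpower x (sx c) / (1 - al c) * Rpower (INR k) (- alp b c)) with
      (Rpower (INR k) (- al b) * (psum (al c) (Qk b c x k)
        - Rpower (Qk b c x k) (1 - al c) / (1 - al c) - zetaR (al c))).
    2:{ unfold Rdiv. rewrite (Rmult_comm (Rpower x (sx c))), Rmult_assoc, <- E1. ring. }
    rewrite Rabs_mult, (Rabs_pos_eq (Rpower _ _)) by (apply Rlt_le, Rpower_pos).
    eapply Rle_trans.
    { apply Rmult_le_compat_l; [apply Rlt_le, Rpower_pos|]. apply HKa. lra. }
    rewrite (Rmult_comm _ (K * _)), Rmult_assoc. apply Rmult_le_compat_l; [lra|].
    assert (E2 : Rpower (Qk b c x k) (- al c) * Rpower (INR k) (- al b) =
       Rpower x (- (1 / 2)) * / sqrt (Qk b c x k) * / sqrt (INR k)).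
    { rewrite <- !Rpower_half by (lra || apply exp_pos). unfold Rpower.
      rewrite ln_Qk, <- !exp_plus. f_equal. unfold al. field. lra. }
    rewrite E2. apply Rmult_le_compat_r; [apply Rlt_le, Rinv_0_lt_compat, sqrt_lt_R0; lra|].
    apply Rmult_le_compat_l; [apply Rlt_le, Rpower_pos|].
    apply Rinv_le_contravar; [apply sqrt_lt_R0; lra|]. apply sqrt_le_1; lra.
  - rewrite rsum_scal, rsum_scal, (Rmult_assoc K 2). apply Rmult_le_compat_l; [lra|].
    assert (S := sum_inv_sqrt r). assert (Sk : 0 < sqrt (kap b c x)) by (apply sqrt_lt_R0; lra).
    assert (Sr : sqrt (INR r) <= sqrt (kap b c x)).
    { apply sqrt_le_1; [apply pos_INR|lra|]. apply nat_floor_spec; lra. }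
    rewrite (Rmult_comm 2), Rmult_assoc. apply Rmult_le_compat_l; [apply Rlt_le, Rpower_pos|].
    apply Rmult_le_reg_l with (sqrt (kap b c x)); auto.
    rewrite <- Rmult_assoc, Rinv_r by lra. lra.
Qed.

(** The right side is symmetric in [b] and [c]: at the split point the boundary terms of both halves
    have the same size, so they can cancel. *)
Lemma alp_sym_prod b c x : (1 <= b)%nat -> (1 <= c)%nat ->
  Rpower x (sx c) * Rpower (kap b c x) (1 - alp b c) = Rpower x (- (1 / 2)) * kap b c x.
Proof.
  intros Hb Hc.
  assert (B1 : 1 <= INR b) by (apply (le_INR 1); auto).
  assert (C1 : 1 <= INR c) by (apply (le_INR 1); auto).
  unfold Rpower, kap. rewrite ln_exp, <- !exp_plus. f_equal. unfold sx, alp. field. lra.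
Qed.

Lemma kap_err b c x : (1 <= b)%nat -> (1 <= c)%nat ->
  Rpower x (sx c) * Rpower (kap b c x) (- alp b c) = Rpower x (- (1 / 2)).
Proof.
  intros Hb Hc.
  assert (B1 : 1 <= INR b) by (apply (le_INR 1); auto).
  assert (C1 : 1 <= INR c) by (apply (le_INR 1); auto).
  unfold Rpower, kap. rewrite ln_exp, <- !exp_plus. f_equal. unfold sx, alp. field. lra.
Qed.

(** Each factor is a multiple of [kap^{1 - al}] up to [O(kap^{-al})]. With [kap^{b+c} = x] the
    product of the main terms has size [x^{-1/2} kap], and the cross terms have size at most
    [x^{-1/2}]. *)
Lemma hyper_prod b c : (2 <= b)%nat -> (2 <= c)%nat -> exists K, 0 < K /\ forall x, 1 <= x ->
  Rabs ((psum (al b) (kap b c x) - zetaR (al b)) * (psum (al c) (kap b c x) - zetaR (al c))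
    - Rpower x (- (1 / 2)) * kap b c x / ((1 - al b) * (1 - al c))) <= K * Rpower x (- (1 / 2)).
Proof.
  intros Hb Hc.
  assert (B1 : 2 <= INR b) by (apply (le_INR 2); auto).
  assert (C1 : 2 <= INR c) by (apply (le_INR 2); auto).
  destruct (psum_asymp (al b)) as [K1 [HK1 HKa1]]; try (unfold al; lra).
  destruct (psum_asymp (al c)) as [K2 [HK2 HKa2]]; try (unfold al; lra).
  exists (2 * K2 + 2 * K1 + K1 * K2). split; [nra|].
  intros x Hx.
  assert (K1' := kap_ge1 b c x ltac:(lia) Hx). set (y := kap b c x) in *.
  specialize (HKa1 y K1'). specialize (HKa2 y K1').
  set (u := psum (al b) y - Rpower y (1 - al b) / (1 - al b) - zetaR (al b)) in *.
  set (v := psum (al c) y - Rpower y (1 - al c) / (1 - al c) - zetaR (al c)) in *.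
  replace (psum (al b) y - zetaR (al b)) with (u + Rpower y (1 - al b) / (1 - al b)) by (unfold u; ring).
  replace (psum (al c) y - zetaR (al c)) with (v + Rpower y (1 - al c) / (1 - al c)) by (unfold v; ring).
  assert (E0 : Rpower y (1 - al b) * Rpower y (1 - al c) = Rpower x (- (1 / 2)) * y).
  { unfold y, Rpower, kap. rewrite !ln_exp, <- !exp_plus. f_equal. unfold al. field. lra. }
  assert (E1 : Rpower y (1 - al b) * Rpower y (- al c) = Rpower x (- (1 / 2))).
  { unfold y, Rpower, kap. rewrite !ln_exp, <- !exp_plus. f_equal. unfold al. field. lra. }
  assert (E2 : Rpower y (- al b) * Rpower y (1 - al c) = Rpower x (- (1 / 2))).
  { unfold y, Rpower, kap. rewrite !ln_exp, <- !exp_plus. f_equal. unfold al. field. lra. }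
  assert (E3 : Rpower y (- al b) * Rpower y (- al c) <= Rpower x (- (1 / 2))).
  { rewrite <- E1. apply Rmult_le_compat_r; [apply Rlt_le, Rpower_pos|]. apply Rle_Rpower; lra. }
  rewrite <- E0.
  replace ((u + Rpower y (1 - al b) / (1 - al b)) * (v + Rpower y (1 - al c) / (1 - al c))
    - Rpower y (1 - al b) * Rpower y (1 - al c) / ((1 - al b) * (1 - al c))) with
    (u * v + u * (Rpower y (1 - al c) / (1 - al c)) + v * (Rpower y (1 - al b) / (1 - al b))).
  2:{ field. unfold al. lra. }
  assert (I : forall d, 2 <= INR d -> forall p, 0 < p -> Rabs (p / (1 - al d)) <= 2 * p).
  { intros d Hd p Hp. unfold Rdiv. rewrite Rabs_mult, (Rabs_pos_eq p), Rabs_inv, Rabs_left by (unfold al; lra).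
    rewrite Rmult_comm. apply Rmult_le_compat_r; [lra|].
    replace 2 with (/ (1 / 2)) by field. apply Rinv_le_contravar; unfold al; lra. }
  assert (I1 := I b B1 (Rpower y (1 - al b)) (Rpower_pos _ _)).
  assert (I2 := I c C1 (Rpower y (1 - al c)) (Rpower_pos _ _)).
  eapply Rle_trans; [apply Rabs_triang|]. eapply Rle_trans; [apply Rplus_le_compat_r, Rabs_triang|].
  rewrite !Rabs_mult.
  assert (T1 : Rabs u * Rabs v <= (K1 * Rpower y (- al b)) * (K2 * Rpower y (- al c)))
    by (apply Rmult_le_compat; auto using Rabs_pos).
  assert (T2 : Rabs u * Rabs (Rpower y (1 - al c) / (1 - al c)) <= (K1 * Rpower y (- al b)) * (2 * Rpower y (1 - al c)))
    by (apply Rmult_le_compat; auto using Rabs_pos).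
  assert (T3 : Rabs v * Rabs (Rpower y (1 - al b) / (1 - al b)) <= (K2 * Rpower y (- al c)) * (2 * Rpower y (1 - al b)))
    by (apply Rmult_le_compat; auto using Rabs_pos).
  replace ((K1 * Rpower y (- al b)) * (K2 * Rpower y (- al c))) with (K1 * K2 * (Rpower y (- al b) * Rpower y (- al c))) in T1 by ring.
  replace ((K1 * Rpower y (- al b)) * (2 * Rpower y (1 - al c))) with (2 * K1 * (Rpower y (- al b) * Rpower y (1 - al c))) in T2 by ring.
  replace ((K2 * Rpower y (- al c)) * (2 * Rpower y (1 - al b))) with (2 * K2 * (Rpower y (1 - al b) * Rpower y (- al c))) in T3 by ring.
  rewrite E2 in T2. rewrite E1 in T3.
  assert (K1 * K2 * (Rpower y (- al b) * Rpower y (- al c)) <= K1 * K2 * Rpower x (- (1 / 2))).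
  { apply Rmult_le_compat_l; [nra|auto]. }
  lra.
Qed.

(** With [u, v] the sums up to [kap] and [Zb, Zc] the zeta values, the pieces combine through [u Zc
    + v Zb - u v = Zb Zc - (u - Zb)(v - Zc)]: the constant appears at once and the correction is the
    product treated in [hyper_prod]. *)
Lemma hyper b c : (2 <= b)%nat -> (2 <= c)%nat -> exists K, 0 < K /\ forall x, 1 <= x ->
  Rabs (Hs b c x - zetaR (al b) * zetaR (al c)
    - Rpower x (sx c) / (1 - al c) * psum (alp b c) (kap b c x)
    - Rpower x (sx b) / (1 - al b) * psum (alp c b) (kap b c x)
    + Rpower x (- (1 / 2)) * kap b c x / ((1 - al b) * (1 - al c))) <= K * Rpower x (- (1 / 2)).
Proof.
  intros Hb Hc.
  destruct (hyper_half b c Hb Hc) as [K1 [P1 H1]].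
  destruct (hyper_half c b Hc Hb) as [K2 [P2 H2]].
  destruct (hyper_prod b c Hb Hc) as [K3 [P3 H3]].
  exists (K1 + K2 + K3). split; [lra|]. intros x Hx.
  specialize (H1 x Hx). specialize (H2 x Hx). specialize (H3 x Hx).
  rewrite (kap_sym c b) in H2.
  rewrite (hyperbola b c x) by (lia || lra).
  match type of H1 with Rabs ?a <= _ => match type of H2 with Rabs ?b <= _ => match type of H3 with Rabs ?c <= _ =>
    match goal with |- Rabs ?e <= _ => replace e with (a + b - c) by ring end end end end.
  unfold Rminus at 1. eapply Rle_trans; [apply Rabs_triang|]. rewrite Rabs_Ropp.
  eapply Rle_trans; [apply Rplus_le_compat_r, Rabs_triang|]. lra.
Qed.

(* The secondary terms of the counting sum [Hs b c x] for [b <> c] ... *)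
Definition Rgen (b c : nat) (x : R) : R :=
  zetaR (alp b c) / (1 - al c) * Rpower x (sx c) + zetaR (alp c b) / (1 - al b) * Rpower x (sx b).

(** Expanding the sums up to [kap] leaves boundary terms of size [x^{-1/2} kap], too large for the
    error; they cancel by the rational identity [S]. Since [b <> c], neither [alp b c] nor [alp c b]
    is 1, so [psum_asymp] applies to both. *)
Lemma Hs_gen b c : (2 <= b)%nat -> (2 <= c)%nat -> b <> c -> exists K, 0 < K /\ forall x, 1 <= x ->
  Rabs (Hs b c x - zetaR (al b) * zetaR (al c) - Rgen b c x) <= K * Rpower x (- (1 / 2)).
Proof.
  intros Hb Hc Hbc.
  assert (B1 : 2 <= INR b) by (apply (le_INR 2); auto).
  assert (C1 : 2 <= INR c) by (apply (le_INR 2); auto).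
  assert (Hn : INR b <> INR c) by (intros H; apply Hbc, INR_eq; auto).
  destruct (hyper b c Hb Hc) as [K [P H]].
  assert (A1 : 0 < alp b c).
  { unfold alp. assert (0 < INR b / (2 * INR c)) by (apply Rdiv_lt_0_compat; lra). lra. }
  assert (A2 : 0 < alp c b).
  { unfold alp. assert (0 < INR c / (2 * INR b)) by (apply Rdiv_lt_0_compat; lra). lra. }
  assert (N1 : alp b c <> 1).
  { unfold alp. intros E. apply Hn. assert (E2 : INR b / (2 * INR c) = 1 / 2) by lra.
    apply Rmult_eq_reg_r with (/ (2 * INR c)); [|apply Rinv_neq_0_compat; lra].
    unfold Rdiv in E2. rewrite E2. field. lra. }
  assert (N2 : alp c b <> 1).
  { unfold alp. intros E. apply Hn. assert (E2 : INR c / (2 * INR b) = 1 / 2) by lra.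
    symmetry. apply Rmult_eq_reg_r with (/ (2 * INR b)); [|apply Rinv_neq_0_compat; lra].
    unfold Rdiv in E2. rewrite E2. field. lra. }
  destruct (psum_asymp (alp b c) A1 N1) as [K1 [P1 H1]].
  destruct (psum_asymp (alp c b) A2 N2) as [K2 [P2 H2]].
  exists (K + 2 * K1 + 2 * K2). split; [lra|]. intros x Hx. specialize (H x Hx).
  assert (Kx := kap_ge1 b c x ltac:(lia) Hx).
  specialize (H1 _ Kx). specialize (H2 _ Kx).
  assert (Q1 := alp_sym_prod b c x ltac:(lia) ltac:(lia)).
  assert (Q2 := alp_sym_prod c b x ltac:(lia) ltac:(lia)). rewrite (kap_sym c b) in Q2.
  assert (R1 := kap_err b c x ltac:(lia) ltac:(lia)).
  assert (R2 := kap_err c b x ltac:(lia) ltac:(lia)). rewrite (kap_sym c b) in R2.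
  set (y := kap b c x) in *.
  set (u := psum (alp b c) y - Rpower y (1 - alp b c) / (1 - alp b c) - zetaR (alp b c)) in *.
  set (v := psum (alp c b) y - Rpower y (1 - alp c b) / (1 - alp c b) - zetaR (alp c b)) in *.
  set (w := Hs b c x - zetaR (al b) * zetaR (al c)
    - Rpower x (sx c) / (1 - al c) * psum (alp b c) y
    - Rpower x (sx b) / (1 - al b) * psum (alp c b) y
    + Rpower x (- (1 / 2)) * y / ((1 - al b) * (1 - al c))) in *.
  assert (S : 1 / ((1 - al c) * (1 - alp b c)) + 1 / ((1 - al b) * (1 - alp c b))
     - 1 / ((1 - al b) * (1 - al c)) = 0).
  { unfold al, alp. field. repeat split; lra. }
  assert (E : Hs b c x - zetaR (al b) * zetaR (al c) - Rgen b c x =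
    w + (Rpower x (sx c) * / (1 - al c)) * u + (Rpower x (sx b) * / (1 - al b)) * v).
  { unfold w, Rgen.
    replace (psum (alp b c) y) with (u + Rpower y (1 - alp b c) / (1 - alp b c) + zetaR (alp b c)) by (unfold u; ring).
    replace (psum (alp c b) y) with (v + Rpower y (1 - alp c b) / (1 - alp c b) + zetaR (alp c b)) by (unfold v; ring).
    match goal with |- ?lhs = ?rhs => replace rhs with (lhs - (Rpower x (sx c) * Rpower y (1 - alp b c) / ((1 - al c) * (1 - alp b c))
       + Rpower x (sx b) * Rpower y (1 - alp c b) / ((1 - al b) * (1 - alp c b))
       - Rpower x (- (1 / 2)) * y / ((1 - al b) * (1 - al c)))) end.
    - rewrite Q1, Q2.
      replace (Rpower x (- (1 / 2)) * y / ((1 - al c) * (1 - alp b c)) + Rpower x (- (1 / 2)) * y / ((1 - al b) * (1 - alp c b))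
        - Rpower x (- (1 / 2)) * y / ((1 - al b) * (1 - al c))) with
        (Rpower x (- (1 / 2)) * y * (1 / ((1 - al c) * (1 - alp b c)) + 1 / ((1 - al b) * (1 - alp c b))
     - 1 / ((1 - al b) * (1 - al c)))) by (unfold Rdiv; ring).
      rewrite S. ring.
    - field. unfold al. repeat split; lra. }
  rewrite E.
  assert (I : forall d, 2 <= INR d -> forall p z, 0 < p -> Rabs (p * / (1 - al d) * z) <= 2 * p * Rabs z).
  { intros d Hd p z Hp. rewrite !Rabs_mult, (Rabs_pos_eq p), Rabs_inv, Rabs_left by (unfold al; lra).
    apply Rmult_le_compat_r; [apply Rabs_pos|]. rewrite Rmult_comm. apply Rmult_le_compat_r; [lra|].
    replace 2 with (/ (1 / 2)) by field. apply Rinv_le_contravar; unfold al; lra. }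
  assert (I1 := I c C1 (Rpower x (sx c)) u (Rpower_pos _ _)).
  assert (I2 := I b B1 (Rpower x (sx b)) v (Rpower_pos _ _)).
  assert (J1 : 2 * Rpower x (sx c) * Rabs u <= 2 * Rpower x (sx c) * (K1 * Rpower y (- alp b c))).
  { apply Rmult_le_compat_l; auto. assert (Z := Rpower_pos x (sx c)). lra. }
  assert (J2 : 2 * Rpower x (sx b) * Rabs v <= 2 * Rpower x (sx b) * (K2 * Rpower y (- alp c b))).
  { apply Rmult_le_compat_l; auto. assert (Z := Rpower_pos x (sx b)). lra. }
  replace (2 * Rpower x (sx c) * (K1 * Rpower y (- alp b c))) with (2 * K1 * (Rpower x (sx c) * Rpower y (- alp b c))) in J1 by ring.
  replace (2 * Rpower x (sx b) * (K2 * Rpower y (- alp c b))) with (2 * K2 * (Rpower x (sx b) * Rpower y (- alp c b))) in J2 by ring.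
  rewrite R1 in J1. rewrite R2 in J2.
  eapply Rle_trans; [apply Rabs_triang|]. eapply Rle_trans; [apply Rplus_le_compat_r, Rabs_triang|]. lra.
Qed.

(* ... and for [b = c], where the two powers of [x] coincide and produce a logarithm. *)
Definition Rdbl (b : nat) (x : R) : R :=
  / (INR b * (1 - al b)) * (Rpower x (sx b) * ln x)
  + (2 * euler_gamma / (1 - al b) - / (1 - al b) ^ 2) * Rpower x (sx b).

Lemma psum_1 x : 1 <= x -> psum 1 x = hsum x.
Proof.
  intros Hx. unfold psum, hsum. apply rsum_ext. intros k Hk.
  rewrite Rpower_Ropp, Rpower_1; auto. apply lt_0_INR; lia.
Qed.

(** Now [alp b b = 1]: the sum up to [kap] is harmonic, and [ln kap = ln x / (2 b)] brings in the
    logarithm. The boundary term [x^{-1/2} kap] equals [x^{sx b}] and joins the secondary term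
    instead of cancelling. *)
Lemma Hs_eq b : (2 <= b)%nat -> exists K, 0 < K /\ forall x, 1 <= x ->
  Rabs (Hs b b x - zetaR (al b) * zetaR (al b) - Rdbl b x) <= K * Rpower x (- (1 / 2)).
Proof.
  intros Hb.
  assert (B1 : 2 <= INR b) by (apply (le_INR 2); auto).
  destruct (hyper b b Hb Hb) as [K [P H]].
  destruct hsum_asymp as [K1 [P1 H1]].
  exists (K + 4 * K1). split; [lra|]. intros x Hx. specialize (H x Hx).
  assert (Kx := kap_ge1 b b x ltac:(lia) Hx). specialize (H1 _ Kx).
  assert (A1 : alp b b = 1) by (unfold alp; field; lra).
  rewrite A1, psum_1 in H by auto.
  assert (Ly : ln (kap b b x) = ln x / (2 * INR b)) by (unfold kap; rewrite ln_exp; f_equal; ring).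
  assert (Q : Rpower x (- (1 / 2)) * kap b b x = Rpower x (sx b)).
  { unfold Rpower, kap. rewrite <- exp_plus. f_equal. unfold sx. field. lra. }
  assert (Q2 : Rpower x (sx b) * / kap b b x = Rpower x (- (1 / 2))).
  { rewrite <- Q. field. lra. }
  set (y := kap b b x) in *.
  set (w := Hs b b x - zetaR (al b) * zetaR (al b)
    - Rpower x (sx b) / (1 - al b) * hsum y - Rpower x (sx b) / (1 - al b) * hsum y
    + Rpower x (- (1 / 2)) * y / ((1 - al b) * (1 - al b))) in *.
  set (u := hsum y - ln y - euler_gamma) in *.
  assert (E : Hs b b x - zetaR (al b) * zetaR (al b) - Rdbl b x =
    w + (2 * (Rpower x (sx b) * / (1 - al b))) * u).
  { unfold w, Rdbl. replace (hsum y) with (u + ln y + euler_gamma) by (unfold u; ring).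
    rewrite Ly, Q. field. unfold al. lra. }
  rewrite E.
  assert (I1 : Rabs (2 * (Rpower x (sx b) * / (1 - al b)) * u) <= 4 * Rpower x (sx b) * Rabs u).
  { assert (Z := Rpower_pos x (sx b)).
    rewrite !Rabs_mult, (Rabs_pos_eq 2), (Rabs_pos_eq (Rpower _ _)), Rabs_inv, Rabs_left by (unfold al; lra).
    apply Rmult_le_compat_r; [apply Rabs_pos|].
    assert (/ - (1 - al b) <= 2).
    { replace 2 with (/ (1 / 2)) by field. apply Rinv_le_contravar; unfold al; lra. }
    nra. }
  assert (J1 : 4 * Rpower x (sx b) * Rabs u <= 4 * Rpower x (sx b) * (K1 * / y)).
  { apply Rmult_le_compat_l; auto. assert (Z := Rpower_pos x (sx b)). lra. }
  replace (4 * Rpower x (sx b) * (K1 * / y)) with (4 * K1 * (Rpower x (sx b) * / y)) in J1 by ring.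
  rewrite Q2 in J1. eapply Rle_trans; [apply Rabs_triang|]. lra.
Qed.

(** * The diagonal *)

(** The sum over [n] produced by the diagonal, since [n^{-1} (X/n)^{-q} = X^{-q} n^{q-1}]. *)
Definition sig (q y : R) : R := rsum (fun n => Rpower (INR n) (q - 1)) (nat_floor y).

Lemma pow_mvt q x y : 1 <= q -> 0 < x <= y ->
  q * Rpower x (q - 1) * (y - x) <= Rpower y q - Rpower x q <= q * Rpower y (q - 1) * (y - x).
Proof.
  intros Hq Hx. destruct (Req_dec x y) as [->|Hn]; [lra|].
  destruct (mvt_le (fun t => Rpower t q) (fun t => q * Rpower t (q - 1)) x y) as [c [Hc E]];
    [lra|intros; apply Rpower_derive; lra|].
  rewrite E.
  assert (Rpower x (q - 1) <= Rpower c (q - 1)) by (apply Rpower_le_base; lra).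
  assert (Rpower c (q - 1) <= Rpower y (q - 1)) by (apply Rpower_le_base; lra).
  split; (apply Rmult_le_compat_r; [lra|]; apply Rmult_le_compat_l; lra).
Qed.

Lemma sig_nat q N : 1 <= q -> (1 <= N)%nat ->
  Rpower (INR N) q <= q * rsum (fun n => Rpower (INR n) (q - 1)) N <= Rpower (INR N + 1) q.
Proof.
  intros Hq HN. induction N as [|N IH]; [lia|].
  destruct N as [|N].
  - cbn [rsum]. simpl INR. rewrite !Rpower_1_l.
    assert (H := pow_mvt q 1 (1 + 1) Hq ltac:(lra)). rewrite !Rpower_1_l in H. lra.
  - specialize (IH ltac:(lia)). set (M := S N) in *.
    cbn [rsum]. rewrite S_INR. assert (M1 := INR_ge1 M ltac:(lia)).
    assert (H1 := pow_mvt q (INR M) (INR M + 1) Hq ltac:(lra)).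
    assert (H2 := pow_mvt q (INR M + 1) (INR M + 1 + 1) Hq ltac:(lra)).
    lra.
Qed.

Lemma sig_asymp q y : 1 <= q -> 1 <= y ->
  Rabs (q * sig q y - Rpower y q) <= q * Rpower 2 (q - 1) * Rpower y (q - 1).
Proof.
  intros Hq Hy. unfold sig. destruct (floor_bounds y Hy) as [[F1 F2] [F3 F4]].
  assert (H := sig_nat q (nat_floor y) Hq (nat_floor_ge1 y Hy)).
   set (N := INR (nat_floor y)) in *.
  assert (H1 := pow_mvt q N y Hq ltac:(lra)). assert (H2 := pow_mvt q y (N + 1) Hq ltac:(lra)).
  assert (P1 : Rpower (N + 1) (q - 1) <= Rpower 2 (q - 1) * Rpower y (q - 1)).
  { rewrite Rpower_mult_distr by lra. apply Rpower_le_base; lra. }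
  assert (P2 : 1 <= Rpower 2 (q - 1)) by (apply Rpower_ge1; lra).
  assert (P3 := Rpower_pos y (q - 1)).
  assert (T1 : q * Rpower y (q - 1) * (y - N) <= q * Rpower y (q - 1) * 1) by (apply Rmult_le_compat_l; nra).
  assert (T2 : q * Rpower (N + 1) (q - 1) * (N + 1 - y) <= q * Rpower (N + 1) (q - 1) * 1)
    by (apply Rmult_le_compat_l; nra).
  assert (T3 : q * Rpower (N + 1) (q - 1) <= q * (Rpower 2 (q - 1) * Rpower y (q - 1)))
    by (apply Rmult_le_compat_l; lra).
  assert (T4 : Rpower y (q - 1) * 1 <= Rpower y (q - 1) * Rpower 2 (q - 1)) by (apply Rmult_le_compat_l; lra).
  assert (T5 : q * Rpower y (q - 1) <= q * (Rpower 2 (q - 1) * Rpower y (q - 1))) by (apply Rmult_le_compat_l; lra).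
  apply Rabs_le. lra.
Qed.

(** * Step functions and the sum over [n] as an integral *)

Lemma is_RInt_rsum (f : nat -> R -> R) u v (I : nat -> R) n :
  (forall k, (1 <= k <= n)%nat -> is_RInt (f k) u v (I k)) ->
  is_RInt (fun t => rsum (fun k => f k t) n) u v (rsum I n).
Proof.
  induction n as [|n IH]; intros H.
  - simpl. assert (G := is_RInt_const (V := R_NormedModule) u v 0).
    unfold scal in G; simpl in G; unfold mult in G; simpl in G. rewrite Rmult_0_r in G. exact G.
  - cbn [rsum]. apply (is_RInt_plus (V := R_NormedModule)); [apply IH; intros|]; apply H; lia.
Qed.

Lemma is_RInt_zero u v : is_RInt (fun _ : R => 0) u v 0.
Proof. exact (is_RInt_rsum (fun _ _ => 0) u v (fun _ => 0) 0 ltac:(intros; lia)). Qed.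

Lemma is_RInt_ext_in (f g : R -> R) u v I : u <= v -> (forall x, u < x < v -> f x = g x) ->
  is_RInt f u v I -> is_RInt g u v I.
Proof.
  intros Huv H. apply is_RInt_ext. rewrite Rmin_left, Rmax_right by lra. auto.
Qed.

Lemma is_RInt_scalr a (f : R -> R) u v I : is_RInt f u v I -> is_RInt (fun x => a * f x) u v (a * I).
Proof. intros. apply (is_RInt_scal (V := R_NormedModule)); auto. Qed.

Lemma is_RInt_minusr (f g : R -> R) u v I J : is_RInt f u v I -> is_RInt g u v J ->
  is_RInt (fun x => f x - g x) u v (I - J).
Proof. intros. apply (is_RInt_minus (V := R_NormedModule)); auto. Qed.

Lemma is_RInt_right_step (f F : R -> R) j Z : 1 <= j -> 1 <= Z ->
  (forall x, 1 <= x -> is_derive F x (f x)) -> (forall x, 1 <= x -> continuous f x) ->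
  is_RInt (fun x => stepR j x * f x) 1 Z (stepR j Z * (F Z - F j)).
Proof.
  intros Hj HZ HF Hc. destruct (Rle_dec j Z) as [H|H].
  - rewrite (stepR_1 j Z) by auto. rewrite Rmult_1_l.
    replace (F Z - F j) with (plus 0 (minus (F Z) (F j))) by (unfold plus, minus, opp; simpl; unfold plus; simpl; ring).
    apply (is_RInt_Chasles (V := R_NormedModule)) with j.
    + apply (is_RInt_ext_in (fun _ => 0)); [lra| |apply is_RInt_zero].
      intros x Hx. rewrite stepR_0 by lra. ring.
    + apply (is_RInt_ext_in f); [lra| |].
      * intros x Hx. rewrite stepR_1 by lra. ring.
      * apply (is_RInt_derive (V := R_CompleteNormedModule)); rewrite Rmin_left, Rmax_right by lra;
          intros; [apply HF|apply Hc]; lra.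
  - rewrite (stepR_0 j Z) by lra. rewrite Rmult_0_l.
    apply (is_RInt_ext_in (fun _ => 0)); [lra| |apply is_RInt_zero].
    intros x Hx. rewrite stepR_0 by lra. ring.
Qed.

Lemma is_RInt_left_step (f : R -> R) w X I : 1 <= w <= X -> is_RInt f 1 w I ->
  is_RInt (fun x => stepR x w * f x) 1 X I.
Proof.
  intros Hw HI. replace I with (plus I 0) by (unfold plus; simpl; ring).
  apply (is_RInt_Chasles (V := R_NormedModule)) with w.
  - apply (is_RInt_ext_in f); [lra| |auto]. intros x Hx. rewrite stepR_1 by lra. ring.
  - apply (is_RInt_ext_in (fun _ => 0)); [lra| |apply is_RInt_zero].
    intros x Hx. rewrite stepR_0 by lra. ring.
Qed.

Lemma is_RInt_abs_le (f g : R -> R) u v I G : u <= v -> is_RInt f u v I -> is_RInt g u v G ->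
  (forall x, u < x < v -> Rabs (f x) <= g x) -> Rabs I <= G.
Proof.
  intros Huv HI HG H. apply Rabs_le. split.
  - apply (is_RInt_le (fun x => (- 1) * g x) f u v); auto.
    + replace (- G) with ((- 1) * G) by ring. apply is_RInt_scalr; auto.
    + intros x Hx. specialize (H x Hx). apply Rabs_le_between in H. lra.
  - apply (is_RInt_le f g u v); auto.
    intros x Hx. specialize (H x Hx). apply Rabs_le_between in H. lra.
Qed.

(* [\int_1^Z q x^{q-1} H(x) dx] and [\int_1^Y H(x) dx/x]. *)
Definition PH (b c : nat) (q Z : R) : R :=
  rsum (fun k => rsum (fun l => wkl b c k l *
    (stepR (kl b c k l) Z * (Rpower Z q - Rpower (kl b c k l) q))) (nat_floor Z)) (nat_floor Z).

Definition LH (b c : nat) (Y : R) : R :=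
  rsum (fun k => rsum (fun l => wkl b c k l *
    (stepR (kl b c k l) Y * (ln Y - ln (kl b c k l)))) (nat_floor Y)) (nat_floor Y).

(** [Hs] is a finite combination of unit steps at the points [k^b l^c], and each step is integrated
    from its jump with the primitive [F]. *)
Lemma Hs_RInt b c f F Z : (1 <= b)%nat -> (1 <= c)%nat -> 1 <= Z ->
  (forall x, 1 <= x -> is_derive F x (f x)) -> (forall x, 1 <= x -> continuous f x) ->
  is_RInt (fun x => f x * Hs b c x) 1 Z
    (rsum (fun k => rsum (fun l => wkl b c k l *
    (stepR (kl b c k l) Z * (F Z - F (kl b c k l)))) (nat_floor Z)) (nat_floor Z)).
Proof.
  intros Hb Hc HZ HF Hcont. set (N := nat_floor Z).
  apply (is_RInt_ext_in (fun x => rsum (fun k => rsum (fun l => wkl b c k l *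
    (stepR (kl b c k l) x * f x)) N) N)); auto.
  - intros x Hx. rewrite <- (Hbox_stable b c N x); auto; try lra.
    + unfold Hbox. rewrite <- rsum_scal. apply rsum_ext. intros k Hk.
      rewrite <- rsum_scal. apply rsum_ext. intros l Hl. ring.
    + apply nat_floor_le; [lra|]. destruct (nat_floor_spec x); lra.
  - apply is_RInt_rsum. intros k Hk. apply is_RInt_rsum. intros l Hl. apply is_RInt_scalr.
    apply is_RInt_right_step; auto. apply kl_ge; auto; lia.
Qed.

Lemma Rpower_cont a x : 0 < x -> continuous (fun y => Rpower y a) x.
Proof.
  intros Hx. apply (ex_derive_continuous (V := R_NormedModule)).
  eexists. apply Rpower_derive; auto.
Qed.

Lemma inv_cont x : 0 < x -> continuous (fun y => / y) x.
Proof.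
  intros Hx. apply (ex_derive_continuous (V := R_NormedModule)). auto_derive; lra.
Qed.

Lemma cont_scal a (f : R -> R) x : continuous f x -> continuous (fun y => a * f y) x.
Proof.
  intros. apply (continuous_mult (K := R_AbsRing)); auto. apply continuous_const.
Qed.

(** [PE] and [WE] are the integrals of the error [Hs - Kc - Rf] from 1 against the kernels
    [q x^{q-1}] and [1/x], in closed form; [RQ] and [RL] are primitives of [Rf] times these
    kernels. *)
Definition PE (b c : nat) (q Kc : R) (RQ : R -> R) (Z : R) : R :=
  PH b c q Z - Kc * (Rpower Z q - 1) - (RQ Z - RQ 1).

Definition WE (b c : nat) (Kc : R) (RL : R -> R) (Y : R) : R :=
  LH b c Y - Kc * ln Y - (RL Y - RL 1).

Lemma PE_RInt b c q Kc (Rf RQ : R -> R) Z : (1 <= b)%nat -> (1 <= c)%nat -> 1 <= Z ->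
  (forall x, 1 <= x -> is_derive RQ x (q * Rpower x (q - 1) * Rf x)) ->
  (forall x, 1 <= x -> continuous Rf x) ->
  is_RInt (fun x => q * Rpower x (q - 1) * (Hs b c x - Kc - Rf x)) 1 Z (PE b c q Kc RQ Z).
Proof.
  intros Hb Hc HZ HQ HR.
  assert (C1 : forall x, 1 <= x -> continuous (fun x => q * Rpower x (q - 1)) x).
  { intros. apply cont_scal, Rpower_cont; lra. }
  apply (is_RInt_ext_in (fun x => (q * Rpower x (q - 1)) * Hs b c x
     - Kc * (q * Rpower x (q - 1)) - q * Rpower x (q - 1) * Rf x)); auto.
  { intros; ring. }
  unfold PE. apply is_RInt_minusr; [apply is_RInt_minusr|].
  - apply (Hs_RInt b c (fun x => q * Rpower x (q - 1)) (fun x => Rpower x q)); auto.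
    intros; apply Rpower_derive; lra.
  - apply is_RInt_scalr. replace (Rpower Z q - 1) with (minus (Rpower Z q) (Rpower 1 q)).
    2:{ unfold minus, plus, opp; simpl. rewrite Rpower_1_l. ring. }
    apply (is_RInt_derive (V := R_CompleteNormedModule) (fun x => Rpower x q));
      rewrite Rmin_left, Rmax_right by lra; intros; [apply Rpower_derive; lra|apply C1; lra].
  - apply (is_RInt_derive (V := R_CompleteNormedModule) RQ);
      rewrite Rmin_left, Rmax_right by lra; intros; [apply HQ; lra|].
    apply (continuous_mult (K := R_AbsRing) (fun x => q * Rpower x (q - 1)) Rf); [apply C1|apply HR]; lra.
Qed.

Lemma WE_RInt b c Kc (Rf RL : R -> R) Y : (1 <= b)%nat -> (1 <= c)%nat -> 1 <= Y ->
  (forall x, 1 <= x -> is_derive RL x (/ x * Rf x)) ->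
  (forall x, 1 <= x -> continuous Rf x) ->
  is_RInt (fun x => / x * (Hs b c x - Kc - Rf x)) 1 Y (WE b c Kc RL Y).
Proof.
  intros Hb Hc HY HL HR.
  apply (is_RInt_ext_in (fun x => / x * Hs b c x - Kc * / x - / x * Rf x)); auto.
  { intros; ring. }
  unfold WE. apply is_RInt_minusr; [apply is_RInt_minusr|].
  - apply (Hs_RInt b c (fun x => / x) ln); auto.
    + intros; apply is_derive_ln; lra.
    + intros; apply inv_cont; lra.
  - apply is_RInt_scalr. replace (ln Y) with (minus (ln Y) (ln 1)).
    2:{ unfold minus, plus, opp; simpl. rewrite ln_1. ring. }
    apply (is_RInt_derive (V := R_CompleteNormedModule) ln);
      rewrite Rmin_left, Rmax_right by lra; intros; [apply is_derive_ln; lra|apply inv_cont; lra].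
  - apply (is_RInt_derive (V := R_CompleteNormedModule) RL);
      rewrite Rmin_left, Rmax_right by lra; intros; [apply HL; lra|].
    apply (continuous_mult (K := R_AbsRing) (fun x => / x) Rf); [apply inv_cont|apply HR]; lra.
Qed.

(* [Dg b c theta T = T * Vd b c q X] with [q = 1/theta] and [X = (T/2pi)^theta]. *)
Definition Vd (b c : nat) (q X : R) : R :=
  rsum (fun n => rsum (fun k => rsum (fun l =>
    wgt b c n k l * Rmax 0 (1 - Rpower (INR (qn b c n k l) / X) q))
    (nat_floor X)) (nat_floor X)) (nat_floor X).

(** With [Z = X/n] the weight [1 - (k^b l^c / Z)^q] is [Z^{-q}] times the integral of [q x^{q-1}]
    from [k^b l^c] to [Z], so each [n] contributes a weighted integral of [Hs]. *)
Lemma Vd_PH b c q X : (1 <= b)%nat -> (1 <= c)%nat -> 0 < q -> 1 <= X ->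
  Vd b c q X = rsum (fun n => / INR n * Rpower (X / INR n) (- q) * PH b c q (X / INR n)) (nat_floor X).
Proof.
  intros Hb Hc Hq HX. unfold Vd. set (N := nat_floor X). apply rsum_ext. intros n Hn.
  assert (n1 := INR_ge1 n ltac:(lia)).
  assert (HnX : INR n <= X) by (apply nat_floor_le; [lra|unfold N in Hn; lia]).
  assert (HZ : 1 <= X / INR n) by (apply Rle_div_r; lra).
  assert (HZX : X / INR n <= X) by (apply Rle_div_l; nra).
  set (Z := X / INR n) in *.
  assert (HNZ : (nat_floor Z <= N)%nat).
  { apply nat_floor_le; [lra|]. destruct (nat_floor_spec Z); lra. }
  unfold PH. rewrite <- rsum_scal.
  assert (T : forall k l, (1 <= k)%nat -> (1 <= l)%nat ->
    wgt b c n k l * Rmax 0 (1 - Rpower (INR (qn b c n k l) / X) q) =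
    / INR n * Rpower Z (- q) * (wkl b c k l * (stepR (kl b c k l) Z * (Rpower Z q - Rpower (kl b c k l) q)))).
  { intros k l Hk Hl. destruct (kl_ge b c k l Hb Hc Hk Hl) as [K1 _].
    assert (E : INR (qn b c n k l) / X = kl b c k l / Z).
    { rewrite INR_qn. unfold kl, Z. field. lra. }
    assert (E2 : Rpower (kl b c k l / Z) q = Rpower (kl b c k l) q * Rpower Z (- q)).
    { unfold Rpower. rewrite ln_div, <- exp_plus by lra. f_equal. ring. }
    assert (E3 : Rpower Z (- q) * Rpower Z q = 1).
    { rewrite <- Rpower_plus. replace (- q + q) with 0 by ring. apply Rpower_O; lra. }
    assert (E4 : 1 - Rpower (kl b c k l) q * Rpower Z (- q) =
      Rpower Z (- q) * (Rpower Z q - Rpower (kl b c k l) q)).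
    { rewrite Rmult_minus_distr_l, E3. ring. }
    rewrite E, E2, E4. unfold wgt, wkl, al.
    assert (Pm := Rpower_pos Z (- q)).
    destruct (Rle_dec (kl b c k l) Z) as [H|H].
    - rewrite stepR_1, Rmax_right; auto; [ring|].
      assert (Rpower (kl b c k l) q <= Rpower Z q) by (apply Rpower_le_base; lra).
      apply Rmult_le_pos; lra.
    - rewrite stepR_0, Rmax_left; [ring| |lra].
      assert (Rpower Z q <= Rpower (kl b c k l) q) by (apply Rpower_le_base; lra). nra. }
  rewrite (rsum_trunc _ (nat_floor Z) N); auto.
  - apply rsum_ext. intros k Hk. rewrite <- rsum_scal.
    rewrite (rsum_trunc _ (nat_floor Z) N); auto.
    + apply rsum_ext. intros l Hl. apply T; lia.
    + intros l Hl. rewrite T by lia. destruct (kl_ge b c k l Hb Hc ltac:(lia) ltac:(lia)) as [_ [_ K3]].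
      rewrite stepR_0; [ring|]. destruct Hl as [Hl _]. apply nat_floor_lt in Hl; lra.
  - intros k Hk. rewrite (rsum_ext _ (fun _ => 0)), rsum_zero; auto. intros l Hl. rewrite T by lia.
    destruct (kl_ge b c k l Hb Hc ltac:(lia) ltac:(lia)) as [_ [K2 _]].
    rewrite stepR_0; [ring|]. destruct Hk as [Hk _]. apply nat_floor_lt in Hk; lra.
Qed.

Lemma sqrt_inv_RInt X : 1 <= X -> is_RInt (fun x => Rpower x (- (1 / 2))) 1 X (2 * sqrt X - 2).
Proof.
  intros HX.
  replace (2 * sqrt X - 2) with (minus (2 * Rpower X (1 / 2)) (2 * Rpower 1 (1 / 2))).
  2:{ rewrite Rpower_1_l. replace (1 / 2) with (/ 2) by field. rewrite Rpower_sqrt by lra.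
      unfold minus, plus, opp; simpl. ring. }
  apply (is_RInt_derive (V := R_CompleteNormedModule) (fun x => 2 * Rpower x (1 / 2)));
    rewrite Rmin_left, Rmax_right by lra; intros x Hx; [|apply Rpower_cont; lra].
  evar_last; [apply is_derive_scal, Rpower_derive; lra|].
  replace (1 / 2 - 1) with (- (1 / 2)) by field. field.
Qed.

(* Interchanging sum and integral turns [sum_n n^{-1} (X/n)^{-q} \int_1^{X/n} q x^{q-1} e(x) dx] into
   [\int_1^X e(x) q x^{q-1} X^{-q} sig(X/x) dx], whose kernel is [1/x + O(1/X)]. *)
Lemma PE_sum b c q Kc (Rf RQ RL : R -> R) C0 : (1 <= b)%nat -> (1 <= c)%nat -> 1 <= q ->
  (forall x, 1 <= x -> is_derive RQ x (q * Rpower x (q - 1) * Rf x)) ->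
  (forall x, 1 <= x -> is_derive RL x (/ x * Rf x)) ->
  (forall x, 1 <= x -> continuous Rf x) -> 0 <= C0 ->
  (forall x, 1 <= x -> Rabs (Hs b c x - Kc - Rf x) <= C0 * Rpower x (- (1 / 2))) ->
  forall X, 1 <= X ->
  Rabs (rsum (fun n => / INR n * Rpower (X / INR n) (- q) * PE b c q Kc RQ (X / INR n)) (nat_floor X)
    - WE b c Kc RL X) <= 2 * (C0 * (q * Rpower 2 (q - 1))) * Rpower X (- (1 / 2)).
Proof.
  intros Hb Hc Hq HQ HL HR HC0 He X HX. set (N := nat_floor X).
  set (e := fun x => Hs b c x - Kc - Rf x).
  set (g := fun x => rsum (fun n => / INR n * Rpower (X / INR n) (- q) *
     (stepR x (X / INR n) * (q * Rpower x (q - 1) * e x))) N).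
  assert (Hg : is_RInt g 1 X (rsum (fun n => / INR n * Rpower (X / INR n) (- q) * PE b c q Kc RQ (X / INR n)) N)).
  { apply is_RInt_rsum. intros n Hn. apply is_RInt_scalr.
    assert (n1 := INR_ge1 n ltac:(lia)).
    assert (HnX : INR n <= X) by (apply nat_floor_le; [lra|unfold N in Hn; lia]).
    assert (HZ : 1 <= X / INR n) by (apply Rle_div_r; lra).
    assert (HZX : X / INR n <= X) by (apply Rle_div_l; nra).
    apply is_RInt_left_step; [lra|]. apply (PE_RInt b c q Kc Rf); auto. }
  set (Cs := q * Rpower 2 (q - 1)).
  assert (HCs : 0 <= Cs) by (unfold Cs; assert (P := Rpower_pos 2 (q - 1)); nra).
  apply Rle_trans with (C0 * Cs * / X * (2 * sqrt X - 2)).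
  - apply (is_RInt_abs_le (fun x => g x - / x * e x) (fun x => C0 * Cs * / X * Rpower x (- (1 / 2))) 1 X); auto.
    + apply is_RInt_minusr; auto. apply (WE_RInt b c Kc Rf); auto.
    + apply is_RInt_scalr, sqrt_inv_RInt; auto.
    + intros x Hx.
      assert (Hy : 1 <= X / x) by (apply Rle_div_r; lra).
      assert (HyX : X / x <= X) by (apply Rle_div_l; nra).
      (* [x <= X/n] and [n <= X/x] are the same condition, so the steps under the integral sum to
         [sig] at [X/x]. *)
      assert (G : g x = e x * (Rpower x (q - 1) * Rpower X (- q)) * (q * sig q (X / x))).
      { unfold g, sig. rewrite <- (rsum_stepR _ N).
        - rewrite <- rsum_scal, <- rsum_scal. apply rsum_ext. intros n Hn.
          assert (n1 := INR_ge1 n ltac:(lia)).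
          rewrite (stepR_iff x (X / INR n) (INR n) (X / x)).
          + assert (E : / INR n * Rpower (X / INR n) (- q) = Rpower X (- q) * Rpower (INR n) (q - 1)).
            { replace (/ INR n) with (Rpower (INR n) (- (1))) by (rewrite Rpower_Ropp, Rpower_1; lra).
              unfold Rpower. rewrite ln_div, <- !exp_plus by lra. f_equal. ring. }
            rewrite E. ring.
          + split; intros H; apply Rle_div_r in H; try lra; apply Rle_div_r; lra.
        - lra.
        - apply nat_floor_le; [lra|]. destruct (nat_floor_spec (X / x)); lra. }
      assert (E1 : Rpower x (q - 1) * Rpower X (- q) * Rpower (X / x) q = / x).
      { replace (/ x) with (Rpower x (- (1))) by (rewrite Rpower_Ropp, Rpower_1; lra).
        unfold Rpower. rewrite ln_div, <- !exp_plus by lra. f_equal. ring. }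
      assert (E2 : Rpower x (q - 1) * Rpower X (- q) * Rpower (X / x) (q - 1) = / X).
      { replace (/ X) with (Rpower X (- (1))) by (rewrite Rpower_Ropp, Rpower_1; lra).
        unfold Rpower. rewrite ln_div, <- !exp_plus by lra. f_equal. ring. }
      replace (g x - / x * e x) with
        (e x * ((Rpower x (q - 1) * Rpower X (- q)) * (q * sig q (X / x) - Rpower (X / x) q))).
      2:{ rewrite G, <- E1. ring. }
      assert (P0 : 0 <= Rpower x (q - 1) * Rpower X (- q)).
      { apply Rmult_le_pos; apply Rlt_le, Rpower_pos. }
      rewrite (Rabs_mult (e x)), (Rabs_mult (_ * _)), (Rabs_pos_eq (Rpower x (q - 1) * _)) by auto.
      assert (S := sig_asymp q (X / x) Hq Hy). fold Cs in S.
      assert (He1 := He x ltac:(lra)). fold (e x) in He1.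
      replace (C0 * Cs * / X * Rpower x (- (1 / 2))) with ((C0 * Rpower x (- (1 / 2))) * (Cs * / X)) by ring.
      apply Rmult_le_compat; try apply Rabs_pos; auto.
      { apply Rmult_le_pos; auto. apply Rabs_pos. }
      rewrite <- E2. replace (Cs * (Rpower x (q - 1) * Rpower X (- q) * Rpower (X / x) (q - 1))) with
        (Rpower x (q - 1) * Rpower X (- q) * (Cs * Rpower (X / x) (q - 1))) by ring.
      apply Rmult_le_compat_l; auto.
  - rewrite Rpower_half by lra.
    assert (sX : 0 < sqrt X) by (apply sqrt_lt_R0; lra).
    assert (ss : sqrt X * sqrt X = X) by (apply sqrt_sqrt; lra).
    assert (0 < / X) by (apply Rinv_0_lt_compat; lra).
    assert (0 <= C0 * Cs * / X) by (apply Rmult_le_pos; [apply Rmult_le_pos; auto|lra]).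
    apply Rle_trans with (C0 * Cs * / X * (2 * sqrt X)); [apply Rmult_le_compat_l; lra|].
    apply Req_le. rewrite <- ss at 1. field. lra.
Qed.

(** * The constant term of the diagonal *)

Lemma lim_of_Rbound (u : nat -> R) l (v : nat -> R) :
  (forall N, (1 <= N)%nat -> Rabs (u N - l) <= v N) -> is_lim_seq v 0 -> is_lim_seq u l.
Proof.
  intros H Hv. apply is_lim_seq_spec. intros eps. apply is_lim_seq_spec in Hv.
  destruct (Hv eps) as [N HN]. exists (S N). intros n Hn.
  eapply Rle_lt_trans; [apply H; lia|].
  specialize (HN n ltac:(lia)). rewrite Rminus_0_r in HN.
  eapply Rle_lt_trans; [apply Rle_abs|exact HN].
Qed.

Lemma psum_lim a : 1 < a -> is_lim_seq (fun N => rsum (fun n => Rpower (INR n) (- a)) N) (zetaR a).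
Proof.
  intros Ha. apply (lim_of_Rbound _ _ (fun N => 2 * Rpower 2 (a + 1) * Rpower (INR N) (- a)
     + / (a - 1) * Rpower (INR N) (- (a - 1)))).
  - intros N HN. assert (H := zetaR_nat a N ltac:(lra) ltac:(lra) HN).
    set (s := rsum _ _) in *.
    replace (s - zetaR a) with ((s - Rpower (INR N) (1 - a) / (1 - a) - zetaR a)
      + Rpower (INR N) (1 - a) / (1 - a)) by ring.
    eapply Rle_trans; [apply Rabs_triang|]. apply Rplus_le_compat; auto.
    unfold Rdiv. rewrite Rabs_mult, Rabs_inv, (Rabs_pos_eq (Rpower _ _)), (Rabs_left (1 - a))
      by (lra || apply Rlt_le, Rpower_pos).
    apply Req_le.
    replace (- (1 - a)) with (a - 1) by ring. replace (- (a - 1)) with (1 - a) by ring. ring.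
  - replace (Finite 0) with (Finite (0 + 0)) by (f_equal; ring).
    apply is_lim_seq_plus'; apply lim_scal_Rpower_neg; lra.
Qed.

Lemma lsum_lim a : 1 < a ->
  is_lim_seq (fun N => rsum (fun n => Rpower (INR n) (- a) * ln (INR n)) N) (- zetaR' a).
Proof.
  intros Ha. destruct (lu_lim a ltac:(lra) ltac:(lra)) as [l [L1 _]].
  rewrite (zetaR_deriv_lim a l) by (auto; lra).
  replace (- - l) with (l + 0) by ring.
  apply (is_lim_seq_ext (fun N => lu a N + lF a (INR N))); [intros; unfold lu; ring|].
  apply is_lim_seq_plus'; auto.
  set (d := (a - 1) / 2).
  apply (lim_of_Rbound _ 0 (fun N => (2 / (a - 1) ^ 2 + / (a - 1) ^ 2) * Rpower (INR N) (- d))).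
  - intros N HN. assert (N1 := INR_ge1 N HN). rewrite Rminus_0_r.
    assert (H := lf_bound (a - 1) (INR N) ltac:(lra) N1).
    replace (- (a - 1)) with (1 - a) in H by ring. fold d in H.
    assert (P : Rpower (INR N) (1 - a) <= Rpower (INR N) (- d)) by (apply Rle_Rpower; unfold d; lra).
    assert (P0 := Rpower_pos (INR N) (1 - a)).
    assert (L := ln_nonneg _ N1). rewrite Rabs_pos_eq in H by (apply Rmult_le_pos; lra).
    assert (I : 0 < / (a - 1)) by (apply Rinv_0_lt_compat; lra).
    assert (I2 : 0 < / (a - 1) ^ 2) by (apply Rinv_0_lt_compat; nra).
    unfold lF. replace (Rpower (INR N) (1 - a) * ln (INR N) / (1 - a) - Rpower (INR N) (1 - a) / (1 - a) ^ 2)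
      with (- (/ (a - 1) * (Rpower (INR N) (1 - a) * ln (INR N)) + / (a - 1) ^ 2 * Rpower (INR N) (1 - a)))
      by (field; lra).
    rewrite Rabs_Ropp, Rabs_pos_eq.
    + assert (/ (a - 1) * (Rpower (INR N) (1 - a) * ln (INR N)) <= / (a - 1) * (2 / (a - 1) * Rpower (INR N) (- d)))
        by (apply Rmult_le_compat_l; lra).
      assert (/ (a - 1) ^ 2 * Rpower (INR N) (1 - a) <= / (a - 1) ^ 2 * Rpower (INR N) (- d))
        by (apply Rmult_le_compat_l; lra).
      replace (2 / (a - 1) ^ 2 * Rpower (INR N) (- d)) with (/ (a - 1) * (2 / (a - 1) * Rpower (INR N) (- d)))
        by (field; lra).
      rewrite Rmult_plus_distr_r.
      replace (2 / (a - 1) ^ 2 * Rpower (INR N) (- d)) with (/ (a - 1) * (2 / (a - 1) * Rpower (INR N) (- d)))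
        by (field; lra). lra.
    + apply Rplus_le_le_0_compat; repeat apply Rmult_le_pos; lra.
  - apply lim_scal_Rpower_neg. unfold d; lra.
Qed.

Definition Lam (b c : nat) (Y : R) : R :=
  rsum (fun k => rsum (fun l => wkl b c k l * (stepR (kl b c k l) Y * ln (kl b c k l)))
    (nat_floor Y)) (nat_floor Y).

Definition boxL (b c N : nat) : R :=
  rsum (fun k => rsum (fun l => wkl b c k l * ln (kl b c k l)) N) N.

Lemma LH_Lam b c Y : LH b c Y = Hs b c Y * ln Y - Lam b c Y.
Proof.
  unfold LH, Hs, Hbox, Lam. rewrite <- rsum_scal_r, <- rsum_minus. apply rsum_ext. intros k Hk.
  rewrite <- rsum_scal_r, <- rsum_minus. apply rsum_ext. intros l Hl. ring.
Qed.

Lemma boxL_lim b c : (2 <= b)%nat -> (2 <= c)%nat ->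
  is_lim_seq (boxL b c) (- (INR b * zetaR' (al b) * zetaR (al c) + INR c * zetaR (al b) * zetaR' (al c))).
Proof.
  intros Hb Hc.
  assert (B1 : 2 <= INR b) by (apply (le_INR 2); auto).
  assert (C1 : 2 <= INR c) by (apply (le_INR 2); auto).
  assert (A1 : 1 < al b) by (unfold al; lra). assert (A2 : 1 < al c) by (unfold al; lra).
  apply (is_lim_seq_ext (fun N =>
    INR b * (rsum (fun n => Rpower (INR n) (- al b) * ln (INR n)) N * rsum (fun n => Rpower (INR n) (- al c)) N)
    + INR c * (rsum (fun n => Rpower (INR n) (- al b)) N * rsum (fun n => Rpower (INR n) (- al c) * ln (INR n)) N))).
  - intros N. unfold boxL. rewrite <- !rsum_prod, <- !rsum_scal, <- rsum_plus. apply rsum_ext. intros k Hk.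
    rewrite <- !rsum_scal, <- rsum_plus. apply rsum_ext. intros l Hl.
    unfold wkl. rewrite Rpower_kl by lia. ring.
  - replace (- (INR b * zetaR' (al b) * zetaR (al c) + INR c * zetaR (al b) * zetaR' (al c))) with
      (INR b * (- zetaR' (al b) * zetaR (al c)) + INR c * (zetaR (al b) * - zetaR' (al c))) by ring.
    assert (P1 := psum_lim _ A1). assert (P2 := psum_lim _ A2).
    assert (L1 := lsum_lim _ A1). assert (L2 := lsum_lim _ A2).
    apply is_lim_seq_plus'; apply (is_lim_seq_mult' (fun _ => _)); try apply is_lim_seq_const;
      apply is_lim_seq_mult'; auto.
Qed.

Lemma nat_floor_INR n : nat_floor (INR n) = n.
Proof.
  destruct (nat_floor_spec (INR n) (pos_INR n)) as [H1 H2].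
  apply Nat.le_antisymm.
  - apply INR_le; auto.
  - apply nat_floor_le; [apply pos_INR|lra].
Qed.

(** The region [k^b l^c <= N^{b+c}] contains the box of side [N] and lies in the box of side
    [N^{b+c}]. As all terms are nonnegative, this sandwich reduces the hyperbolic sum to products of
    single series. *)
Lemma Lam_box b c N : (1 <= b)%nat -> (1 <= c)%nat -> (1 <= N)%nat ->
  boxL b c N <= Lam b c (INR (N ^ (b + c))) <= boxL b c (N ^ (b + c)).
Proof.
  intros Hb Hc HN. unfold Lam. rewrite nat_floor_INR. set (M := (N ^ (b + c))%nat).
  assert (HNM : (N <= M)%nat) by (apply le_pow_self; lia).
  assert (W : forall k l, 0 <= wkl b c k l).
  { intros. unfold wkl. apply Rmult_le_pos; apply Rlt_le, Rpower_pos. }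
  assert (L : forall k l, (1 <= k)%nat -> (1 <= l)%nat -> 0 <= ln (kl b c k l)).
  { intros. apply ln_nonneg. apply kl_ge; auto. }
  assert (S : forall x y, 0 <= stepR x y <= 1).
  { intros. unfold stepR. destruct (Rle_dec x y); lra. }
  assert (T0 : forall k l, (1 <= k)%nat -> (1 <= l)%nat ->
    0 <= wkl b c k l * (stepR (kl b c k l) (INR M) * ln (kl b c k l))).
  { intros. apply Rmult_le_pos; auto. apply Rmult_le_pos; auto. apply S. }
  split.
  - unfold boxL. apply Rle_trans with (rsum (fun k => rsum (fun l =>
      wkl b c k l * (stepR (kl b c k l) (INR M) * ln (kl b c k l))) M) N).
    + apply rsum_le. intros k Hk.
      apply Rle_trans with (rsum (fun l => wkl b c k l * (stepR (kl b c k l) (INR M) * ln (kl b c k l))) N).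
      * apply Req_le. apply rsum_ext. intros l Hl.
        rewrite stepR_1; [ring|]. unfold M, kl. rewrite pow_INR, pow_add.
        apply Rmult_le_compat; try (apply pow_le, pos_INR); apply pow_incr; split;
          try apply pos_INR; apply le_INR; lia.
      * apply rsum_mono; auto. intros l Hl. apply T0; lia.
    + apply rsum_mono; auto. intros k Hk. apply rsum_nonneg. intros l Hl. apply T0; lia.
  - unfold boxL. apply rsum_le. intros k Hk. apply rsum_le. intros l Hl.
    apply Rmult_le_compat_l; auto. assert (Sk := S (kl b c k l) (INR M)).
    assert (Lk := L k l ltac:(lia) ltac:(lia)). nra.
Qed.

(** Evaluates the full integral of the error against [1/x] although the error itself is only
    bounded: [Hs Y ln Y] cancels [Kc ln Y] up to vanishing terms, and what remains is [- Lam], with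
    a convergent double series as its limit. A subsequence suffices, because [WE_tail] bounds all
    differences. *)
Lemma WE_lim b c Kc (Rf RL : R -> R) C0 CR d : (2 <= b)%nat -> (2 <= c)%nat ->
  0 <= C0 -> 0 <= CR -> 0 < d ->
  (forall x, 1 <= x -> Rabs (Hs b c x - Kc - Rf x) <= C0 * Rpower x (- (1 / 2))) ->
  (forall x, 1 <= x -> Rabs (Rf x * ln x) + Rabs (RL x) <= CR * Rpower x (- d)) ->
  is_lim_seq (fun N => WE b c Kc RL (INR (N ^ (b + c))))
    (INR b * zetaR' (al b) * zetaR (al c) + INR c * zetaR (al b) * zetaR' (al c) + RL 1).
Proof.
  intros Hb Hc HC0 HCR Hd He HR.
  set (L := INR b * zetaR' (al b) * zetaR (al c) + INR c * zetaR (al b) * zetaR' (al c)).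
  assert (H1 : is_lim_seq (fun N => Lam b c (INR (N ^ (b + c)))) (- L)).
  { assert (HB := boxL_lim b c Hb Hc). fold L in HB.
    apply (is_lim_seq_le_le_loc (boxL b c) _ (fun N => boxL b c (N ^ (b + c)))); auto.
    - exists 1%nat. intros n Hn. apply Lam_box; lia.
    - apply (is_lim_seq_subseq (boxL b c) (- L) (fun N => (N ^ (b + c))%nat)); auto.
      intros P [N0 HN0]. exists (S N0). intros n Hn. apply HN0.
      assert (n <= n ^ (b + c))%nat by (apply le_pow_self; lia). lia. }
  assert (H2 : is_lim_seq (fun N => WE b c Kc RL (INR (N ^ (b + c))) + Lam b c (INR (N ^ (b + c)))) (RL 1)).
  { apply (lim_of_Rbound _ _ (fun N => 4 * C0 * Rpower (INR N) (- (1 / 4)) + CR * Rpower (INR N) (- d))).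
    - intros N HN. set (Y := INR (N ^ (b + c))).
      assert (N1 := INR_ge1 N HN).
      assert (NY : INR N <= Y) by (apply le_INR, le_pow_self; lia).
      assert (Y1 : 1 <= Y) by lra. assert (LY := ln_nonneg Y Y1).
      assert (A := ln_absorb (1 / 2) Y ltac:(lra) ltac:(lra)).
      specialize (He Y Y1). specialize (HR Y Y1).
      unfold WE. rewrite LH_Lam.
      replace (Hs b c Y * ln Y - Lam b c Y - Kc * ln Y - (RL Y - RL 1) + Lam b c Y - RL 1) with
        ((Hs b c Y - Kc - Rf Y) * ln Y + (Rf Y * ln Y + - RL Y)) by ring.
      eapply Rle_trans; [apply Rabs_triang|]. apply Rplus_le_compat.
      + rewrite Rabs_mult, (Rabs_pos_eq (ln Y)) by auto.
        apply Rle_trans with (C0 * Rpower Y (- (1 / 2)) * (4 * Rpower Y (1 / 2 / 2))).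
        * apply Rmult_le_compat; auto; try apply Rabs_pos. lra.
        * replace (C0 * Rpower Y (- (1 / 2)) * (4 * Rpower Y (1 / 2 / 2))) with
            (4 * C0 * (Rpower Y (- (1 / 2)) * Rpower Y (1 / 2 / 2))) by ring.
          rewrite <- Rpower_plus. replace (- (1 / 2) + 1 / 2 / 2) with (- (1 / 4)) by field.
          apply Rmult_le_compat_l; [lra|]. apply Rpower_le_base_neg; lra.
      + eapply Rle_trans; [apply Rabs_triang|]. rewrite Rabs_Ropp.
        eapply Rle_trans; [exact HR|]. apply Rmult_le_compat_l; auto. apply Rpower_le_base_neg; lra.
    - replace (Finite 0) with (Finite (0 + 0)) by (f_equal; ring).
      apply is_lim_seq_plus'; apply lim_scal_Rpower_neg; lra. }
  apply (is_lim_seq_ext (fun N => (WE b c Kc RL (INR (N ^ (b + c))) + Lam b c (INR (N ^ (b + c))))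
     - Lam b c (INR (N ^ (b + c))))); [intros; ring|].
  replace (L + RL 1) with (RL 1 - - L) by ring.
  apply is_lim_seq_minus'; auto.
Qed.

Lemma m32_RInt X Y : 1 <= X <= Y -> is_RInt (fun x => Rpower x (- (1 / 2) - 1)) X Y
  (2 * Rpower X (- (1 / 2)) - 2 * Rpower Y (- (1 / 2))).
Proof.
  intros HX.
  replace (2 * Rpower X (- (1 / 2)) - 2 * Rpower Y (- (1 / 2))) with
    (minus (- 2 * Rpower Y (- (1 / 2))) (- 2 * Rpower X (- (1 / 2))))
    by (unfold minus, plus, opp; simpl; ring).
  apply (is_RInt_derive (V := R_CompleteNormedModule) (fun x => - 2 * Rpower x (- (1 / 2))));
    rewrite Rmin_left, Rmax_right by lra; intros x Hx; [|apply Rpower_cont; lra].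
  evar_last; [apply is_derive_scal, Rpower_derive; lra|]. field.
Qed.

(** The integrand is [O(x^{-3/2})], so what lies beyond [X] contributes [O(X^{-1/2})], and [WE_lim]
    identifies the limit. *)
Lemma WE_tail b c Kc (Rf RL : R -> R) C0 CR d : (2 <= b)%nat -> (2 <= c)%nat ->
  0 <= C0 -> 0 <= CR -> 0 < d ->
  (forall x, 1 <= x -> is_derive RL x (/ x * Rf x)) ->
  (forall x, 1 <= x -> continuous Rf x) ->
  (forall x, 1 <= x -> Rabs (Hs b c x - Kc - Rf x) <= C0 * Rpower x (- (1 / 2))) ->
  (forall x, 1 <= x -> Rabs (Rf x * ln x) + Rabs (RL x) <= CR * Rpower x (- d)) ->
  forall X, 1 <= X ->
  Rabs (WE b c Kc RL X -
    (INR b * zetaR' (al b) * zetaR (al c) + INR c * zetaR (al b) * zetaR' (al c) + RL 1))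
  <= 2 * C0 * Rpower X (- (1 / 2)).
Proof.
  intros Hb Hc HC0 HCR Hd HL Hcont He HR X HX.
  set (L := INR b * zetaR' (al b) * zetaR (al c) + INR c * zetaR (al b) * zetaR' (al c) + RL 1).
  assert (Hlim := WE_lim b c Kc Rf RL C0 CR d Hb Hc HC0 HCR Hd He HR). fold L in Hlim.
  assert (G : forall Y, X <= Y -> Rabs (WE b c Kc RL X - WE b c Kc RL Y) <= 2 * C0 * Rpower X (- (1 / 2))).
  { intros Y HY. rewrite Rabs_minus_sym.
    apply Rle_trans with (C0 * (2 * Rpower X (- (1 / 2)) - 2 * Rpower Y (- (1 / 2)))).
    - apply (is_RInt_abs_le (fun x => / x * (Hs b c x - Kc - Rf x)) (fun x => C0 * Rpower x (- (1 / 2) - 1)) X Y); auto.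
      + replace (WE b c Kc RL Y - WE b c Kc RL X) with (plus (opp (WE b c Kc RL X)) (WE b c Kc RL Y))
          by (unfold plus, opp; simpl; ring).
        apply (is_RInt_Chasles (V := R_NormedModule)) with 1.
        * apply (is_RInt_swap (V := R_NormedModule)). apply (WE_RInt b c Kc Rf); auto; lia.
        * apply (WE_RInt b c Kc Rf); auto; lia || lra.
      + apply is_RInt_scalr, m32_RInt; lra.
      + intros x Hx. assert (0 < / x) by (apply Rinv_0_lt_compat; lra).
        rewrite Rabs_mult, (Rabs_pos_eq (/ x)) by lra.
        unfold Rminus at 3. rewrite Rpower_plus, (Rpower_Ropp x 1), Rpower_1 by lra.
        specialize (He x ltac:(lra)).
        apply Rle_trans with (/ x * (C0 * Rpower x (- (1 / 2)))); [apply Rmult_le_compat_l; lra|lra].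
    - assert (P := Rpower_pos Y (- (1 / 2))). nra. }
  assert (HA : is_lim_seq (fun N => Rabs (WE b c Kc RL X - WE b c Kc RL (INR (N ^ (b + c))))) (Rabs (WE b c Kc RL X - L))).
  { apply (is_lim_seq_abs (fun N => WE b c Kc RL X - WE b c Kc RL (INR (N ^ (b + c)))) (WE b c Kc RL X - L)).
    apply is_lim_seq_minus'; auto. apply is_lim_seq_const. }
  change (Rbar_le (Rabs (WE b c Kc RL X - L)) (2 * C0 * Rpower X (- (1 / 2)))).
  apply (is_lim_seq_le_loc _ (fun _ => 2 * C0 * Rpower X (- (1 / 2))) _ _) with (2 := HA); [|apply is_lim_seq_const].
  exists (S (nat_floor X)). intros n Hn. apply G.
  apply Rle_trans with (INR n).
  - apply Rlt_le. apply nat_floor_lt; [lra|lia].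
  - apply le_INR, le_pow_self; lia.
Qed.

Lemma Vd_main b c q (Rf RQ RL : R -> R) C0 CR d : (2 <= b)%nat -> (2 <= c)%nat -> 1 <= q ->
  0 <= C0 -> 0 <= CR -> 0 < d ->
  (forall x, 1 <= x -> is_derive RQ x (q * Rpower x (q - 1) * Rf x)) ->
  (forall x, 1 <= x -> is_derive RL x (/ x * Rf x)) ->
  (forall x, 1 <= x -> continuous Rf x) ->
  (forall x, 1 <= x -> Rabs (Hs b c x - zetaR (al b) * zetaR (al c) - Rf x) <= C0 * Rpower x (- (1 / 2))) ->
  (forall x, 1 <= x -> Rabs (Rf x * ln x) + Rabs (RL x) <= CR * Rpower x (- d)) ->
  exists K, 0 < K /\ forall X, 1 <= X ->
  Rabs (Vd b c q X - zetaR (al b) * zetaR (al c) * (ln X + euler_gamma - / q)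
    - (INR b * zetaR' (al b) * zetaR (al c) + INR c * zetaR (al b) * zetaR' (al c) + RL 1)
    - rsum (fun n => / INR n * Rpower (X / INR n) (- q) * (RQ (X / INR n) - RQ 1)) (nat_floor X))
  <= K * Rpower X (- (1 / 2)).
Proof.
  intros Hb Hc Hq HC0 HCR Hd HQ HL Hcont He HR.
  destruct hsum_asymp as [Kh [HKh Hh]].
  set (Kc := zetaR (al b) * zetaR (al c)).
  set (Cs := q * Rpower 2 (q - 1)).
  assert (HCs : 0 < Cs) by (unfold Cs; assert (P := Rpower_pos 2 (q - 1)); nra).
  exists (2 * (C0 * Cs) + 2 * C0 + Rabs Kc * (Kh + Cs) + 1). split.
  { assert (0 <= Rabs Kc * (Kh + Cs)) by (apply Rmult_le_pos; [apply Rabs_pos|lra]). nra. }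
  intros X HX.
  assert (T1 := PE_sum b c q Kc Rf RQ RL C0 ltac:(lia) ltac:(lia) Hq HQ HL Hcont HC0 He X HX).
  assert (T2 := WE_tail b c Kc Rf RL C0 CR d Hb Hc HC0 HCR Hd HL Hcont He HR X HX).
  fold Cs in T1.
  specialize (Hh X HX). assert (Sg := sig_asymp q X Hq HX). fold Cs in Sg.
  rewrite (Vd_PH b c q X) by (lia || lra).
  set (N := nat_floor X) in *.
  set (S1 := rsum (fun n => / INR n * Rpower (X / INR n) (- q) * PE b c q Kc RQ (X / INR n)) N) in *.
  set (S2 := rsum (fun n => / INR n * Rpower (X / INR n) (- q) * (RQ (X / INR n) - RQ 1)) N).
  (* The constant [Kc] in [PH] meets the factor [n^{-1} (1 - (X/n)^{-q})]; summed over [n] it gives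
     [hsum X - X^{-q} sig q X], hence [ln X + euler_gamma - 1/q]. *)
  assert (E : rsum (fun n => / INR n * Rpower (X / INR n) (- q) * PH b c q (X / INR n)) N =
    S1 + S2 + Kc * (hsum X - Rpower X (- q) * sig q X)).
  { unfold S1, S2, hsum, sig. fold N. rewrite <- rsum_scal, <- rsum_minus, <- rsum_scal, <- !rsum_plus.
    apply rsum_ext. intros n Hn. assert (n1 := INR_ge1 n ltac:(lia)).
    unfold PE.
    assert (E1 : / INR n * Rpower (X / INR n) (- q) = Rpower X (- q) * Rpower (INR n) (q - 1)).
    { replace (/ INR n) with (Rpower (INR n) (- (1))) by (rewrite Rpower_Ropp, Rpower_1; lra).
      unfold Rpower. rewrite ln_div, <- !exp_plus by lra. f_equal. ring. }
    assert (E2 : Rpower (X / INR n) (- q) * Rpower (X / INR n) q = 1).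
    { rewrite <- Rpower_plus. replace (- q + q) with 0 by ring. apply Rpower_O.
      apply Rdiv_lt_0_compat; lra. }
    rewrite <- E1.
    replace (/ INR n - / INR n * Rpower (X / INR n) (- q)) with
      (/ INR n * (Rpower (X / INR n) (- q) * Rpower (X / INR n) q) - / INR n * Rpower (X / INR n) (- q))
      by (rewrite E2; ring). ring. }
  rewrite E. clear E.
  set (L := INR b * zetaR' (al b) * zetaR (al c) + INR c * zetaR (al b) * zetaR' (al c) + RL 1) in *.
  assert (PX : Rpower X (- q) * Rpower X q = 1).
  { rewrite <- Rpower_plus. replace (- q + q) with 0 by ring. apply Rpower_O; lra. }
  assert (PX2 : Rpower X (- q) * Rpower X (q - 1) = / X).
  { rewrite <- Rpower_plus. replace (- q + (q - 1)) with (- (1)) by ring.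
    rewrite Rpower_Ropp, Rpower_1; lra. }
  assert (T3 : Rabs (Rpower X (- q) * sig q X - / q) <= Cs * / X).
  { replace (Rpower X (- q) * sig q X - / q) with (/ q * (Rpower X (- q) * (q * sig q X - Rpower X q))).
    2:{ rewrite Rmult_minus_distr_l, PX. field. lra. }
    assert (Pq := Rpower_pos X (- q)).
    rewrite !Rabs_mult, (Rabs_pos_eq (Rpower _ _)), Rabs_inv, (Rabs_pos_eq q) by lra.
    assert (B1 : Rpower X (- q) * Rabs (q * sig q X - Rpower X q) <= Rpower X (- q) * (Cs * Rpower X (q - 1)))
      by (apply Rmult_le_compat_l; lra).
    replace (Rpower X (- q) * (Cs * Rpower X (q - 1))) with (Cs * / X) in B1 by (rewrite <- PX2; ring).
    assert (Iq : / q <= 1) by (rewrite <- Rinv_1; apply Rinv_le_contravar; lra).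
    assert (0 <= Rpower X (- q) * Rabs (q * sig q X - Rpower X q)) by (apply Rmult_le_pos; [lra|apply Rabs_pos]).
    nra. }
  assert (IX : / X <= Rpower X (- (1 / 2))).
  { replace (/ X) with (Rpower X (- (1))) by (rewrite Rpower_Ropp, Rpower_1; lra). apply Rle_Rpower; lra. }
  assert (IX0 : 0 < / X) by (apply Rinv_0_lt_compat; lra).
  replace (S1 + S2 + Kc * (hsum X - Rpower X (- q) * sig q X) - Kc * (ln X + euler_gamma - / q) - L - S2) with
    ((S1 - WE b c Kc RL X) + (WE b c Kc RL X - L) +
      Kc * ((hsum X - ln X - euler_gamma) - (Rpower X (- q) * sig q X - / q))) by ring.
  assert (T4 : Rabs (Kc * ((hsum X - ln X - euler_gamma) - (Rpower X (- q) * sig q X - / q)))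
     <= Rabs Kc * (Kh + Cs) * Rpower X (- (1 / 2))).
  { rewrite Rabs_mult, Rmult_assoc. apply Rmult_le_compat_l; [apply Rabs_pos|].
    unfold Rminus at 1. eapply Rle_trans; [apply Rabs_triang|]. rewrite Rabs_Ropp.
    assert (Kh * / X <= Kh * Rpower X (- (1 / 2))) by (apply Rmult_le_compat_l; lra).
    assert (Cs * / X <= Cs * Rpower X (- (1 / 2))) by (apply Rmult_le_compat_l; lra). lra. }
  eapply Rle_trans; [apply Rabs_triang|]. eapply Rle_trans; [apply Rplus_le_compat_r, Rabs_triang|].
  lra.
Qed.

(** * Summing the secondary terms over [n] *)

Lemma ln_div_INR X n : 0 < X -> (1 <= n)%nat -> ln (X / INR n) = ln X - ln (INR n).
Proof. intros HX Hn. assert (n1 := INR_ge1 n Hn). apply ln_div; lra. Qed.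

Lemma ratio_pow q s X n : 0 < X -> (1 <= n)%nat ->
  / INR n * Rpower (X / INR n) (- q) * Rpower (X / INR n) (q + s) = Rpower X s * Rpower (INR n) (- (1 + s)).
Proof.
  intros HX Hn. assert (n1 := INR_ge1 n Hn).
  replace (/ INR n) with (Rpower (INR n) (- (1))) at 1 by (rewrite Rpower_Ropp, Rpower_1; lra).
  unfold Rpower. rewrite ln_div_INR, <- !exp_plus by auto. f_equal. ring.
Qed.

Lemma ratio_pow0 q X n : 0 < X -> (1 <= n)%nat ->
  / INR n * Rpower (X / INR n) (- q) = Rpower X (- q) * Rpower (INR n) (q - 1).
Proof.
  intros HX Hn. assert (n1 := INR_ge1 n Hn).
  replace (/ INR n) with (Rpower (INR n) (- (1))) at 1 by (rewrite Rpower_Ropp, Rpower_1; lra).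
  unfold Rpower. rewrite ln_div_INR, <- !exp_plus by auto. f_equal. ring.
Qed.

Lemma inv_le_half X : 1 <= X -> 0 < / X <= Rpower X (- (1 / 2)).
Proof.
  intros HX. split; [apply Rinv_0_lt_compat; lra|].
  replace (/ X) with (Rpower X (- (1))) by (rewrite Rpower_Ropp, Rpower_1; lra). apply Rle_Rpower; lra.
Qed.

(** The constant is [- 1/s - 1/q]: the first part is the main term of the zeta sum times [X^s], the
    second comes from [sig]. Multiplied by [q/(q + s)] it becomes [- 1/s] and cancels the
    corresponding part of [RL 1], so pure powers leave no constant behind. *)
Lemma nsum_pow q s : 1 <= q -> - (1 / 2) < s < 0 -> exists K, 0 < K /\ forall X, 1 <= X ->
  Rabs (rsum (fun n => / INR n * Rpower (X / INR n) (- q) * (Rpower (X / INR n) (q + s) - 1)) (nat_floor X)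
    - (zetaR (1 + s) * Rpower X s - (q + s) / (q * s))) <= K * Rpower X (- (1 / 2)).
Proof.
  intros Hq Hs. destruct (psum_asymp (1 + s)) as [K [HK HKa]]; try lra.
  set (Cs := Rpower 2 (q - 1)). assert (HCs : 0 < Cs) by apply Rpower_pos.
  exists (K + Cs). split; [lra|]. intros X HX.
  rewrite (rsum_ext _ (fun n => Rpower X s * Rpower (INR n) (- (1 + s)) - Rpower X (- q) * Rpower (INR n) (q - 1))).
  2:{ intros n Hn. rewrite <- (ratio_pow q), <- ratio_pow0 by (lra || lia). ring. }
  rewrite rsum_minus, !rsum_scal. fold (psum (1 + s) X) (sig q X).
  specialize (HKa X HX). assert (S := sig_asymp q X Hq HX). fold Cs in S.
  assert (Ps := Rpower_pos X s). assert (Pq := Rpower_pos X (- q)).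
  assert (E1 : Rpower X s * Rpower X (1 - (1 + s)) = 1).
  { rewrite <- Rpower_plus. replace (s + (1 - (1 + s))) with 0 by ring. apply Rpower_O; lra. }
  assert (E2 : Rpower X s * Rpower X (- (1 + s)) = / X).
  { rewrite <- Rpower_plus. replace (s + - (1 + s)) with (- (1)) by ring.
    rewrite Rpower_Ropp, Rpower_1; lra. }
  assert (E3 : Rpower X (- q) * Rpower X q = 1).
  { rewrite <- Rpower_plus. replace (- q + q) with 0 by ring. apply Rpower_O; lra. }
  assert (E4 : Rpower X (- q) * Rpower X (q - 1) = / X).
  { rewrite <- Rpower_plus. replace (- q + (q - 1)) with (- (1)) by ring.
    rewrite Rpower_Ropp, Rpower_1; lra. }
  replace (Rpower X s * psum (1 + s) X - Rpower X (- q) * sig q X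
     - (zetaR (1 + s) * Rpower X s - (q + s) / (q * s))) with
    (Rpower X s * (psum (1 + s) X - Rpower X (1 - (1 + s)) / (1 - (1 + s)) - zetaR (1 + s))
      - / q * (Rpower X (- q) * (q * sig q X - Rpower X q))).
  2:{ replace (Rpower X s * (psum (1 + s) X - Rpower X (1 - (1 + s)) / (1 - (1 + s)) - zetaR (1 + s)))
       with (Rpower X s * psum (1 + s) X - (Rpower X s * Rpower X (1 - (1 + s))) / (1 - (1 + s)) - Rpower X s * zetaR (1 + s))
       by (field; lra).
      replace (/ q * (Rpower X (- q) * (q * sig q X - Rpower X q))) with
       (Rpower X (- q) * sig q X - / q * (Rpower X (- q) * Rpower X q)) by (field; lra).
      rewrite E1, E3. field. lra. }
  destruct (inv_le_half X HX) as [I1 I2].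
  unfold Rminus at 1. eapply Rle_trans; [apply Rabs_triang|]. rewrite Rabs_Ropp, !Rabs_mult.
  rewrite (Rabs_pos_eq (Rpower X s)), (Rabs_pos_eq (Rpower X (- q))), (Rabs_pos_eq (/ q))
    by (try apply Rlt_le, Rinv_0_lt_compat; lra).
  assert (B1 : Rpower X s * Rabs (psum (1 + s) X - Rpower X (1 - (1 + s)) / (1 - (1 + s)) - zetaR (1 + s))
     <= K * / X).
  { rewrite <- E2, <- Rmult_assoc, (Rmult_comm K), Rmult_assoc. apply Rmult_le_compat_l; lra. }
  assert (B2 : / q * (Rpower X (- q) * Rabs (q * sig q X - Rpower X q)) <= Cs * / X).
  { apply Rmult_le_reg_l with q; [lra|]. rewrite <- Rmult_assoc, Rinv_r, Rmult_1_l by lra.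
    replace (q * (Cs * / X)) with (Rpower X (- q) * (q * Cs * Rpower X (q - 1))) by (rewrite <- E4; ring).
    apply Rmult_le_compat_l; lra. }
  assert (K * / X <= K * Rpower X (- (1 / 2))) by (apply Rmult_le_compat_l; lra).
  assert (Cs * / X <= Cs * Rpower X (- (1 / 2))) by (apply Rmult_le_compat_l; lra).
  lra.
Qed.

(** [ln (X/n)] splits into [ln X] and [ln n], the latter giving [zetaR']. The main terms with [ln X]
    of the two sums cancel, and the rest of [lF] leaves the constant [1/s^2]. *)
Lemma nsum_log q s : 1 <= q -> - (1 / 2) < s < 0 -> exists K, 0 < K /\ forall X, 1 <= X ->
  Rabs (rsum (fun n => / INR n * Rpower (X / INR n) (- q) *
        (Rpower (X / INR n) (q + s) * ln (X / INR n))) (nat_floor X)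
    - (Rpower X s * (ln X * zetaR (1 + s) + zetaR' (1 + s)) + / s ^ 2)) <= K * Rpower X (- (1 / 2)).
Proof.
  intros Hq Hs. destruct (psum_asymp (1 + s)) as [K [HK HKa]]; try lra.
  destruct (lsum_asymp (1 + s)) as [L [HL HLa]]; try lra.
  exists (2 * K + L). split; [lra|]. intros X HX.
  rewrite (rsum_ext _ (fun n => Rpower X s * (ln X * Rpower (INR n) (- (1 + s)) - Rpower (INR n) (- (1 + s)) * ln (INR n)))).
  2:{ intros n Hn. rewrite <- Rmult_assoc, (ratio_pow q), ln_div_INR by (lra || lia). ring. }
  rewrite rsum_scal, rsum_minus, rsum_scal. fold (psum (1 + s) X) (lsum (1 + s) X).
  specialize (HKa X HX). specialize (HLa X HX).
  assert (Ps := Rpower_pos X s).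
  assert (E1 : Rpower X s * Rpower X (1 - (1 + s)) = 1).
  { rewrite <- Rpower_plus. replace (s + (1 - (1 + s))) with 0 by ring. apply Rpower_O; lra. }
  assert (E2 : Rpower X s * Rpower X (- (1 + s)) = / X).
  { rewrite <- Rpower_plus. replace (s + - (1 + s)) with (- (1)) by ring.
    rewrite Rpower_Ropp, Rpower_1; lra. }
  assert (E3 : Rpower X s * Rpower X (- ((1 + s) / 2)) <= Rpower X (- (1 / 2))).
  { rewrite <- Rpower_plus. apply Rle_Rpower; lra. }
  assert (lX : 0 <= ln X) by (apply ln_nonneg; lra).
  replace (Rpower X s * (ln X * psum (1 + s) X - lsum (1 + s) X)
    - (Rpower X s * (ln X * zetaR (1 + s) + zetaR' (1 + s)) + / s ^ 2)) with
    (Rpower X s * (ln X * (psum (1 + s) X - Rpower X (1 - (1 + s)) / (1 - (1 + s)) - zetaR (1 + s)))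
      - Rpower X s * (lsum (1 + s) X - lF (1 + s) X + zetaR' (1 + s))).
  2:{ unfold lF.
      replace (Rpower X s * (ln X * (psum (1 + s) X - Rpower X (1 - (1 + s)) / (1 - (1 + s)) - zetaR (1 + s)))
        - Rpower X s * (lsum (1 + s) X - (Rpower X (1 - (1 + s)) * ln X / (1 - (1 + s)) - Rpower X (1 - (1 + s)) / (1 - (1 + s)) ^ 2) + zetaR' (1 + s)))
      with (Rpower X s * (ln X * psum (1 + s) X - lsum (1 + s) X) - Rpower X s * (ln X * zetaR (1 + s) + zetaR' (1 + s))
        - (Rpower X s * Rpower X (1 - (1 + s))) / (1 - (1 + s)) ^ 2) by (field; lra).
      rewrite E1. field. lra. }
  unfold Rminus at 1. eapply Rle_trans; [apply Rabs_triang|]. rewrite Rabs_Ropp, !Rabs_mult.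
  rewrite (Rabs_pos_eq (Rpower X s)), (Rabs_pos_eq (ln X)) by lra.
  assert (IX : ln X * / X <= 2 * Rpower X (- (1 / 2))).
  { assert (A1 := ln_absorb 1 X ltac:(lra) ltac:(lra)).
    assert (I0 : 0 < / X) by (apply Rinv_0_lt_compat; lra).
    replace (Rpower X (- (1 / 2))) with (Rpower X (1 / 2) * / X).
    2:{ replace (/ X) with (Rpower X (- (1))) by (rewrite Rpower_Ropp, Rpower_1; lra).
        rewrite <- Rpower_plus. f_equal. field. }
    rewrite <- Rmult_assoc. apply Rmult_le_compat_r; lra. }
  assert (B1 : Rpower X s * (ln X * Rabs (psum (1 + s) X - Rpower X (1 - (1 + s)) / (1 - (1 + s)) - zetaR (1 + s)))
     <= K * (ln X * / X)).
  { replace (K * (ln X * / X)) with (Rpower X s * (ln X * (K * Rpower X (- (1 + s))))) by (rewrite <- E2; ring).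
    apply Rmult_le_compat_l; [lra|]. apply Rmult_le_compat_l; lra. }
  assert (B2 : Rpower X s * Rabs (lsum (1 + s) X - lF (1 + s) X + zetaR' (1 + s)) <= L * Rpower X (- (1 / 2))).
  { eapply Rle_trans; [apply Rmult_le_compat_l; [lra|apply HLa]|].
    rewrite (Rmult_comm L), <- Rmult_assoc, (Rmult_comm L). apply Rmult_le_compat_r; lra. }
  assert (K * (ln X * / X) <= K * (2 * Rpower X (- (1 / 2)))) by (apply Rmult_le_compat_l; lra).
  lra.
Qed.

Lemma log_sq_le d : 0 < d -> exists K, 0 < K /\ forall x, 1 <= x -> (1 + ln x) ^ 2 <= K * Rpower x d.
Proof.
  intros Hd. exists ((1 + 2 / d * 2) ^ 2).
  assert (H2 : 0 < 2 / d) by (apply Rdiv_lt_0_compat; lra).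
  split; [apply pow_lt; lra|]. intros x Hx. assert (lx := ln_nonneg x Hx).
  assert (A1 := ln_absorb d x Hd ltac:(lra)).
  assert (Q1 : 1 <= Rpower x (d / 2)) by (apply Rpower_ge1; lra).
  set (u := Rpower x (d / 2)) in *.
  replace (Rpower x d) with (u ^ 2).
  2:{ unfold u. simpl. rewrite Rmult_1_r, <- Rpower_plus. f_equal. lra. }
  rewrite <- Rpow_mult_distr. apply pow_incr. split; [lra|].
  assert (L1 : ln x <= 2 / d * u).
  { apply Rmult_le_reg_l with d; auto. replace (d * (2 / d * u)) with (2 * u) by (field; lra). lra. }
   lra.
Qed.

(** [a1] and [a2] are the coefficients of two powers, [a3] that of a power times a logarithm, so one
    formula serves [b <> c] (with [a3 = 0]) and [b = c] (with [a2 = 0]). *)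
Definition Vmain (b c : nat) (q s1 s2 a1 a2 a3 X : R) : R :=
  zetaR (al b) * zetaR (al c) * (ln X + euler_gamma - / q)
  + (INR b * zetaR' (al b) * zetaR (al c) + INR c * zetaR (al b) * zetaR' (al c))
  + (a1 * q / (q + s1) * zetaR (1 + s1) * Rpower X s1
     + a2 * q / (q + s2) * zetaR (1 + s2) * Rpower X s2
     + a3 * (q / (q + s1) * (Rpower X s1 * (ln X * zetaR (1 + s1) + zetaR' (1 + s1)))
        - q / (q + s1) ^ 2 * (zetaR (1 + s1) * Rpower X s1))).

Lemma Vd_eval b c q s1 s2 a1 a2 a3 C0 : (2 <= b)%nat -> (2 <= c)%nat -> 1 <= q -> 0 <= C0 ->
  - (1 / 2) < s1 < 0 -> - (1 / 2) < s2 < 0 ->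
  (forall x, 1 <= x -> Rabs (Hs b c x - zetaR (al b) * zetaR (al c)
     - (a1 * Rpower x s1 + a2 * Rpower x s2 + a3 * (Rpower x s1 * ln x))) <= C0 * Rpower x (- (1 / 2))) ->
  exists K, 0 < K /\ forall X, 1 <= X ->
  Rabs (Vd b c q X - Vmain b c q s1 s2 a1 a2 a3 X)
  <= K * Rpower X (- (1 / 2)).
Proof.
  intros Hb Hc Hq HC0 Hs1 Hs2 He.
  set (Rf := fun x => a1 * Rpower x s1 + a2 * Rpower x s2 + a3 * (Rpower x s1 * ln x)) in *.
  set (RQ := fun x => a1 * q / (q + s1) * Rpower x (q + s1) + a2 * q / (q + s2) * Rpower x (q + s2)
     + a3 * q * (Rpower x (q + s1) * ln x / (q + s1) - Rpower x (q + s1) / (q + s1) ^ 2)).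
  set (RL := fun x => a1 / s1 * Rpower x s1 + a2 / s2 * Rpower x s2
     + a3 * (Rpower x s1 * ln x / s1 - Rpower x s1 / s1 ^ 2)).
  assert (Pl : forall p x, p <> 0 -> 0 < x ->
     is_derive (fun x => Rpower x p * ln x / p - Rpower x p / p ^ 2) x (Rpower x (p - 1) * ln x)).
  { intros p x Hp Hx. assert (D := lF_derive (1 - p) x ltac:(lra) Hx). unfold lF in D.
    replace (1 - (1 - p)) with p in D by ring. replace (- (1 - p)) with (p - 1) in D by ring. apply D. }
  assert (Pp : forall k p x, 0 < x -> is_derive (fun x => k * Rpower x p) x (k * (p * Rpower x (p - 1)))).
  { intros k p x Hx. apply (is_derive_scal (fun x => Rpower x p)). apply Rpower_derive; auto. }
  assert (Ep : forall p r x, Rpower x (r - 1) * Rpower x p = Rpower x (r + p - 1)).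
  { intros. rewrite <- Rpower_plus. f_equal. ring. }
  assert (Ei : forall p x, 0 < x -> / x * Rpower x p = Rpower x (p - 1)).
  { intros. replace (/ x) with (Rpower x (- (1))) by (rewrite Rpower_Ropp, Rpower_1; lra).
    rewrite <- Rpower_plus. f_equal. ring. }
  assert (HQ : forall x, 1 <= x -> is_derive RQ x (q * Rpower x (q - 1) * Rf x)).
  { intros x Hx. unfold RQ, Rf.
    replace (q * Rpower x (q - 1) * (a1 * Rpower x s1 + a2 * Rpower x s2 + a3 * (Rpower x s1 * ln x))) with
     (a1 * q / (q + s1) * ((q + s1) * Rpower x (q + s1 - 1))
      + a2 * q / (q + s2) * ((q + s2) * Rpower x (q + s2 - 1))
      + a3 * q * (Rpower x (q + s1 - 1) * ln x)).
    2:{ rewrite <- (Ep s1 q), <- (Ep s2 q). field. lra. }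
    apply (is_derive_plus (V := R_NormedModule)); [apply (is_derive_plus (V := R_NormedModule))|].
    - apply Pp; lra.
    - apply Pp; lra.
    - apply is_derive_scal. apply Pl; lra. }
  assert (HL : forall x, 1 <= x -> is_derive RL x (/ x * Rf x)).
  { intros x Hx. unfold RL, Rf.
    replace (/ x * (a1 * Rpower x s1 + a2 * Rpower x s2 + a3 * (Rpower x s1 * ln x))) with
     (a1 / s1 * (s1 * Rpower x (s1 - 1)) + a2 / s2 * (s2 * Rpower x (s2 - 1))
      + a3 * (Rpower x (s1 - 1) * ln x)).
    2:{ rewrite <- (Ei s1), <- (Ei s2) by lra. field. lra. }
    apply (is_derive_plus (V := R_NormedModule)); [apply (is_derive_plus (V := R_NormedModule))|].
    - apply Pp; lra.
    - apply Pp; lra.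
    - apply is_derive_scal. apply Pl; lra. }
  assert (Hcont : forall x, 1 <= x -> continuous Rf x).
  { intros x Hx. apply (ex_derive_continuous (V := R_NormedModule)). unfold Rf, Rpower. auto_derive. lra. }
  (* Half of the weaker decay is reserved for the logarithms: [s1, s2 <= - 2 d], while
     [(1 + ln x)^2] is [O(x^d)]. *)
  set (d := Rmin (- s1) (- s2) / 2).
  assert (Hd1 : s1 <= - (2 * d)) by (unfold d; assert (M := Rmin_l (- s1) (- s2)); lra).
  assert (Hd2 : s2 <= - (2 * d)) by (unfold d; assert (M := Rmin_r (- s1) (- s2)); lra).
  assert (Hd : 0 < d) by (unfold d; assert (M := Rmin_glb_lt (- s1) (- s2) 0 ltac:(lra) ltac:(lra)); lra).
  destruct (log_sq_le d Hd) as [Kd [HKd HKdx]].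
  set (Ca := Rabs a1 + Rabs a2 + Rabs a3 + (Rabs (a1 / s1) + Rabs (a2 / s2) + Rabs (a3 / s1) + Rabs (a3 / s1 ^ 2))).
  assert (HCa : 0 <= Ca).
  { unfold Ca. assert (P := Rabs_pos). repeat apply Rplus_le_le_0_compat; apply P. }
  assert (HR : forall x, 1 <= x -> Rabs (Rf x * ln x) + Rabs (RL x) <= Ca * Kd * Rpower x (- d)).
  { intros x Hx. assert (lx := ln_nonneg x Hx).
    assert (Pd := Rpower_pos x (- (2 * d))).
    assert (W : Rpower x (- (2 * d)) * (1 + ln x) ^ 2 <= Kd * Rpower x (- d)).
    { replace (Rpower x (- d)) with (Rpower x (- (2 * d)) * Rpower x d).
      2:{ rewrite <- Rpower_plus. f_equal. ring. }
      rewrite <- Rmult_assoc, (Rmult_comm Kd), Rmult_assoc. apply Rmult_le_compat_l; [lra|]. auto. }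
    set (w := Rpower x (- (2 * d)) * (1 + ln x) ^ 2) in *.
    assert (Mon : forall s j, s <= - (2 * d) -> 0 <= j <= (1 + ln x) ^ 2 -> 0 <= Rpower x s * j <= w).
    { intros s j Hs Hj. assert (P := Rpower_pos x s). split; [apply Rmult_le_pos; lra|].
      unfold w. apply Rmult_le_compat; try lra. apply Rle_Rpower; lra. }
    assert (0 <= ln x * ln x) by (apply Rmult_le_pos; lra).
    assert (M1 := Mon s1 (ln x) Hd1 ltac:(lra)). assert (M2 := Mon s2 (ln x) Hd2 ltac:(lra)).
    assert (M3 := Mon s1 (ln x * ln x) Hd1 ltac:(lra)).
    assert (M4 := Mon s1 1 Hd1 ltac:(lra)). assert (M5 := Mon s2 1 Hd2 ltac:(lra)).
    assert (Bd : forall k y, 0 <= y <= w -> Rabs (k * y) <= Rabs k * w).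
    { intros k y Hy. rewrite Rabs_mult, (Rabs_pos_eq y) by lra. apply Rmult_le_compat_l; [apply Rabs_pos|lra]. }
    apply Rle_trans with (Ca * w).
    2:{ rewrite Rmult_assoc. apply Rmult_le_compat_l; lra. }
    replace (Rf x * ln x) with (a1 * (Rpower x s1 * ln x) + a2 * (Rpower x s2 * ln x)
       + a3 * (Rpower x s1 * (ln x * ln x))) by (unfold Rf; ring).
    replace (RL x) with (a1 / s1 * (Rpower x s1 * 1) + a2 / s2 * (Rpower x s2 * 1)
       + a3 / s1 * (Rpower x s1 * ln x) + - (a3 / s1 ^ 2) * (Rpower x s1 * 1)) by (unfold RL; field; lra).

    assert (T7 := Bd (- (a3 / s1 ^ 2)) _ M4). rewrite (Rabs_Ropp (a3 / s1 ^ 2)) in T7.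
    unfold Ca. rewrite !Rmult_plus_distr_r.
    apply Rplus_le_compat.
    - eapply Rle_trans; [apply Rabs_triang|]. apply Rplus_le_compat; auto.
      eapply Rle_trans; [apply Rabs_triang|]. apply Rplus_le_compat; auto.
    - eapply Rle_trans; [apply Rabs_triang|]. apply Rplus_le_compat; auto.
      eapply Rle_trans; [apply Rabs_triang|]. apply Rplus_le_compat; auto.
      eapply Rle_trans; [apply Rabs_triang|]. apply Rplus_le_compat; auto. }
  destruct (Vd_main b c q Rf RQ RL C0 (Ca * Kd) d Hb Hc Hq HC0 ltac:(apply Rmult_le_pos; lra) Hd HQ HL Hcont He HR)
    as [K0 [HK0 V]].
  destruct (nsum_pow q s1 Hq Hs1) as [K1 [HK1 N1]].
  destruct (nsum_pow q s2 Hq Hs2) as [K2 [HK2 N2]].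
  destruct (nsum_log q s1 Hq Hs1) as [K3 [HK3 N3]].
  (* The primitive of [q x^{q + s1 - 1} ln x] also contains a pure power, hence the second
     summand. *)
  set (c1 := a1 * q / (q + s1) - a3 * q / (q + s1) ^ 2).
  set (c2 := a2 * q / (q + s2)). set (c3 := a3 * q / (q + s1)).
  exists (K0 + Rabs c1 * K1 + Rabs c2 * K2 + Rabs c3 * K3).
  assert (P1 := Rabs_pos c1). assert (P2 := Rabs_pos c2). assert (P3 := Rabs_pos c3).
  split.
  { assert (0 <= Rabs c1 * K1) by (apply Rmult_le_pos; lra).
    assert (0 <= Rabs c2 * K2) by (apply Rmult_le_pos; lra).
    assert (0 <= Rabs c3 * K3) by (apply Rmult_le_pos; lra). lra. }
  intros X HX. specialize (V X HX). specialize (N1 X HX). specialize (N2 X HX). specialize (N3 X HX).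
  set (N := nat_floor X) in *.
  assert (ES : rsum (fun n => / INR n * Rpower (X / INR n) (- q) * (RQ (X / INR n) - RQ 1)) N =
    c1 * rsum (fun n => / INR n * Rpower (X / INR n) (- q) * (Rpower (X / INR n) (q + s1) - 1)) N
    + c2 * rsum (fun n => / INR n * Rpower (X / INR n) (- q) * (Rpower (X / INR n) (q + s2) - 1)) N
    + c3 * rsum (fun n => / INR n * Rpower (X / INR n) (- q) * (Rpower (X / INR n) (q + s1) * ln (X / INR n))) N).
  { rewrite <- !rsum_scal, <- !rsum_plus. apply rsum_ext. intros n Hn.
    unfold RQ, c1, c2, c3. rewrite !Rpower_1_l, ln_1.
    set (i := / INR n). unfold Rdiv. field. lra. }
  rewrite ES in V. clear ES.
  set (S1 := rsum _ N) in V. set (S2 := rsum _ N) in V. set (S3 := rsum _ N) in V.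
  fold S1 in N1. fold S2 in N2. fold S3 in N3.
  unfold Vmain. set (Z1 := zetaR (1 + s1)) in *. set (Z2 := zetaR (1 + s2)) in *. set (Z3 := zetaR' (1 + s1)) in *.
  set (p1 := Rpower X s1) in *. set (p2 := Rpower X s2) in *.
  set (M1 := S1 - (Z1 * p1 - (q + s1) / (q * s1))) in *.
  set (M2 := S2 - (Z2 * p2 - (q + s2) / (q * s2))) in *.
  set (M3 := S3 - (p1 * (ln X * Z1 + Z3) + / s1 ^ 2)) in *.
  match goal with |- Rabs ?e <= _ => match type of V with Rabs ?v <= _ =>
    replace e with (v + c1 * M1 + c2 * M2 + c3 * M3) end end.
  (* Here [RL 1] cancels against the constants of [nsum_pow] and [nsum_log]. *)
  2:{ unfold RL. rewrite !Rpower_1_l, ln_1. unfold M1, M2, M3, c1, c2, c3. field. lra. }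
  assert (Bd : forall k y z, Rabs y <= z -> Rabs (k * y) <= Rabs k * z).
  { intros. rewrite Rabs_mult. apply Rmult_le_compat_l; auto. apply Rabs_pos. }
  assert (D1 := Bd c1 _ _ N1). assert (D2 := Bd c2 _ _ N2). assert (D3 := Bd c3 _ _ N3).
  eapply Rle_trans; [apply Rabs_triang|].
  eapply Rle_trans; [apply Rplus_le_compat_r, Rabs_triang|].
  eapply Rle_trans; [apply Rplus_le_compat_r, Rplus_le_compat_r, Rabs_triang|].
  lra.
Qed.

(** * Return to the variable [T] *)

Lemma tm_ratio theta m T : 0 < theta -> 0 < T -> (1 <= m)%nat ->
  tm theta m = T * Rpower (INR m / XT theta T) (/ theta).
Proof.
  intros Hth HT Hm. assert (P := PI_RGT_0). assert (m1 := INR_ge1 m Hm).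
  assert (HX := XT_pos theta T). unfold tm.
  replace (2 * PI) with (T * Rpower (XT theta T) (- / theta)).
  2:{ unfold XT. rewrite Rpower_mult. replace (theta * - / theta) with (- (1)) by (field; lra).
      rewrite Rpower_Ropp, Rpower_1 by (apply Rdiv_lt_0_compat; lra). field. lra. }
  rewrite Rmult_assoc. f_equal. unfold Rpower. rewrite ln_div, <- exp_plus by lra. f_equal. ring.
Qed.

Lemma Dg_Vd b c theta T : 0 < theta -> 0 < T -> Dg b c theta T = T * Vd b c (/ theta) (XT theta T).
Proof.
  intros Hth HT. unfold Dg, DgR, Vd.
  rewrite <- rsum_scal. apply rsum_ext. intros n Hn.
  rewrite <- rsum_scal. apply rsum_ext. intros k Hk.
  rewrite <- rsum_scal. apply rsum_ext. intros l Hl.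
  rewrite (tm_ratio theta (qn b c n k l) T) by (auto; apply qn_pos; lia).
  set (u := Rpower _ _). replace (T - T * u) with (T * (1 - u)) by ring.
  assert (E := RmaxRmult 0 (1 - u) T ltac:(lra)). rewrite Rmult_0_r in E. rewrite E. ring.
Qed.

Lemma ln_XT theta T : 0 < T -> ln (XT theta T) = theta * (ln T - ln (2 * PI)).
Proof.
  intros HT. assert (P := PI_RGT_0). unfold XT, Rpower. rewrite ln_exp, ln_div by lra. ring.
Qed.

Lemma XT_pow theta T s : 0 < T ->
  T * Rpower (XT theta T) s = Rpower (2 * PI) (theta * - s) * Rpower T (1 - theta * - s).
Proof.
  intros HT. rewrite <- (Rpower_1 T) at 1 by auto. unfold Rpower.
  rewrite ln_XT, <- !exp_plus by auto. f_equal. ring.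
Qed.

(** Off-diagonal and diagonal errors become the two terms of [err]: [X sqrt T <= T^{1/2 + theta}],
    and [T X^{-1/2} = (2 PI)^{theta/2} T^{1 - theta/2}]. The threshold [2 PI] ensures [X >= 1] and,
    exceeding [exp 1], also [ln T >= 1]. *)
Lemma M11_of_Vd b c theta V0 K1 : (2 <= b)%nat -> (2 <= c)%nat -> 0 < theta <= 1 / 2 ->
  0 < K1 -> (forall X, 1 <= X -> Rabs (Vd b c (/ theta) X - V0 X) <= K1 * Rpower X (- (1 / 2))) ->
  exists K T0, 0 < T0 /\ forall T, T0 <= T ->
    Cmod (Cminus (M11 theta (INR b) (INR c) T) (RtoC (T * V0 (XT theta T)))) <= K * err theta T.
Proof.
  intros Hb Hc Hth HK1 HV. assert (P4 := PI2_3_2).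
  destruct (offdiag_bound b c theta Hb Hc Hth) as [K2 [HK2 HO]].
  set (w := Rpower (2 * PI) (theta / 2)). assert (Hw : 0 < w) by apply Rpower_pos.
  exists (K2 + K1 * w), (2 * PI). split; [lra|]. intros T HT.
  assert (HX := XT_ge1 theta T ltac:(lra) HT).
  specialize (HO T ltac:(lra)). specialize (HV _ HX).
  rewrite Dg_Vd in HO by lra. set (X := XT theta T) in *.
  replace (Cminus (M11 theta (INR b) (INR c) T) (RtoC (T * V0 X))) with
    (Cplus (Cminus (M11 theta (INR b) (INR c) T) (RtoC (T * Vd b c (/ theta) X)))
       (RtoC (T * (Vd b c (/ theta) X - V0 X)))).
  2:{ apply injective_projections; simpl; ring. }
  eapply Rle_trans; [apply Cmod_triangle|]. rewrite Cmod_R, Rabs_mult, (Rabs_pos_eq T) by lra.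
  assert (L : 1 <= ln T).
  { rewrite <- (ln_exp 1). apply ln_le; [apply exp_pos|]. assert (E := exp_le_3). lra. }
  assert (L2 : 1 <= Rpower (ln T) (13 / 4)) by (apply Rpower_ge1; lra).
  assert (B1 : X * sqrt T <= Rpower T (1 / 2 + theta)).
  { rewrite <- Rpower_sqrt, (Rplus_comm (1 / 2)), Rpower_plus by lra.
    replace (/ 2) with (1 / 2) by field.
    apply Rmult_le_compat_r; [apply Rlt_le, Rpower_pos|].
    unfold X, XT. apply Rpower_le_base; [|lra]. split; [apply Rdiv_lt_0_compat; lra|].
    apply Rle_div_l; [lra|]. rewrite <- (Rmult_1_r T) at 1. apply Rmult_le_compat_l; lra. }
  assert (PT := Rpower_pos T (1 - theta / 2)).
  assert (B2 : T * Rabs (Vd b c (/ theta) X - V0 X) <= K1 * (w * Rpower T (1 - theta / 2))).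
  { apply Rle_trans with (T * (K1 * Rpower X (- (1 / 2)))); [apply Rmult_le_compat_l; lra|].
    rewrite <- Rmult_assoc, (Rmult_comm T), Rmult_assoc. unfold X. rewrite XT_pow by lra.
    replace (theta * - - (1 / 2)) with (theta / 2) by field. fold w. lra. }
  assert (B3 : Rpower T (1 - theta / 2) <= Rpower T (1 - theta / 2) * Rpower (ln T) (13 / 4)).
  { rewrite <- (Rmult_1_r (Rpower T (1 - theta / 2))) at 1. apply Rmult_le_compat_l; lra. }
  assert (PT2 := Rpower_pos T (1 / 2 + theta)).
  assert (Hkw : 0 < K1 * w) by (apply Rmult_lt_0_compat; lra).
  assert (C1 := Rmult_le_compat_l K2 _ _ ltac:(lra) B1).
  assert (C2 := Rmult_le_compat_l (K1 * w) _ _ ltac:(lra) B3).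
  assert (C3 : 0 < (K1 * w) * Rpower T (1 / 2 + theta)) by (apply Rmult_lt_0_compat; lra).
  assert (C4 : 0 < K2 * (Rpower T (1 - theta / 2) * Rpower (ln T) (13 / 4))).
  { apply Rmult_lt_0_compat; [lra|]. apply Rmult_lt_0_compat; lra. }
  unfold err. rewrite Rmult_plus_distr_l, !Rmult_plus_distr_r. lra.
Qed.

Lemma sx_bounds c : (2 <= c)%nat -> - (1 / 2) < sx c < 0.
Proof.
  intros Hc. assert (C1 : 2 <= INR c) by (apply (le_INR 2); auto). unfold sx.
  replace (1 / (2 * INR c)) with (/ 2 * / INR c) by (field; lra).
  assert (0 < / INR c) by (apply Rinv_0_lt_compat; lra).
  assert (/ INR c <= / 2) by (apply Rinv_le_contravar; lra). lra.
Qed.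

Lemma lambda_den theta r : 0 < theta <= 1 / 2 -> 2 <= r ->
  0 < r * 2 - theta * r + theta /\ 0 < lambda_theta theta * r + 1.
Proof.
  intros Hth Hr. assert (theta * r <= 1 / 2 * r) by (apply Rmult_le_compat_r; lra). split; [lra|].
  unfold lambda_theta. replace ((2 / theta - 1) * r + 1) with ((r * 2 - theta * r + theta) / theta) by (field; lra).
  apply Rdiv_lt_0_compat; lra.
Qed.

(** The factor [q/(q + s)], which comes from integrating [q x^{q+s-1}], is the origin of
    [lambda_theta] in the constants. *)
Lemma ratio_lambda theta c : 0 < theta <= 1 / 2 -> 2 <= INR c ->
  / theta / (/ theta + sx c) = 2 * INR c / (theta * (lambda_theta theta * INR c + 1)).
Proof.
  intros Hth Hr. destruct (lambda_den theta (INR c) Hth Hr) as [L1 L2].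
  unfold sx, lambda_theta in *. field. repeat split; try lra.
Qed.

Theorem theorem1p5 (b c : nat) (theta : R) (Htheta0 : 0 < theta) (Htheta1 : theta <= 1 / 2) :
  ((1 < c)%nat -> (c < b)%nat ->
   exists (K T0 : R), forall T : R, T0 <= T ->
     Cmod (Cminus (M11 theta (INR b) (INR c) T)
       (RtoC (T * Kpoly theta (INR b) (INR c) (ln T)
              - C1' theta (INR c) (INR b) * Rpower T (1 - theta * (1 / 2 - 1 / (2 * INR c)))
              - C1' theta (INR b) (INR c) * Rpower T (1 - theta * (1 / 2 - 1 / (2 * INR b))))))
     <= K * err theta T)
  /\
  ((1 < b)%nat ->
   exists (K T0 : R), forall T : R, T0 <= T ->
     Cmod (Cminus (M11 theta (INR b) (INR b) T)
       (RtoC (T * Kpoly theta (INR b) (INR b) (ln T)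
              - Gpoly theta (INR b) (ln T) * Rpower T (1 - theta * (1 / 2 - 1 / (2 * INR b))))))
     <= K * err theta T).
Proof.
  assert (Hq : 1 <= / theta) by (rewrite <- Rinv_1; apply Rinv_le_contravar; lra).
  (* In terms of [sx] the secondary powers of [T] are [1 + theta sx] and the zeta arguments
     [1 + sx]. *)
  assert (Esx : forall n, 1 / 2 - 1 / (2 * INR n) = - sx n) by (intros; unfold sx; ring).
  assert (Esx1 : forall n, 1 / 2 + 1 / (2 * INR n) = 1 + sx n) by (intros; unfold sx; lra).
  split.
  - intros Hc Hcb.
    assert (b1 : 2 <= INR b) by (apply (le_INR 2); lia).
    assert (c1 : 2 <= INR c) by (apply (le_INR 2); lia).
    destruct (Hs_gen b c ltac:(lia) ltac:(lia) ltac:(lia)) as [C0 [HC0 H0]].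
    destruct (Vd_eval b c (/ theta) (sx c) (sx b) (zetaR (alp b c) / (1 - al c)) (zetaR (alp c b) / (1 - al b)) 0 C0)
      as [Kv [HKv HV]]; try lia; try lra; try (apply sx_bounds; lia).
    { intros x Hx. specialize (H0 x Hx). unfold Rgen in H0. rewrite Rmult_0_l, Rplus_0_r. exact H0. }
    destruct (M11_of_Vd b c theta _ Kv ltac:(lia) ltac:(lia) ltac:(lra) HKv HV) as [K [T0 [HT0 HM]]].
    exists K, T0. intros T HT. specialize (HM T HT).
    replace (T * Kpoly theta (INR b) (INR c) (ln T)
       - C1' theta (INR c) (INR b) * Rpower T (1 - theta * (1 / 2 - 1 / (2 * INR c)))
       - C1' theta (INR b) (INR c) * Rpower T (1 - theta * (1 / 2 - 1 / (2 * INR b)))) with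
      (T * Vmain b c (/ theta) (sx c) (sx b) (zetaR (alp b c) / (1 - al c)) (zetaR (alp c b) / (1 - al b)) 0 (XT theta T)); auto.
    unfold Vmain, C1', Defs.C1. rewrite !Esx, !Esx1.
    replace (INR b / (2 * INR c) + 1 / 2) with (alp b c) by (unfold alp; lra).
    replace (INR c / (2 * INR b) + 1 / 2) with (alp c b) by (unfold alp; lra).
    replace (zetaR (alp b c) / (1 - al c) * / theta / (/ theta + sx c)) with
      (zetaR (alp b c) / (1 - al c) * (/ theta / (/ theta + sx c))) by (unfold Rdiv; ring).
    replace (zetaR (alp c b) / (1 - al b) * / theta / (/ theta + sx b)) with
      (zetaR (alp c b) / (1 - al b) * (/ theta / (/ theta + sx b))) by (unfold Rdiv; ring).
    rewrite !ratio_lambda by lra.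
    rewrite ln_XT by lra.
    assert (W1 := XT_pow theta T (sx c) ltac:(lra)). assert (W2 := XT_pow theta T (sx b) ltac:(lra)).
    destruct (lambda_den theta (INR b) ltac:(lra) b1) as [L1 L2].
    destruct (lambda_den theta (INR c) ltac:(lra) c1) as [L3 L4].
    set (u1 := Rpower (XT theta T) (sx c)) in *. set (u2 := Rpower (XT theta T) (sx b)) in *.

    set (Z1 := zetaR (1 + sx c)). set (Z2 := zetaR (1 + sx b)).
    set (Y1 := zetaR (alp b c)). set (Y2 := zetaR (alp c b)).
    unfold Kpoly, Bcoef, K1. fold (al b) (al c).
    set (lam := lambda_theta theta) in *.
    (* The minus sign of the secondary terms comes from [1 - al r = - (r - 1)/2]. *)
    assert (EQ : forall r Y Z u v w, 2 <= INR r -> T * u = v * w -> 0 < lam * INR r + 1 ->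
      Z * (4 * INR r / (theta * (INR r - 1) * (lam * INR r + 1)) * Y * v) * w =
      - (T * (Y / (1 - al r) * (2 * INR r / (theta * (lam * INR r + 1))) * Z * u))).
    { intros r Y Z u v w Hr Hu Hl.
      transitivity (Z * (4 * INR r / (theta * (INR r - 1) * (lam * INR r + 1)) * Y) * (v * w)); [ring|].
      rewrite <- Hu. unfold al. field. repeat split; lra. }
    rewrite (EQ c Y1 Z1 u1), (EQ b Y2 Z2 u2) by auto. rewrite Rmult_0_l. field. unfold al; lra.
  - intros Hb.
    assert (b1 : 2 <= INR b) by (apply (le_INR 2); lia).
    destruct (Hs_eq b ltac:(lia)) as [C0 [HC0 H0]].
    (* The two exponents coincide; [Rdbl] supplies the coefficient [a1] of the power and [a3] of the
       logarithmic term. *)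
    destruct (Vd_eval b b (/ theta) (sx b) (sx b) (2 * euler_gamma / (1 - al b) - / (1 - al b) ^ 2) 0
      (/ (INR b * (1 - al b))) C0) as [Kv [HKv HV]]; try lia; try lra; try (apply sx_bounds; lia).
    { intros x Hx. specialize (H0 x Hx). unfold Rdbl in H0.
      rewrite Rmult_0_l, Rplus_0_r, (Rplus_comm (_ * Rpower x (sx b))). exact H0. }
    destruct (M11_of_Vd b b theta _ Kv ltac:(lia) ltac:(lia) ltac:(lra) HKv HV) as [K [T0 [HT0 HM]]].
    exists K, T0. intros T HT. specialize (HM T HT).
    match type of HM with context [RtoC ?e] => replace
      (T * Kpoly theta (INR b) (INR b) (ln T)
       - Gpoly theta (INR b) (ln T) * Rpower T (1 - theta * (1 / 2 - 1 / (2 * INR b)))) with e; auto end.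
    unfold Vmain, Gpoly, H0', H1', E0', F0', E1', F1', E0, Defs.E1, F0, F1. rewrite !Esx, !Esx1.
    set (g := / theta / (/ theta + sx b)).
    (* With [q = 1/theta] this is [q/(q + s)^2 = theta (q/(q + s))^2], the source of the squared
       denominator [lam r + 1]. *)
    assert (Eg : / theta / (/ theta + sx b) ^ 2 = theta * g ^ 2).
    { unfold g. field. destruct (sx_bounds b ltac:(lia)). split; [lra|].
      assert (theta * - sx b <= 1 / 2 * - sx b) by (apply Rmult_le_compat_r; lra). lra. }
    rewrite Eg.
    replace ((2 * euler_gamma / (1 - al b) - / (1 - al b) ^ 2) * / theta / (/ theta + sx b)) with
      ((2 * euler_gamma / (1 - al b) - / (1 - al b) ^ 2) * g) by (unfold g, Rdiv; ring).
    unfold g. rewrite ratio_lambda by lra. clear g Eg.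
    rewrite ln_XT by lra.
    assert (W1 := XT_pow theta T (sx b) ltac:(lra)).
    destruct (lambda_den theta (INR b) ltac:(lra) b1) as [L1 L2].
    set (v1 := Rpower (2 * PI) (theta * - sx b)) in *.
    set (w1 := Rpower T (1 - theta * - sx b)) in *.
    unfold Kpoly, Bcoef, K1. fold (al b).
    rewrite (Rmult_comm (INR b) (lambda_theta theta)).
    set (lam := lambda_theta theta) in *.
    match goal with |- _ = _ - v1 * ?e * w1 => transitivity (T * (zetaR (al b) * zetaR (al b)
      * (theta * (ln T - ln (2 * PI)) + euler_gamma - theta) + (INR b * zetaR' (al b) * zetaR (al b)
       + INR b * zetaR (al b) * zetaR' (al b))) - (v1 * w1) * e); [|ring] end.
    rewrite <- W1. replace (1 - al b) with (- ((INR b - 1) / 2)) by (unfold al; field).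
    (* The relation [lam + 1 = 2/theta] is what merges the [E] and [F] parts, with denominators
       [r - 1] and [lam r + 1], into a single fraction. *)
    rewrite Rmult_0_l, Rdiv_0_l. unfold lam, lambda_theta in *. field.
    repeat split; try lra.
Qed.
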